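(* Let $1<p<\infty$ and $0<\alpha<\infty$. Then: (1) $A^p_{\alpha+}$ is a Fréchet-Schwartz space; (2) $A^p_{\alpha-}$ is a (DFS)-space.
   Context: $\mathbb{D}=\{z\in\mathbb{C}:|z|<1\}$, $H(\mathbb{D})$ is the space of all analytic functions on $\mathbb{D}$, and $\mathbb{N}=\{1,2,\dots\}$. For $1<p<\infty$ and $0<\mu<\infty$, the weighted Bergman space $A^p_\mu$ is the Banach space of all $f\in H(\mathbb{D})$ with $\|f\|_{p,\mu}:=\left(\int_{\mathbb{D}}|f(z)|^p(1-|z|)^\mu\,ds(z)\right)^{1/p}<\infty$, where $ds(z)=\frac1\pi\,dx\,dy$. For $0<\alpha<\infty$, $A^p_{\alpha+}:=\bigcap_{\mu>\alpha}A^p_\mu=\bigcap_{n\in\mathbb{N}}A^p_{\alpha+1/n}$, a Fréchet space with the topology generated by the increasing sequence of norms $\|\cdot\|_{p,\alpha+1/n}$, $n\in\mathbb{N}$. For $0<\alpha<\infty$, $A^p_{\alpha-}:=\bigcup_{0<\mu<\alpha}A^p_\mu=\bigcup_{n\in\mathbb{N},\,n>1/\alpha}A^p_{\alpha-1/n}$, with the finest locally convex topology for which all inclusions $A^p_\mu\hookrightarrow A^p_{\alpha-}$, $0<\mu<\alpha$, are continuous (i.e. the (LB)-space that is the inductive limit of the Banach spaces $A^p_{\alpha-1/n}$). A Fréchet-Schwartz space is a Fréchet space that is a Schwartz space. A (DFS)-space is a locally convex space isomorphic to the strong dual of a Fréchet-Schwartz space. *)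

(* Defs.v *)
From HB Require Import structures.
From mathcomp Require Import all_boot all_order all_algebra.
From mathcomp Require Import all_classical all_reals all_analysis.
From mathcomp Require Import measurable_realfun complex ring lra.

Set Implicit Arguments.
Unset Strict Implicit.
Unset Printing Implicit Defensive.
Import Order.TTheory GRing.Theory Num.Theory.
Import numFieldNormedType.Exports.
Local Open Scope classical_set_scope.
Local Open Scope ring_scope.

Section absolutely_convex.
Variables (K : numFieldType) (E : lmodType K).
Implicit Types (U V : set E) (x : E).

Definition balanced U := forall (a : K) x, `|a| <= 1 -> U x -> U (a *: x).

Definition absconvex U := convex_set (U : set (convex_lmodType E)) /\ balanced U.

(* for balanced sets this is the usual notion *)
Definition absorbing U := forall x, exists2 r : K, 0 < r & U (r *: x).

Record lcbase := LCBase {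
  lcb_sets :> set E -> Prop ;
  lcb_neq0 : exists U, lcb_sets U ;
  lcb_absconvex : forall U, lcb_sets U -> absconvex U ;
  lcb_absorbing : forall U, lcb_sets U -> absorbing U ;
  lcb_setI : forall U V, lcb_sets U -> lcb_sets V ->
    exists2 W, lcb_sets W & W `<=` U `&` V ;
  lcb_scale : forall U (r : K), lcb_sets U -> 0 < r ->
    exists2 W, lcb_sets W & forall x, W x -> U (r *: x) }.

Lemma absconvexD U x y (s t : K) : absconvex U -> U x -> U y ->
  0 <= s -> 0 <= t -> s + t = 1 -> U (s *: x + t *: y).
Proof.
move=> [cU _] Ux Uy s0 t0 st1.
have s1 : s <= 1 by rewrite -st1 lerDl.
have := cU x y (Itv01 s0 s1); rewrite !inE => /(_ Ux Uy).
suff -> : t = 1 - s by [].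
by rewrite -st1 addrC addKr.
Qed.

Lemma absconvex0 U : absconvex U -> absorbing U -> U 0.
Proof.
by move=> [_ bU] /(_ 0)[r _]; rewrite scaler0.
Qed.

Definition lctype (B : lcbase) : Type := E.

End absolutely_convex.

Section lctype_tvs.
Variables (K : numFieldType) (E : lmodType K) (B : lcbase E).

HB.instance Definition _ := GRing.Lmodule.on (lctype B).

Definition lc_nbhs (x : lctype B) : set_system (lctype B) :=
  [set A | exists2 U : set E, B U & forall u, U u -> A (x + u)].

HB.instance Definition _ := hasNbhs.Build (lctype B) lc_nbhs.

Let lc_nbhs_filter (x : lctype B) : ProperFilter (nbhs x).
Proof.
split.
  move=> [U BU] /(_ 0); apply.
  exact: absconvex0 (lcb_absconvex BU) (lcb_absorbing BU).
split.
- by have [U BU] := lcb_neq0 B; exists U.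
- move=> P Q [U BU UP] [V BV VQ]; have [W BW WUV] := lcb_setI BU BV.
  by exists W => // w /WUV[/UP ? /VQ ?].
- by move=> P Q PQ [U BU UP]; exists U => // u /UP/PQ.
Qed.

Let lc_nbhs_singleton (x : lctype B) (A : set (lctype B)) : nbhs x A -> A x.
Proof.
move=> [U BU /(_ 0)]; rewrite addr0; apply.
exact: absconvex0 (lcb_absconvex BU) (lcb_absorbing BU).
Qed.

Let lcb_half U : B U -> exists2 W, B W & forall x y, W x -> W y -> U (x + y).
Proof.
move=> BU; have [W BW WU] := @lcb_scale _ _ B _ 2 BU ltac:(by []).
exists W => // x y /WU Ux /WU Uy.
have := @absconvexD _ _ U _ _ (2^-1) (2^-1) (lcb_absconvex BU) Ux Uy.
rewrite !scalerA mulVf ?pnatr_eq0// !scale1r; apply.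
- by rewrite invr_ge0.
- by rewrite invr_ge0.
- by rewrite -mulr2n -[_ *+ 2]mulr_natl mulfV ?pnatr_eq0.
Qed.

Let lc_nbhs_nbhs (x : lctype B) (A : set (lctype B)) :
  nbhs x A -> nbhs x (nbhs^~ A).
Proof.
move=> [U BU UA]; have [W BW WU] := lcb_half BU.
exists W => // u Wu; exists W => // v Wv.
by rewrite -addrA; apply: UA; exact: WU.
Qed.

HB.instance Definition _ := Nbhs_isNbhsTopological.Build (lctype B)
  lc_nbhs_filter lc_nbhs_singleton lc_nbhs_nbhs.

Let lc_add : continuous (fun x : lctype B * lctype B => x.1 + x.2).
Proof.
move=> [x y] A /= [U BU UA]; have [W BW WU] := lcb_half BU.
exists ([set x + w | w in W], [set y + w | w in W]) => /=.
  by split; exists W => // w Ww; exists w.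
move=> [_ _] /= [[u Wu <-] [v Wv <-]].
by rewrite addrACA; apply: UA; exact: WU.
Qed.

Let lc_scale : continuous (fun z : K^o * lctype B => z.1 *: z.2).
Proof.
move=> [a x] A /= [U BU UA]; have [W BW WU] := lcb_half BU.
have [r r0 Wrx] := lcb_absorbing BW x.
have a1 : 0 < `|a| + r by rewrite ltr_wpDl.
have [V BV VW] := lcb_scale BW a1.
have balW := (lcb_absconvex BW).2.
exists ([set b | `|a - b| < r], [set x + v | v in V]) => /=.
  split; last by exists V => // v Vv; exists v.
  by apply/nbhs_ballP; exists r => // b /=; rewrite -ball_normE.
move=> [b _] /= [abr [v Vv <-]].
have -> : b *: (x + v) = a *: x + ((b - a) *: x + b *: v).
  by rewrite scalerDr scalerBl !addrA [a *: x + _]addrC addrK.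
apply/UA/WU.
- have -> : (b - a) *: x = ((b - a) / r) *: (r *: x).
    by rewrite scalerA mulfVK// gt_eqF.
  apply: balW => //.
  by rewrite normrM normfV (gtr0_norm r0) distrC ler_pdivrMr// mul1r ltW.
- have -> : b *: v = (b / (`|a| + r)) *: ((`|a| + r) *: v).
    by rewrite scalerA mulfVK// gt_eqF.
  apply: balW; last exact: VW.
  rewrite normrM normfV (gtr0_norm a1) ler_pdivrMr// mul1r.
  by rewrite -[b](subKr a) (le_trans (ler_normB _ _))// lerD2l ltW.
Qed.

Let lc_locally_convex : exists2 D : set_system (lctype B),
  (forall b, b \in D -> convex_set b) & basis D.
Proof.
exists [set b | open b /\ convex_set (b : set (convex_lmodType (lctype B)))].
  by move=> b; rewrite inE => -[].
split; first by move=> b [].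
move=> x A [U BU UA].
pose D : set (lctype B) := [set y : lctype B | nbhs y [set x + u | u in U]].
have DA : D `<=` A.
  move=> y /lc_nbhs_singleton [u Uu <-]; exact: UA.
exists D => //; split; last by exists U => // u Uu; exists u.
split.
  rewrite openE => y; exact: lc_nbhs_nbhs.
move=> y z t; rewrite !inE => -[V BV Vy] [W BW Wz].
have [S BS SVW] := lcb_setI BV BW.
exists S => // s Ss.
have [u Uu ue] := Vy s (SVW s Ss).1.
have [v Uv ve] := Wz s (SVW s Ss).2.
have cU := (lcb_absconvex BU).1.
exists (t%:num *: u + (1 - t%:num) *: v).
  by have := cU u v t; rewrite !inE; apply.
rewrite -[in LHS](convmm t (x : convex_lmodType (lctype B))).
rewrite -[in RHS](convmm t (s : convex_lmodType (lctype B))).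
rewrite /conv/= addrACA -!scalerDr ue ve.
by rewrite !scalerDr addrACA.
Qed.

HB.instance Definition _ := PreTopologicalLmod_isTvs.Build K (lctype B)
  lc_add lc_scale lc_locally_convex.
(* the previous factory only builds the uniform structure *)
HB.instance Definition _ :=
  PreTopologicalNmodule_isTopologicalNmodule.Build (lctype B) lc_add.
HB.instance Definition _ :=
  TopologicalNmodule_isTopologicalLmodule.Build K (lctype B) lc_scale.
HB.instance Definition _ := Uniform_isTvs.Build K (lctype B) lc_locally_convex.

End lctype_tvs.

Section absconvex_nbhs.
Variables (K : numFieldType) (E : tvsType K).

Lemma nbhs0_absconvex (U : set E) : nbhs 0 U ->
  exists V : set E, [/\ nbhs 0 V, absconvex V & V `<=` U].
Proof.
move=> U0; have [B Bconv [Bo Bb]] := @locally_convex K E.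
have [V [BV V0] VU] := Bb 0 U U0.
have nV : nbhs (0 : E) V by apply: open_nbhs_nbhs; split=> //; exact: Bo.
have cV := Bconv V (mem_set BV).
exists [set x | forall a : K, `|a| <= 1 -> V (a *: x)]; split; last first.
- by move=> x /(_ 1); rewrite normr1 scale1r => /(_ (lexx _))/VU.
- split.
    move=> x y t; rewrite !inE => Wx Wy a a1.
    have := cV (a *: x) (a *: y) t; rewrite !inE => /(_ (Wx _ a1) (Wy _ a1)).
    by rewrite /conv/= scalerDr !scalerA ![a * _]mulrC.
  move=> a x a1 Wx b b1; rewrite scalerA; apply: Wx.
  by rewrite normrM mulr_ile1.
have := @scale_continuous K E (0, 0) V; rewrite /= scaler0 => /(_ nV).
move=> [[N1 N2]] /= [/nbhs_ballP[d /= d0 dN1] nN2] N12.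
have d20 : d / 2 != 0 by rewrite mulf_neq0 ?gt_eqF// invr_neq0// pnatr_eq0.
apply: filterS (nbhs0Z d20 nN2) => _ [x N2x <-] a a1.
rewrite scalerA; apply: (N12 (a * (d / 2), x)); split => //=.
apply: dN1; rewrite -ball_normE/= sub0r normrN normrM.
rewrite (@ger0_norm _ (d / 2)) ?divr_ge0 ?ltW//.
rewrite (le_lt_trans (_ : _ <= d / 2))//.
  by rewrite ler_piMl// divr_ge0 ?ltW.
by rewrite ltr_pdivrMr// mulr_natr mulr2n ltrDr.
Qed.

End absconvex_nbhs.

Section classes.
Variables (R : realType) (E : tvsType R[i]).
Implicit Types (U V : set E).

Definition metrizable := exists d : E -> E -> R,
  [/\ forall x y, d x y = 0 <-> x = y,
      forall x y, d x y = d y x,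
      forall x y z, d x z <= d x y + d y z &
      forall x (A : set E),
        nbhs x A <-> exists2 e : R, 0 < e & [set y | d x y < e] `<=` A].

(* Completeness refers to the translation-invariant uniformity: a [tvsType]
   does not relate its entourages to the vector space structure. *)
Definition tvs_cauchy (F : set_system E) := forall U, nbhs 0 U ->
  exists2 A, F A & forall x y, A x -> A y -> U (x - y).

Definition tvs_complete := forall F : set_system E,
  ProperFilter F -> tvs_cauchy F -> exists x : E, F --> x.

Definition frechet_space := metrizable /\ tvs_complete.

Definition schwartz_space := forall U, nbhs 0 U ->
  exists2 V, nbhs 0 V &
    forall e : R[i], 0 < e -> exists2 F : set E, finite_set F &
      V `<=` [set x + e *: u | x in F & u in U].

Definition frechet_schwartz_space := frechet_space /\ schwartz_space.

Definition tvs_bounded U := forall V, nbhs 0 V ->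
  exists2 r : R[i], 0 < r & U `<=` [set r *: v | v in V].

End classes.

Section strong_dual.
Variables (R : realType) (E : tvsType R[i]).

Definition dual_pred : {pred E -> R[i]^o} :=
  [pred f : E -> R[i]^o | `[< linear f /\ continuous f >]].

Let dual_submod_closed : submod_closed dual_pred.
Proof.
split.
  apply/asboolP; split; first by move=> a x y; rewrite scaler0 addr0.
  by move=> x; exact: cvg_cst.
move=> a f g /asboolP[lf cf] /asboolP[lg cg]; apply/asboolP; split.
  move=> b x y; rewrite !fctE lf lg !scalerDr !scalerA [b * a]mulrC.
  by rewrite addrACA.
by move=> x; apply: cvgD; [apply: cvgZr; exact: cf | exact: cg].
Qed.

HB.instance Definition _ :=
  GRing.isSubmodClosed.Build _ _ dual_pred dual_submod_closed.

Definition dual : Type := {f : E -> R[i]^o | f \in dual_pred}.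

HB.instance Definition _ := SubChoice.on dual.
HB.instance Definition _ := [SubChoice_isSubLmodule of dual by <:].

Definition strong_dual_base (W : set dual) : Prop :=
  exists (A : set E) (e : R[i]), [/\ tvs_bounded A, 0 < e &
    W = [set f | forall x, A x -> `|val f x| <= e]].

Let sd_neq0 : exists W, strong_dual_base W.
Proof.
exists [set f | forall x, set0 x -> `|val f x| <= 1], set0, 1; split => //.
by move=> V _; exists 1.
Qed.

Let sd_absconvex W : strong_dual_base W -> absconvex W.
Proof.
move=> [A [e [_ e0 ->]]]; split.
  move=> f g t; rewrite !inE => Wf Wg x Ax /=.
  have t0 : 0 <= t%:num by [].
  have t1 : 0 <= 1 - t%:num by rewrite subr_ge0.
  change (`|t%:num * (val f x : R[i]) + (1 - t%:num) * val g x| <= e).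
  rewrite (le_trans (ler_normD _ _))// !normrM (ger0_norm t0) (ger0_norm t1).
  rewrite (le_trans (lerD (ler_wpM2l t0 (Wf x Ax)) (ler_wpM2l t1 (Wg x Ax))))//.
  by rewrite -mulrDl subrKC mul1r.
move=> a f a1 Wf x Ax.
change (`|a * (val f x : R[i])| <= e).
by rewrite normrM (le_trans (ler_wpM2r _ a1))// mul1r Wf.
Qed.

Let sd_absorbing W : strong_dual_base W -> absorbing W.
Proof.
move=> [A [e [bA e0 ->]]] f; have [lf cf] : linear (val f) /\ continuous (val f).
  by have := valP f; rewrite inE.
have f0 : val f 0 = 0 by have := lf (-1) 0 0; rewrite scaler0 addr0 scaleN1r addNr.
have nf : nbhs (0 : E) [set x | `|val f x| <= 1].
  have := cf 0 [set y | `|y| <= 1]; rewrite f0; apply.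
  apply/nbhs_ballP; exists 1 => //= y; rewrite -ball_normE/= sub0r normrN.
  exact: ltW.
have [r r0 Ar] := bA _ nf.
exists (e / r); first by rewrite divr_gt0.
move=> x /Ar[y fy <-] /=.
change (`|(e / r) * (val f (r *: y) : R[i])| <= e).
have -> : val f (r *: y) = r *: val f y.
  by have := lf r y 0; rewrite addr0 f0 addr0.
rewrite [X in `|X|](_ : _ = e * val f y); last first.
  by rewrite [LHS]mulrA mulfVK// gt_eqF.
by rewrite normrM gtr0_norm// ler_piMr// ltW.
Qed.

Let sd_setI U V : strong_dual_base U -> strong_dual_base V ->
  exists2 W, strong_dual_base W & W `<=` U `&` V.
Proof.
move=> [A [e [bA e0 ->]]] [B [d [bB d0 ->]]].
pose m := (e * d) / (e + d).
have ed0 : 0 < e + d by rewrite addr_gt0.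
exists [set f | forall x, (A `|` B) x -> `|val f x| <= m].
  exists (A `|` B), m; split => //; last by rewrite divr_gt0 ?mulr_gt0.
  move=> N /nbhs0_absconvex[P [nP [_ balP] PN]].
  have [r r0 Ar] := bA _ nP; have [s s0 Bs] := bB _ nP.
  have rs0 : 0 < r + s by rewrite addr_gt0.
  exists (r + s) => // x ABx.
  have [t [y [Py t0 tle <-]]] : exists t y, [/\ P y, 0 < t, t <= r + s &
      t *: y = x].
    case: ABx => [/Ar|/Bs] [y Py <-]; [exists r, y|exists s, y].
      by split => //; rewrite lerDl ltW.
    by split => //; rewrite lerDr ltW.
  exists ((t / (r + s)) *: y).
    apply/PN/balP => //; rewrite ger0_norm; last by rewrite divr_ge0 ?ltW.
    by rewrite ler_pdivrMr// mul1r.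
  by rewrite scalerA mulrC mulfVK// gt_eqF.
move=> f Wf; split=> x /= xP.
  apply: (le_trans (Wf x (or_introl xP))).
  by rewrite /m ler_pdivrMr// ler_pM2l// lerDr ltW.
apply: (le_trans (Wf x (or_intror xP))).
by rewrite /m ler_pdivrMr// mulrC ler_pM2l// lerDl ltW.
Qed.

Let sd_scale U (r : R[i]) : strong_dual_base U -> 0 < r ->
  exists2 W, strong_dual_base W & forall x, W x -> U (r *: x).
Proof.
move=> [A [e [bA e0 ->]]] r0.
exists [set f | forall x, A x -> `|val f x| <= e / r].
  by exists A, (e / r); split => //; rewrite divr_gt0.
move=> f Wf x /Wf /=; rewrite ler_pdivlMr// => h.
change (`|r * (val f x : R[i])| <= e).
by rewrite normrM (gtr0_norm r0) mulrC.
Qed.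

Definition strong_dual_lcbase :=
  LCBase sd_neq0 sd_absconvex sd_absorbing sd_setI sd_scale.

Definition strong_dual : Type := lctype strong_dual_lcbase.

HB.instance Definition _ := Tvs.copy strong_dual (lctype strong_dual_lcbase).

End strong_dual.

Definition dfs_space (R : realType) (E : tvsType R[i]) :=
  exists (F : tvsType R[i]) (u : {linear E -> strong_dual F})
    (v : strong_dual F -> E),
    [/\ frechet_schwartz_space F, cancel u v, cancel v u,
        continuous u & continuous v].

Notation normc := ComplexField.Normc.normc.

Section bergman_spaces.
Variable R : realType.
Local Notation C := R[i].
Implicit Types (f g : C -> C^o) (p mu : R).

Definition disc : set C := [set z | normc z < 1].

Definition analytic_at f (c : C) := exists (a : nat -> C^o) (r : R), 0 < r /\
  forall z : C, normc (z - c) < r ->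
    series (fun n => a n * (z - c) ^+ n) @ \oo --> f z.

(* H(D): a function on the disc is encoded by its extension by 0. *)
Definition holo_disc f :=
  (forall c, disc c -> analytic_at f c) /\ (forall z, ~ disc z -> f z = 0).

Definition area := (@lebesgue_measure R \x @lebesgue_measure R)%E.

Definition disc2 : set (R * R) := [set xy | disc (xy.1 +i* xy.2)%C].

Definition bergman_integrand p mu f (xy : R * R) : R :=
  let z : C := (xy.1 +i* xy.2)%C in normc (f z) `^ p * (1 - normc z) `^ mu.

(* the p-th power of the norm *)
Definition bergman_modular p mu f : \bar R :=
  ((pi^-1)%:E * \int[area]_(xy in disc2) (bergman_integrand p mu f xy)%:E)%E.

Definition bergman_norm p mu f : \bar R := (bergman_modular p mu f `^ p^-1)%E.

Definition bergman p mu f := holo_disc f /\ (bergman_norm p mu f < +oo)%E.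

Lemma normcE (z : C) : (normc z)%:C%C = `|z|. Proof. by []. Qed.

Lemma normc_ge0 (z : C) : 0 <= normc z.
Proof. by rewrite -lecR normcE; exact: normr_ge0. Qed.

Lemma normcD (z w : C) : normc (z + w) <= normc z + normc w.
Proof. by rewrite -lecR rmorphD/= !normcE ler_normD. Qed.

Lemma normcN (z : C) : normc (- z) = normc z.
Proof.
have h : (normc (- z))%:C%C = (normc z)%:C%C by rewrite !normcE normrN.
by case: h.
Qed.

Lemma normc_real (r : R) : 0 <= r -> normc r%:C%C = r.
Proof.
by move=> r0 /=; rewrite expr0n/= addr0 sqrtr_sqr ger0_norm.
Qed.

Lemma normcM (z w : C) : normc (z * w) = normc z * normc w.
Proof. exact: ComplexField.Normc.normcM. Qed.

Lemma normc_le_ReIm (x y : R) : normc (x +i* y)%C <= `|x| + `|y|.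
Proof.
rewrite /= -[leRHS]ger0_norm ?addr_ge0// -sqrtr_sqr ler_wsqrtr//.
rewrite sqrrD !real_normK ?num_real//.
have : 0 <= `|x| * `|y| by rewrite mulr_ge0.
by rewrite -mulr_natl; lra.
Qed.

Lemma analytic_lin f g (c b : C) : analytic_at f c -> analytic_at g c ->
  analytic_at (b *: f + g) c.
Proof.
move=> [u [r [r0 fu]]] [v [s [s0 gv]]].
exists (fun n => b * u n + v n), (Num.min r s); split.
  by rewrite lt_min r0.
move=> z; rewrite lt_min => /andP[zr zs].
have -> : series (fun n : nat => (b * u n + v n) * (z - c) ^+ n) =
  (fun n => b *: (series (fun n : nat => u n * (z - c) ^+ n : C^o) n) +
     series (fun n : nat => v n * (z - c) ^+ n : C^o) n).
  apply/funext => n; rewrite /series/= scaler_sumr -big_split/=.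
  by apply: eq_bigr => i _; rewrite mulrDl -mulrA.
by apply: cvgD; [apply: cvgZr; exact: fu|exact: gv].
Qed.

Lemma holo_lin f g (b : C) : holo_disc f -> holo_disc g ->
  holo_disc (b *: f + g).
Proof.
move=> [Af f0] [Ag g0]; split=> [c Dc|z Dz].
  by apply: analytic_lin; [exact: Af|exact: Ag].
by rewrite !fctE f0// g0// scaler0 addr0.
Qed.

Lemma holo0 : holo_disc 0.
Proof.
split=> // c _; exists (fun=> 0), 1; split => // z _.
rewrite (_ : series _ = fun=> 0); first exact: cvg_cst.
by apply/funext => n; rewrite /series/= big1// => i _; rewrite mul0r.
Qed.

Lemma analytic_cont f (c : C) (e : R) : analytic_at f c -> 0 < e ->
  exists2 d : R, 0 < d & forall z, normc (z - c) < d -> normc (f z - f c) <= e.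
Proof.
move=> [a [r [r0 fa]]] e0.
pose rho := r / 2; have rho0 : 0 < rho by rewrite divr_gt0.
have [M M0 aM] : exists2 M : R, 0 < M & forall n, normc (a n) * rho ^+ n <= M.
  have rhor : normc ((c + rho%:C%C) - c) < r.
    by rewrite addrAC subrr add0r normc_real ?ltW// ltr_pdivrMr// ltr_pMr// ltr1n.
  have /fa/cvgP/cvg_series_cvg_0/cvgP/cvg_seq_bounded/ex_strict_bound_gt0 := rhor.
  move=> [[m m']]; rewrite ltcE/= => /andP[/eqP-> m0] aM.
  exists m => // n; have := aM n I; rewrite addrAC subrr add0r -normcE ltcR.
  rewrite normcM => /ltW; congr (_ * _ <= _).
  elim: n => [|n IH]; first by rewrite !expr0 normc_real.
  by rewrite !exprS normcM IH normc_real// ltW.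
have key z : normc (z - c) <= rho / 2 -> normc (z - c) < r ->
    normc (f z - a 0) <= e / 4 + 2 * M * (normc (z - c) / rho).
  move=> zrho zr; set q := normc (z - c) / rho.
  have q0 : 0 <= q by rewrite divr_ge0 ?normc_ge0// ltW.
  have q1 : q <= 2^-1 by rewrite ler_pdivrMr// mulrC.
  have S n : normc (series (fun n => a n * (z - c) ^+ n) n.+1 - a 0)
      <= 2 * M * q * (1 - 2^-1 ^+ n).
    elim: n => [|n IH].
      by rewrite /series/= big_nat1 expr0 mulr1 subrr expr0 subrr mulr0 normc_real.
    rewrite /series/= big_nat_recr//= addrAC.
    rewrite (le_trans (normcD _ _))// (le_trans (lerD IH (_ : _ <= M * q * 2^-1 ^+ n)))//.
      rewrite normcM.
      have -> : normc ((z - c) ^+ n.+1) = q ^+ n.+1 * rho ^+ n.+1.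
        rewrite -exprMn /q mulfVK ?gt_eqF//.
        elim: (n.+1) => [|k IHk]; first by rewrite !expr0 normc_real.
        by rewrite !exprS normcM IHk.
      have -> : normc (a n.+1) * (q ^+ n.+1 * rho ^+ n.+1) =
        (normc (a n.+1) * rho ^+ n.+1) * (q * q ^+ n) by rewrite -exprS; ring.
      rewrite -[leRHS]mulrA; apply: ler_pM.
      - by rewrite mulr_ge0 ?normc_ge0// exprn_ge0// ltW.
      - by rewrite mulr_ge0// exprn_ge0.
      - exact: aM.
      by rewrite ler_wpM2l// lerXn2r// nnegrE invr_ge0.
    rewrite exprS; set t := 2^-1 ^+ n.
    by rewrite le_eqVlt; apply/orP; left; apply/eqP; field.
  have /cvgrPdist_lt/(_ (e / 4)%:C%C) := fa z zr.
  rewrite ltcR divr_gt0// => /(_ isT)[N _ /(_ N.+1 (leqnSn N))].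
  rewrite -normcE ltcR => fS.
  rewrite -[f z](subrK (series (fun n => a n * (z - c) ^+ n) N.+1)) -addrA.
  apply: (le_trans (normcD _ _)); apply: lerD; first exact: ltW.
  apply: le_trans (S N) _; rewrite ler_piMr//.
  by rewrite mulr_ge0// mulr_ge0// ltW.
exists (Num.min (rho / 2) (rho * e / (8 * M))).
  by rewrite lt_min !divr_gt0 ?mulr_gt0.
move=> z; rewrite lt_min => /andP[z1 z2].
have zr : normc (z - c) < r.
  by rewrite (lt_trans z1)// /rho; lra.
have cr : normc (c - c) < r by rewrite subrr normc_real.
have kz := key _ (ltW z1) zr.
have kc : normc (f c - a 0) <= e / 4.
  have := key c; rewrite subrr normc_real// mul0r mulr0 addr0.
  by apply; rewrite ?divr_ge0// ltW.
have -> : f z - f c = (f z - a 0) + - (f c - a 0).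
  by rewrite opprB addrA subrK.
rewrite (le_trans (normcD _ _))// normcN.
have : 2 * M * (normc (z - c) / rho) <= e / 4.
  rewrite mulrA ler_pdivrMr//.
  move: z2; rewrite ltr_pdivlMr ?mulr_gt0// => z2.
  by lra.
by lra.
Qed.

Lemma measurable_openC (O : set C) :
  (forall c, O c -> exists2 d : R, 0 < d &
    forall z, normc (z - c) < d -> O z) ->
  measurable [set xy : R * R | O (xy.1 +i* xy.2)%C].
Proof.
move=> Oopen.
pose box (q : rat * rat * rat * rat) : set (R * R) :=
  `]ratr q.1.1.1 : R, ratr q.1.1.2[%classic `*`
  `]ratr q.1.2 : R, ratr q.2[%classic.
pose F (n : nat) : set (R * R) :=
  if unpickle n is Some q then
    if `[< box q `<=` [set xy : R * R | O (xy.1 +i* xy.2)%C] >] then box q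
    else set0 else set0.
have -> : [set xy : R * R | O (xy.1 +i* xy.2)%C] = \bigcup_n F n.
  apply/seteqP; split; last first.
    move=> xy [n _]; rewrite /F; case: (unpickle n) => // q.
    by case: asboolP => // + boxq; apply.
  move=> [x y] /= /Oopen[d d0 dO].
  have d2 : 0 < d / 2 by rewrite divr_gt0.
  have [q1 + ] := @rat_in_itvoo R (x - d / 2) x ltac:(by rewrite ltrBlDr ltrDl).
  have [q2 + ] := @rat_in_itvoo R x (x + d / 2) ltac:(by rewrite ltrDl).
  have [q3 + ] := @rat_in_itvoo R (y - d / 2) y ltac:(by rewrite ltrBlDr ltrDl).
  have [q4 + ] := @rat_in_itvoo R y (y + d / 2) ltac:(by rewrite ltrDl).
  rewrite !in_itv/= => /andP[q4l q4r] /andP[q3l q3r] /andP[q2l q2r] /andP[q1l q1r].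
  exists (pickle (q1, q2, q3, q4)); first exact: I.
  rewrite /F pickleK.
  case: asboolP; first by move=> _; rewrite /box/= !in_itv/= q1r q2l q3r q4l.
  move=> []; move=> [x' y'] [] /=; rewrite !in_itv/= => /andP[x1 x2] /andP[y1 y2].
  apply: dO; apply: (le_lt_trans (normc_le_ReIm _ _)).
  rewrite [ltRHS]splitr; apply: ltrD; rewrite ltr_norml; apply/andP; split; lra.
apply: bigcupT_measurable => n; rewrite /F.
case: (unpickle n) => [q|]; last exact: measurable0.
case: asboolP => _; last exact: measurable0.
by apply: measurableX; exact: measurable_itv.
Qed.

Lemma disc_open (c : C) : disc c -> exists2 d : R, 0 < d &
  forall z, normc (z - c) < d -> disc z.
Proof.
move=> c1; exists (1 - normc c); first by rewrite subr_gt0.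
move=> z zc; rewrite /disc/= -[z](subrK c).
by rewrite (le_lt_trans (normcD _ _))// -ltrBrDr.
Qed.

Lemma measurable_disc2 : measurable disc2.
Proof. exact: measurable_openC disc_open. Qed.

Lemma measurable_disc2_cont (h : C -> R) :
  (forall c, disc c -> forall e : R, 0 < e -> exists2 d : R, 0 < d &
    forall z, normc (z - c) < d -> `|h z - h c| <= e) ->
  measurable_fun disc2 (fun xy : R * R => h (xy.1 +i* xy.2)%C).
Proof.
move=> hc mD; apply: (measurability _ (measurable_realfun.RGenOInfty.measurableE R)) => //.
move=> _ [_ [y ->] <-].
rewrite (_ : _ `&` _ =
  [set xy : R * R | (disc `&` [set z | y < h z]) (xy.1 +i* xy.2)%C]); last first.
  by apply/seteqP; split=> -[a b] [/= Dab]; rewrite /= in_itv/= ?andbT.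
apply: measurable_openC => c [Dc /= yc].
have [d d0 dD] := disc_open Dc.
have e0 : 0 < (h c - y) / 2 by rewrite divr_gt0// subr_gt0.
have [e e0' eh] := hc c Dc _ e0.
exists (Num.min d e); first by rewrite lt_min d0.
move=> z; rewrite lt_min => /andP[/dD Dz /eh]; rewrite ler_norml => /andP[h1 h2].
by split => //=; lra.
Qed.

Lemma measurable_bergman p mu f : holo_disc f -> 
  measurable_fun disc2 (EFin \o bergman_integrand p mu f).
Proof.
move=> [Af _]; apply/measurable_EFinP; apply: measurable_funM.
  apply: (measurableT_comp (measurable_powR p)).
  apply: (@measurable_disc2_cont (fun z => normc (f z))) => c Dc e e0.
  have [d d0 df] := analytic_cont (Af c Dc) e0.
  exists d => // z /df; apply: le_trans; rewrite ler_norml; apply/andP; split.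
    have := normcD (f z - f c) (- f z).
    by rewrite addrAC subrr add0r !normcN; lra.
  by have := normcD (f z - f c) (f c); rewrite subrK; lra.
apply: (measurableT_comp (measurable_powR mu)).
apply: (@measurable_disc2_cont (fun z => 1 - normc z)) => c Dc e e0.
exists e => // z /ltW; apply: le_trans; rewrite ler_norml; apply/andP; split.
  by have := normcD (z - c) c; rewrite subrK; lra.
have := normcD (z - c) (- z).
by rewrite addrAC subrr add0r !normcN; lra.
Qed.

Lemma bergman_integrand_ge0 p mu f xy :

  (0 <= (bergman_integrand p mu f xy)%:E)%E.
Proof. by rewrite lee_fin mulr_ge0 ?powR_ge0. Qed.

Lemma bergman_modular_ge0 p mu f : (0 <= bergman_modular p mu f)%E.
Proof.
rewrite mule_ge0// ?lee_fin ?invr_ge0 ?pi_ge0//.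
by apply: integral_ge0 => xy _; exact: bergman_integrand_ge0.
Qed.

Lemma bergman_modular_conv p mu f g (s t : R) : 1 < p ->
  holo_disc f -> holo_disc g -> 0 <= s -> 0 <= t -> s + t = 1 ->
  (bergman_modular p mu (s%:C%C *: f + t%:C%C *: g)%R <=
   s%:E * bergman_modular p mu f + t%:E * bergman_modular p mu g)%E.
Proof.
move=> p1 Hf Hg s0 t0 st.
have s1 : s <= 1 by rewrite -st lerDl.
have pi0 : (0 <= (pi^-1)%:E :> \bar R)%E by rewrite lee_fin invr_ge0 pi_ge0.
rewrite /bergman_modular !(muleCA _ (pi^-1)%:E) -muleDr//; last first.
  rewrite ge0_adde_def// inE mule_ge0 ?lee_fin//;
  by apply: integral_ge0 => xy _; exact: bergman_integrand_ge0.
apply: lee_wpmul2l => //.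
have mD := measurable_disc2.
have mf := measurable_bergman p mu Hf; have mg := measurable_bergman p mu Hg.
rewrite -!ge0_integralZl//; try by move=> xy _; exact: bergman_integrand_ge0.
rewrite -ge0_integralD//; first last.
- exact: measurable_funeM.
- by move=> xy _; rewrite mule_ge0 ?lee_fin//; exact: bergman_integrand_ge0.
- exact: measurable_funeM.
- by move=> xy _; rewrite mule_ge0 ?lee_fin//; exact: bergman_integrand_ge0.
apply: ge0_le_integral => //.
- by move=> xy _; exact: bergman_integrand_ge0.
- apply: measurable_bergman; apply: holo_lin => //.
  rewrite -[t%:C%C *: g]addr0; apply: holo_lin => //; exact: holo0.
- by apply: emeasurable_funD; exact: measurable_funeM.
move=> xy _; rewrite /bergman_integrand; set z := (_ +i* _)%C.
rewrite -!EFinM -EFinD lee_fin !mulrA -mulrDl ler_wpM2r ?powR_ge0//.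
have nfg : normc ((s%:C%C *: f + t%:C%C *: g) z) <= s * normc (f z) + t * normc (g z).
  rewrite !fctE (le_trans (normcD _ _))//.
  by rewrite [s%:C%C *: _]/GRing.scale/= [t%:C%C *: _]/GRing.scale/= !normcM !normc_real.
have stn : 0 <= s * normc (f z) + t * normc (g z).
  by rewrite addr_ge0// mulr_ge0// normc_ge0.
apply: (le_trans (ge0_ler_powR _ _ _ nfg)); rewrite ?nnegrE ?normc_ge0//.
  by rewrite (le_trans _ (ltW p1)).
have := @convex_powR R p (ltW p1) (Itv01 s0 s1) (normc (f z)) (normc (g z)).
rewrite !inE/= !in_itv/= !andbT !normc_ge0 => /(_ isT isT).
have -> : t = 1 - s by rewrite -st addrAC subrr add0r.
by move=> h; apply: le_trans h _; exact: lexx.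
Qed.

Lemma bergman_modular_scale p mu f (a : C) : 0 <= p -> holo_disc f ->
  bergman_modular p mu (a *: f)%R = ((normc a `^ p)%:E * bergman_modular p mu f)%E.
Proof.
move=> p0 Hf; rewrite /bergman_modular muleCA; congr (_ * _)%E.
rewrite -ge0_integralZl//; first last.
- by rewrite lee_fin powR_ge0.
- by move=> xy _; exact: bergman_integrand_ge0.
- exact: measurable_bergman.
- exact: measurable_disc2.
apply: eq_integral => xy _; rewrite -EFinM mulrA; congr (_ * _)%:E.
by rewrite -powRM ?normc_ge0// -normcM.
Qed.

Lemma bergman_norm_scale p mu f (a : C) : 0 < p -> holo_disc f ->
  bergman_norm p mu (a *: f)%R = ((normc a)%:E * bergman_norm p mu f)%E.
Proof.
move=> p0 Hf; rewrite /bergman_norm bergman_modular_scale ?ltW//.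
rewrite poweRM ?lee_fin ?powR_ge0 ?bergman_modular_ge0//.
by rewrite poweR_EFin -powRrM mulfV ?gt_eqF// powRr1// normc_ge0.
Qed.

Lemma bergman_norm_mono p mu nu f : 0 < p -> holo_disc f -> mu <= nu ->
  (bergman_norm p nu f <= bergman_norm p mu f)%E.
Proof.
move=> p0 Hf mn; rewrite /bergman_norm gt0_ler_poweR//.
- by rewrite invr_ge0 ltW.
- by rewrite in_itv/= bergman_modular_ge0 leey.
- by rewrite in_itv/= bergman_modular_ge0 leey.
apply: lee_wpmul2l; first by rewrite lee_fin invr_ge0 pi_ge0.
apply: ge0_le_integral => //.
- exact: measurable_disc2.
- by move=> xy _; exact: bergman_integrand_ge0.
- exact: measurable_bergman.
- exact: measurable_bergman.
move=> xy Dxy; rewrite lee_fin ler_wpM2l ?powR_ge0//.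
have Dxy' : normc (xy.1 +i* xy.2)%C < 1 by [].
apply: ger_powR => //; apply/andP; split; first by rewrite subr_gt0.
by rewrite lerBlDr lerDl normc_ge0.
Qed.

Lemma poweR_ltE p (X : \bar R) (e : R) : 0 < p -> (0 <= X)%E -> 0 < e ->
  (X `^ p^-1 < e%:E)%E <-> (X < (e `^ p)%:E)%E.
Proof.
move=> p0 X0 e0; case: X X0 => [x| |] //; last first.
  by rewrite poweRyr// invr_eq0 gt_eqF.
rewrite lee_fin => x0; rewrite poweR_EFin !lte_fin; split=> h.
  rewrite -[x](@powRr1 _ x)// -[X in _ `^ X](@mulVf _ p) ?gt_eqF// powRrM.
  by apply: gt0_ltr_powR; rewrite // nnegrE ?powR_ge0// ltW.
rewrite -[e](@powRr1 _ e) ?ltW// -[X in _ < _ `^ X](@mulfV _ p) ?gt_eqF// powRrM.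
by apply: gt0_ltr_powR; rewrite ?invr_gt0// nnegrE ?powR_ge0.
Qed.

Lemma bergman_normD_lt p mu f g (s t e : R) : 1 < p -> 0 < e ->
  holo_disc f -> holo_disc g -> 0 <= s -> 0 <= t -> s + t = 1 ->
  (bergman_norm p mu f < e%:E)%E -> (bergman_norm p mu g < e%:E)%E ->
  (bergman_norm p mu (s%:C%C *: f + t%:C%C *: g)%R < e%:E)%E.
Proof.
move=> p1 e0 Hf Hg s0 t0 st.
have p0 : 0 < p by rewrite (lt_trans _ p1).
have M0 h := bergman_modular_ge0 p mu h.
move=> /(poweR_ltE p0 (M0 f) e0) fe /(poweR_ltE p0 (M0 g) e0) ge.
apply/(poweR_ltE p0 (M0 _) e0).
apply: (le_lt_trans (bergman_modular_conv mu p1 Hf Hg s0 t0 st)).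
have := bergman_modular_ge0 p mu f; have := bergman_modular_ge0 p mu g.
move: fe ge; case: (bergman_modular p mu f) => [x| |] //.
case: (bergman_modular p mu g) => [y| |] //.
rewrite -!EFinM -EFinD !lte_fin => xe ye _ _.
apply: (@le_lt_trans _ _ (Num.max x y)); last by rewrite gt_max xe.
rewrite -[leRHS]mul1r -st mulrDl lerD//; apply: ler_wpM2l => //.
  by rewrite le_max lexx.
by rewrite le_max lexx orbT.
Qed.

Lemma bergman_norm_ge0 p mu f : (0 <= bergman_norm p mu f)%E.
Proof. exact: poweR_ge0. Qed.

Lemma holoZ f (b : C) : holo_disc f -> holo_disc (b *: f).
Proof.
by move=> Hf; rewrite -[b *: f]addr0; apply: holo_lin => //; exact: holo0.
Qed.

Lemma bergman_norm_fin p mu f : (bergman_norm p mu f < +oo)%E ->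
  exists2 e : R, 0 < e & (bergman_norm p mu f < e%:E)%E.
Proof.
have := bergman_norm_ge0 p mu f.
case: (bergman_norm p mu f) => [x| |] //; rewrite lee_fin => x0 _.
by exists (x + 1); rewrite ?lte_fin ?ltrDl// ltr_wpDl.
Qed.

Lemma bergman_lin p mu f g (b : C) : 1 < p -> bergman p mu f ->
  bergman p mu g -> bergman p mu (b *: f + g).
Proof.
move=> p1 [Hf nf] [Hg ng]; split; first exact: holo_lin.
have p0 : 0 < p by rewrite (lt_trans _ p1).
have fin h (a : C) : holo_disc h -> (bergman_norm p mu h < +oo)%E ->
    (bergman_norm p mu (a *: h)%R < +oo)%E.
  by move=> Hh nh; rewrite bergman_norm_scale// lte_mul_pinfty// ?lee_fin ?normc_ge0.
have [e e0 fe] := bergman_norm_fin (fin f (2 * b) Hf nf).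
have [d d0 gd] := bergman_norm_fin (fin g 2 Hg ng).
have ed0 : 0 < e + d by rewrite addr_gt0.
have h0 : 0 <= (2^-1 : R) by rewrite invr_ge0.
have h1 : 2^-1 + 2^-1 = 1 :> R by lra.
have fe' : (bergman_norm p mu ((2 * b) *: f)%R < (e + d)%:E)%E.
  by apply: lt_le_trans fe _; rewrite lee_fin lerDl ltW.
have gd' : (bergman_norm p mu (2 *: g)%R < (e + d)%:E)%E.
  by apply: lt_le_trans gd _; rewrite lee_fin lerDr ltW.
have := bergman_normD_lt p1 ed0 (holoZ (2 * b) Hf) (holoZ 2 Hg) h0 h0 h1 fe' gd'.
have c2 : (2^-1)%:C%C * 2 = 1 :> C.
  by rewrite fmorphV/= rmorph_nat mulVf// pnatr_eq0.
rewrite !scalerA mulrA c2 mul1r scale1r => /lt_trans; apply; exact: ltry.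
Qed.

Lemma bergman0 p mu : 0 < p -> bergman p mu 0.
Proof.
move=> p0; split; first exact: holo0.
rewrite -(scale0r (0 : C -> C^o)) bergman_norm_scale//; last exact: holo0.
by rewrite normc_real// mul0e.
Qed.

Lemma posC (r : C) : 0 < r -> exists2 s : R, 0 < s & r = s%:C%C.
Proof.
case: r => x y; rewrite ltcE/= => /andP[/eqP -> x0]; by exists x.
Qed.

Lemma i01C (t : {i01 C}) : exists s u : R, [/\ 0 <= s, 0 <= u, s + u = 1,
  t%:num = s%:C%C & 1 - t%:num = u%:C%C].
Proof.
have : 0 <= t%:num by [].
have : t%:num <= 1 by [].
case: (t%:num) => x y; rewrite !lecE/= => /andP[/eqP <- x1] /andP[_ x0].
exists x, (1 - x); rewrite subr_ge0; split => //; first by rewrite subrKC.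
by rewrite rmorphB.
Qed.

Lemma normc_le1 (a : C) : `|a| <= 1 -> normc a <= 1.
Proof. by rewrite -normcE -lecR. Qed.

Lemma bergman_ball_conv p mu f g (e : R) (t : {i01 C}) : 1 < p -> 0 < e ->
  holo_disc f -> holo_disc g ->
  (bergman_norm p mu f < e%:E)%E -> (bergman_norm p mu g < e%:E)%E ->
  (bergman_norm p mu (t%:num *: f + (1 - t%:num) *: g)%R < e%:E)%E.
Proof.
move=> p1 e0 Hf Hg fe ge; have [s [u [s0 u0 su -> ->]]] := i01C t.
exact: bergman_normD_lt.
Qed.

Lemma bergman_ball_balanced p mu f (e : R) (a : C) : 0 < p ->
  holo_disc f -> `|a| <= 1 -> (bergman_norm p mu f < e%:E)%E ->
  (bergman_norm p mu (a *: f)%R < e%:E)%E.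
Proof.
move=> p0 Hf /normc_le1 a1; apply: le_lt_trans.
by rewrite bergman_norm_scale// gee_pMl ?lee_fin ?bergman_norm_ge0.
Qed.

Lemma bergman_ball_absorbing p mu f (e : R) : 0 < p -> 0 < e ->
  holo_disc f -> (bergman_norm p mu f < +oo)%E ->
  exists2 r : C, 0 < r & (bergman_norm p mu (r *: f)%R < e%:E)%E.
Proof.
move=> p0 e0 Hf /bergman_norm_fin[d d0 fd].
exists (e / d)%:C%C; first by rewrite ltcR divr_gt0.
rewrite bergman_norm_scale// normc_real ?divr_ge0 ?ltW//.
have -> : (e%:E = (e / d)%:E * d%:E)%E.
  by rewrite -EFinM mulfVK// gt_eqF.
by rewrite lte_pmul2l// ?lte_fin ?divr_gt0.
Qed.

End bergman_spaces.

#[local] Opaque bergman_norm holo_disc.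

Section bergman_plus.
Variables (R : realType) (p alpha : R).
Local Notation C := R[i].

(* [p1] and [a0] are unused in the body: they let the closure instance below,
   which needs them, be inferred from the predicate. *)
Definition bergman_plus_pred (p1 : 1 < p) (a0 : 0 < alpha) : {pred C -> C^o} :=
  [pred f : C -> C^o | `[< forall mu, alpha < mu -> bergman p mu f >]].

Variables (p1 : 1 < p) (a0 : 0 < alpha).
Let p0 : 0 < p. Proof. by rewrite (lt_trans _ p1). Qed.

Let bergman_plus_closed : submod_closed (bergman_plus_pred p1 a0).
Proof.
split; first by apply/asboolP => mu _; exact: bergman0.
move=> b f g /asboolP Af /asboolP Ag; apply/asboolP => mu amu.
by apply: bergman_lin; [|exact: Af|exact: Ag].
Qed.

HB.instance Definition _ := GRing.isSubmodClosed.Build _ _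
  (bergman_plus_pred p1 a0) bergman_plus_closed.

Definition bergman_plus_lmod : Type :=
  {f : C -> C^o | f \in bergman_plus_pred p1 a0}.

HB.instance Definition _ := SubChoice.on bergman_plus_lmod.
HB.instance Definition _ := [SubChoice_isSubLmodule of bergman_plus_lmod by <:].

Lemma bergman_plusP (f : bergman_plus_lmod) mu :
  alpha < mu -> bergman p mu (val f).
Proof. by have := valP f; rewrite inE => /[apply]. Qed.

Lemma bergman_plus_holo (f : bergman_plus_lmod) : holo_disc (val f).
Proof. by have [] := bergman_plusP f (ltr_pwDr ltr01 (lexx alpha)). Qed.

Let weight (n : nat) : R := alpha + n.+1%:R^-1.

Let weight_gt n : alpha < weight n.
Proof. by rewrite ltrDl invr_gt0. Qed.

(* a base and not only a subbase because the norms increase with n *)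
Definition bergman_plus_base (U : set bergman_plus_lmod) : Prop :=
  exists (n : nat) (e : R), 0 < e /\
    U = [set f | (bergman_norm p (alpha + n.+1%:R^-1) (val f) < e%:E)%E].

Let bp_neq0 : exists U, bergman_plus_base U.
Proof. by eexists; exists 0, 1; split. Qed.

Let bp_absconvex U : bergman_plus_base U -> absconvex U.
Proof.
move=> [n [e [e0 ->]]]; split.
  move=> f g t /set_mem fe /set_mem ge; apply/mem_set.
  apply: (bergman_ball_conv t p1 e0 _ _ fe ge); exact: bergman_plus_holo.
move=> a f a1 fe.
exact: (bergman_ball_balanced p0 (bergman_plus_holo f) a1 fe).
Qed.

Let bp_absorbing U : bergman_plus_base U -> absorbing U.
Proof.
move=> [n [e [e0 ->]]] f; 
exact: (bergman_ball_absorbing p0 e0 (bergman_plus_holo f)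
  (bergman_plusP f (weight_gt n)).2).
Qed.

Let bp_setI U V : bergman_plus_base U -> bergman_plus_base V ->
  exists2 W, bergman_plus_base W & W `<=` U `&` V.
Proof.
move=> [n [e [e0 ->]]] [m [d [d0 ->]]].
exists [set f | (bergman_norm p (weight (maxn n m)) (val f) <
  (Num.min e d)%:E)%E].
  by exists (maxn n m), (Num.min e d); rewrite lt_min e0.
have wle k : (k <= maxn n m)%N -> weight (maxn n m) <= weight k.
  by move=> km; rewrite lerD2l lef_pV2 ?posrE// ler_nat ltnS.
have key k r (f : bergman_plus_lmod) : (k <= maxn n m)%N -> Num.min e d <= r ->
    (bergman_norm p (weight (maxn n m)) (val f) < (Num.min e d)%:E)%E ->
    (bergman_norm p (weight k) (val f) < r%:E)%E.
  move=> km rle /lt_le_trans h; apply: (@le_lt_trans _ _ _ _ _ _ (h r%:E _)).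
    by apply: bergman_norm_mono => //; [exact: bergman_plus_holo|exact: wle].
  by rewrite lee_fin.
move=> f fe; split.
  by apply: key fe; rewrite ?leq_maxl// ge_min lexx.
by apply: key fe; rewrite ?leq_maxr// ge_min lexx orbT.
Qed.

Let bp_scale U (r : C) : bergman_plus_base U -> 0 < r ->
  exists2 W, bergman_plus_base W & forall f, W f -> U (r *: f).
Proof.
move=> [n [e [e0 ->]]] /posC[s s0 ->].
exists [set f | (bergman_norm p (weight n) (val f) < (e / s)%:E)%E].
  by exists n, (e / s); rewrite divr_gt0.
move=> f fe /=.
have -> : (e%:E = s%:E * (e / s)%:E)%E.
  by rewrite -EFinM mulrC mulfVK// gt_eqF.
have := bergman_norm_scale (weight n) s%:C%C p0 (bergman_plus_holo f).
rewrite normc_real ?ltW// => h.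
by rewrite [X in (X < _)%E]h lte_pmul2l// lte_fin.
Qed.

Definition bergman_plus_lcbase :=
  LCBase bp_neq0 bp_absconvex bp_absorbing bp_setI bp_scale.

Definition bergman_plus : Type := lctype bergman_plus_lcbase.

HB.instance Definition _ := Tvs.copy bergman_plus (lctype bergman_plus_lcbase).

End bergman_plus.

Section bergman_minus.
Variables (R : realType) (p alpha : R).
Local Notation C := R[i].

Definition bergman_minus_pred (p1 : 1 < p) (a0 : 0 < alpha) : {pred C -> C^o} :=
  [pred f : C -> C^o |
    `[< exists mu, [/\ 0 < mu, mu < alpha & bergman p mu f] >]].

Variables (p1 : 1 < p) (a0 : 0 < alpha).
Let p0 : 0 < p. Proof. by rewrite (lt_trans _ p1). Qed.

Let bergman_minus_closed : submod_closed (bergman_minus_pred p1 a0).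
Proof.
split.
  apply/asboolP; exists (alpha / 2).
  rewrite divr_gt0// ltr_pdivrMr// ltr_pMr// ltr1n; split => //.
  exact: bergman0.
move=> b f g /asboolP[mu [mu0 mua [Hf Af]]] /asboolP[nu [nu0 nua [Hg Ag]]].
apply/asboolP; exists (Num.max mu nu); rewrite lt_max mu0 gt_max mua nua.
split=> [||]; [by []|by []|apply: (bergman_lin b p1); split]; [by []| |by []|].
  apply: le_lt_trans Af; apply: (bergman_norm_mono p0 Hf).
  by rewrite le_max lexx.
apply: le_lt_trans Ag; apply: (bergman_norm_mono p0 Hg).
by rewrite le_max lexx orbT.
Qed.

HB.instance Definition _ := GRing.isSubmodClosed.Build _ _
  (bergman_minus_pred p1 a0) bergman_minus_closed.

Definition bergman_minus_lmod : Type :=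
  {f : C -> C^o | f \in bergman_minus_pred p1 a0}.

HB.instance Definition _ := SubChoice.on bergman_minus_lmod.
HB.instance Definition _ := [SubChoice_isSubLmodule of bergman_minus_lmod by <:].

Lemma bergman_minusP (f : bergman_minus_lmod) :
  exists mu, [/\ 0 < mu, mu < alpha & bergman p mu (val f)].
Proof. by have := valP f; rewrite inE. Qed.

Lemma bergman_minus_holo (f : bergman_minus_lmod) : holo_disc (val f).
Proof. by have [mu [_ _ []]] := bergman_minusP f. Qed.

(* The finest locally convex topology making the inclusions continuous: an
   absolutely convex set is a neighbourhood of 0 iff its trace on each step
   contains a norm ball (a finite norm of weight mu already implies membership
   in the step of weight mu). *)
Definition bergman_minus_base (U : set bergman_minus_lmod) : Prop :=
  absconvex U /\ forall mu, 0 < mu -> mu < alpha ->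
    exists2 e : R, 0 < e &
      forall f : bergman_minus_lmod, (bergman_norm p mu (val f) < e%:E)%E -> U f.

Let bm_neq0 : exists U, bergman_minus_base U.
Proof.
exists setT; split; first by split => // f g t; rewrite !inE.
by move=> mu _ _; exists 1.
Qed.

Let bm_absconvex U : bergman_minus_base U -> absconvex U.
Proof. by case. Qed.

Let bm_absorbing U : bergman_minus_base U -> absorbing U.
Proof.
move=> [_ HU] f; have [mu [mu0 mua [Hf nf]]] := bergman_minusP f.
have [e e0 eU] := HU mu mu0 mua.
have [r r0 rfe] := bergman_ball_absorbing p0 e0 Hf nf.
by exists r => //; apply: eU.
Qed.

Let bm_setI U V : bergman_minus_base U -> bergman_minus_base V ->
  exists2 W, bergman_minus_base W & W `<=` U `&` V.
Proof.
move=> [[cU bU] HU] [[cV bV] HV]; exists (U `&` V) => //; split; first split.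
- move=> f g t; rewrite !inE => -[Uf Vf] [Ug Vg]; split.
    by have := cU f g t; rewrite !inE; apply.
  by have := cV f g t; rewrite !inE; apply.
- by move=> a f a1 [Uf Vf]; split; [exact: bU|exact: bV].
move=> mu mu0 mua; have [e e0 eU] := HU mu mu0 mua.
have [d d0 dV] := HV mu mu0 mua.
exists (Num.min e d); first by rewrite lt_min e0.
by move=> f; rewrite EFin_min lt_min => /andP[/eU ? /dV].
Qed.

Let bm_scale U (r : C) : bergman_minus_base U -> 0 < r ->
  exists2 W, bergman_minus_base W & forall f, W f -> U (r *: f).
Proof.
move=> [[cU bU] HU] r0; exists [set f | U (r *: f)] => //; split; first split.
- move=> f g t; rewrite !inE /= => Uf Ug.
  have := cU (r *: f) (r *: g) t; rewrite !inE => /(_ Uf Ug).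
  by rewrite /conv/= !scalerDr !scalerA ![_ * r]mulrC.
- by move=> a f a1 /= Uf; rewrite scalerA mulrC -scalerA; exact: bU.
have [s s0 rs] := posC r0.
move=> mu mu0 mua; have [e e0 eU] := HU mu mu0 mua.
exists (e / s); first by rewrite divr_gt0.
move=> f fe /=; apply: eU.
have -> : (e%:E = s%:E * (e / s)%:E)%E.
  by rewrite -EFinM mulrC mulfVK// gt_eqF.
have := bergman_norm_scale mu s%:C%C p0 (bergman_minus_holo f).
rewrite normc_real ?ltW// rs => h.
by rewrite [X in (X < _)%E]h lte_pmul2l// lte_fin.
Qed.

Definition bergman_minus_lcbase :=
  LCBase bm_neq0 bm_absconvex bm_absorbing bm_setI bm_scale.

Definition bergman_minus : Type := lctype bergman_minus_lcbase.

HB.instance Definition _ :=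
  Tvs.copy bergman_minus (lctype bergman_minus_lcbase).

(* The inclusions of the steps are continuous, and every linear map whose
   restrictions to the steps are continuous is continuous: this characterizes
   the inductive limit topology. *)
Lemma bergman_minus_incl (mu : R) (U : set bergman_minus) :
  0 < mu -> mu < alpha -> nbhs 0 U ->
  exists2 e : R, 0 < e &
    forall f : bergman_minus, (bergman_norm p mu (val f) < e%:E)%E -> U f.
Proof.
move=> mu0 mua [V [_ HV] VU]; have [e e0 eV] := HV mu mu0 mua.
by exists e => // f /eV/VU; rewrite add0r.
Qed.

Lemma bergman_minus_finest (T : tvsType C) (u : {linear bergman_minus -> T}) :
  (forall mu, 0 < mu -> mu < alpha -> forall U : set T, nbhs 0 U ->
     exists2 e : R, 0 < e &
       forall f : bergman_minus, (bergman_norm p mu (val f) < e%:E)%E -> U (u f)) ->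
  continuous u.
Proof.
move=> uc f A nA.
have nA0 : nbhs (0 : T) [set y | A (u f + y)].
  have := nbhsB (- u f) nA; rewrite addNr; apply: filterS => _ [y Ay <-] /=.
  by rewrite addrA subrr add0r.
have [V [nV [cV bV] VA]] := nbhs0_absconvex nA0.
exists (u @^-1` V); last by move=> g /= /VA/=; rewrite -linearD.
split; last by move=> mu mu0 mua; exact: uc.
split.
  move=> g h t; rewrite !inE/= => Vg Vh.
  have := cV (u g) (u h) t; rewrite !inE => /(_ Vg Vh).
  by rewrite /conv/= linearD !linearZ.
by move=> a g a1 Vg /=; rewrite linearZ; exact: bV.
Qed.

End bergman_minus.

(* Main.v *)
Require Import Defs.
From HB Require Import structures.
From mathcomp Require Import all_boot all_order all_algebra.
From mathcomp Require Import all_classical all_reals all_analysis.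
From mathcomp Require Import measurable_realfun complex zify ring lra.
From mathcomp Require cyclic separable cyclotomic.
(* Imported again so that its [normcE] is not shadowed by that of [complex]. *)
Require Import Defs.

(* Complex analysis. Averaging a power series over the N-th roots of unity and
   letting N tend to infinity isolates one coefficient; this gives Cauchy's
   estimates, and, applied to the re-expansions of a power series at the points
   of a circle, it shows that a locally analytic function on the disc is the sum
   of its Taylor series at 0. Integrating the same average over an annulus
   (the area is invariant under rotations) bounds the coefficients by the
   weighted Bergman norm: |a_n| rho^n <= C_rho N(f).

   Compactness. If mu < nu, the unit ball of weight mu is precompact for the norm
   of weight nu: near the circle (1 - |z|)^nu is small with respect to
   (1 - |z|)^mu, and on a smaller disc f is determined up to a small error by
   finitely many coefficients. With Fatou's lemma this also gives completeness.
   Hence the intersection is a Frechet-Schwartz space.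

   Duality. Let E be the inductive limit, with unit balls B_n of its steps, and F
   its dual with the seminorms sup_{B_n} |u|. F is complete, and it is a Schwartz
   space because B_n is precompact in some B_m. The evaluation map from E to the
   strong dual of F is open by the bipolar theorem, and it is onto because a
   functional bounded by sup_{B_n} |u| is a limit of evaluations at points of a
   multiple of the relatively compact set B_n. *)

Set Implicit Arguments.
Unset Strict Implicit.
Unset Printing Implicit Defensive.
Import Order.TTheory GRing.Theory Num.Theory.
Import numFieldNormedType.Exports.
Local Open Scope classical_set_scope.
Local Open Scope ring_scope.

(** * The Hahn-Banach theorem *)

(** The obstacle on the analytic side is that analyticity is local, whereas the estimates need one
    expansion on the whole disc with quantitative control. No contour integral is used: a mean over
    roots of unity is exact for polynomials, and on a power series its error is geometric once a
    little radius is given up. This is why most estimates fix auxiliary radii and carry a ratio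
    [q < 1]. On the functional side no ball is assumed closed. Separation is therefore stated with a
    ratio [r > 1], which replaces the closure of a set by a slightly larger multiple of it, and
    compactness of a step only asks that an ultrafilter on [B n] converge somewhere in E, possibly
    outside [B n]. The constants 1/2 and 1/4 of the duality part come from this ratio, taken equal
    to 2, and from passing from large to strict inequalities. Hahn-Banach serves in two different
    spaces, E and C^k, hence its formulation for an arbitrary absolutely convex absorbing set. *)

Lemma norm_le_normc (R : realType) (a : R[i]) (r : R) :
  (`|a| <= r%:C%C) = (normc a <= r).
Proof. by rewrite -normcE lecR. Qed.

Section hahn_banach.
Variables (R : realType) (E : lmodType R[i]).
Implicit Types (p q : E -> R) (x y : E) (t : R) (V : E -> set R).

Definition sublinear q := (forall x y, q (x + y) <= q x + q y) /\
  (forall t x, 0 <= t -> q (t%:C%C *: x) = t * q x).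

Lemma sublinear0 q : sublinear q -> q 0 = 0.
Proof. by move=> [_ /(_ 0 0 (lexx _))]; rewrite scale0r mul0r. Qed.

Lemma sublinear_geN q x : sublinear q -> - q (- x) <= q x.
Proof.
move=> sq; have := sq.1 x (- x); rewrite subrr (sublinear0 sq).
by rewrite -lerBlDr sub0r.
Qed.

Lemma scaleRA (s t : R) x : s%:C%C *: (t%:C%C *: x) = (s * t)%:C%C *: x.
Proof. by rewrite scalerA -rmorphM. Qed.

(** Common core of three constructions: the lower bound of a chain, the tangent functional and the
    gauge. The lower bound [m] keeps the infima finite. Only one half of homogeneity is proved
    directly; the other half is the same inequality for [t^-1]. *)
Lemma sublinear_inf V (m : E -> R) :
  (forall x, V x !=set0) -> (forall x a, V x a -> m x <= a) ->
  (forall x y a b, V x a -> V y b -> exists2 c, V (x + y) c & c <= a + b) ->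
  (forall x a t, V x a -> 0 < t -> exists2 c, V (t%:C%C *: x) c & c <= t * a) ->
  (forall a, V 0 a -> 0 <= a) ->
  (forall e, 0 < e -> exists2 c, V 0 c & c <= e) ->
  sublinear (fun x => inf (V x)).
Proof.
move=> V0 Vm VD VZ V0ge V0le.
have lbV x : has_lbound (V x) by exists (m x) => a /Vm.
have ple x a : V x a -> inf (V x) <= a by move=> /ge_inf; apply.
have adh x e : 0 < e -> exists2 a, V x a & a < inf (V x) + e.
  by move=> e0; apply: inf_adherent => //; split.
have half t x : 0 < t -> inf (V (t%:C%C *: x)) <= t * inf (V x).
  move=> t0; apply/ler_addgt0Pr => e e0.
  have [a Va ale] := adh x (e / t) (divr_gt0 e0 t0).
  have [c /ple cV /(le_trans cV) /le_trans] := VZ _ _ _ Va t0; apply.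
  have : t * a <= t * (inf (V x) + e / t) by rewrite ler_pM2l// ltW.
  by rewrite mulrDr mulrCA mulfV ?gt_eqF// mulr1.
have inf0 : inf (V 0) = 0.
  apply/eqP; rewrite eq_le (lb_le_inf (V0 0) V0ge) andbT.
  apply/ler_addgt0Pr => e /V0le[c /ple cV ce].
  by rewrite add0r (le_trans cV).
split=> [x y|t x].
  apply/ler_addgt0Pr => e e0.
  have e2 : 0 < e / 2 by rewrite divr_gt0.
  have [a Va ale] := adh x _ e2; have [b Vb ble] := adh y _ e2.
  have [c /ple cV cab] := VD _ _ _ _ Va Vb.
  by rewrite (le_trans cV)// (le_trans cab)//; lra.
rewrite le_eqVlt => /predU1P[<-|t0]; first by rewrite scale0r mul0r inf0.
apply/eqP; rewrite eq_le half//=.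
have := half t^-1 (t%:C%C *: x).
rewrite invr_gt0 scaleRA mulVf ?gt_eqF// scale1r => /(_ t0).
by rewrite -(ler_pM2l t0) mulrA mulfV ?gt_eqF// mul1r.
Qed.

(** Zorn's lemma below [p]: the pointwise infimum of a chain is finite because every sublinear
    functional below [p] stays above [- p (- x)]. *)
Lemma sublinear_minimal p : sublinear p -> exists q, [/\ sublinear q,
  forall x, q x <= p x &
  forall r, sublinear r -> (forall x, r x <= q x) -> forall x, q x <= r x].
Proof.
move=> sp.
pose T := {q : E -> R | sublinear q /\ forall x, q x <= p x}.
(* The order is reversed, so that a maximal element is a minimal functional. *)
pose ord (a b : T) := `[< forall x, sval b x <= sval a x >].
have sT (a : T) : sublinear (sval a) by case: a => ? [].
have Tp (a : T) x : sval a x <= p x by case: a => ? [].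
have [| | | |[q [sq qp]] qmin] := @Zorn T ord.
- by move=> a; apply/asboolP => x.
- move=> a b c /asboolP ab /asboolP bc; apply/asboolP => x.
  exact: le_trans (bc x) (ab x).
- move=> [a Ha] [b Hb] /asboolP ab /asboolP ba; apply: eq_exist.
  by apply/funext => x; apply/eqP; rewrite eq_le ab ba.
- move=> A Atot; have [[a0 Aa0]|] := pselect (exists a, A a); last first.
    move=> A0; exists (exist _ p (conj sp (fun x => lexx _))) => s As.
    by exfalso; apply: A0; exists s.
  pose V x := [set sval a x | a in A].
  have Vm x c : V x c -> - p (- x) <= c.
    move=> [a Aa <-]; rewrite (le_trans _ (sublinear_geN x (sT a)))//.
    by rewrite lerN2 Tp.
  have sV : sublinear (fun x => inf (V x)).
    apply: (@sublinear_inf V (fun x => - p (- x))).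
    + by move=> x; exists (sval a0 x), a0.
    + by move=> x a /Vm.
    + move=> x y _ _ [a Aa <-] [b Ab <-].
      have [/asboolP ab|/asboolP ba] := Atot a b Aa Ab.
        exists (sval b (x + y)); first by exists b.
        by rewrite (le_trans ((sT b).1 x y))// lerD.
      exists (sval a (x + y)); first by exists a.
      by rewrite (le_trans ((sT a).1 x y))// lerD.
    + move=> x _ t [a Aa <-] t0; exists (t * sval a x) => //.
      by exists a => //; rewrite (sT a).2// ltW.
    + by move=> _ [a Aa <-]; rewrite (sublinear0 (sT a)).
    + move=> e /ltW e0; exists 0 => //.
      by exists a0 => //; rewrite (sublinear0 (sT a0)).
  have Vle x a : A a -> inf (V x) <= sval a x.
    by move=> Aa; apply: ge_inf; [exists (- p (- x)) => c /Vm|exists a].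
  have Vp x : inf (V x) <= p x by rewrite (le_trans (Vle x a0 Aa0)).
  exists (exist _ (fun x => inf (V x)) (conj sV Vp)) => a Aa; apply/asboolP => x; exact: Vle.
exists q; split => // r sr rq x.
have rp y : r y <= p y by rewrite (le_trans (rq y)).
have := qmin (exist _ r (conj sr rp)).
by move=> /(_ ltac:(exact/asboolP)) [] ->.
Qed.

(* [r x] is the infimum of [q (x + t y) - t q y] over t >= 0; a minimal [q]
   coincides with it, which makes it additive. *)
Lemma sublinear_tangent q y : sublinear q -> exists r, [/\ sublinear r,
  forall x, r x <= q x & forall t x, 0 <= t -> r x <= q (x + t%:C%C *: y) - t * q y].
Proof.
move=> sq.
pose V x := [set q (x + t%:C%C *: y) - t * q y | t in [set t | 0 <= t]].
have Vm x c : V x c -> - q (- x) <= c.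
  move=> [t /= t0 <-]; rewrite -(sq.2 t y)// lerBrDr addrC -lerBrDr opprK.
  have := sq.1 (x + t%:C%C *: y) (- x).
  by rewrite addrAC subrr add0r.
exists (fun x => inf (V x)); split.
- apply: (@sublinear_inf V (fun x => - q (- x))).
  + by move=> x; eexists; exists 0 => //=.
  + exact: Vm.
  + move=> x z _ _ [s /= s0 <-] [t /= t0 <-]; eexists.
      by exists (s + t) => //=; rewrite addr_ge0.
    have := sq.1 (x + s%:C%C *: y) (z + t%:C%C *: y).
    by rewrite addrACA -scalerDl -rmorphD mulrDl/= => h; lra.
  + move=> x _ t [s /= s0 <-] t0; eexists.
      by exists (t * s) => //=; rewrite mulr_ge0// ltW.
    by rewrite -scaleRA -scalerDr (sq.2 _ _ (ltW t0)) mulrBr mulrA.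
  + by move=> _ [t /= t0 <-]; rewrite add0r sq.2// subrr.
  + move=> e /ltW e0; exists 0 => //; exists 0 => //=.
    by rewrite mul0r scale0r addr0 subr0 (sublinear0 sq).
- move=> x; apply: ge_inf; first by exists (- q (- x)) => c /Vm.
  by exists 0 => //=; rewrite mul0r scale0r addr0 subr0.
- move=> t x t0; apply: ge_inf; first by exists (- q (- x)) => c /Vm.
  by exists t.
Qed.

(** By minimality [q] lies below its own tangent functional in direction [y]; at t = 1 this is the
    missing inequality [q x + q y <= q (x + y)]. *)
Lemma minimal_sublinearD q : sublinear q ->
  (forall r, sublinear r -> (forall x, r x <= q x) -> forall x, q x <= r x) ->
  forall x y, q (x + y) = q x + q y.
Proof.
move=> sq qmin x y; apply/eqP; rewrite eq_le sq.1/=.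
have [r [sr rq rt]] := sublinear_tangent y sq.
have := le_trans (qmin r sr rq x) (rt 1 x ler01).
by rewrite scale1r mul1r lerBrDr.
Qed.

(** The minimal functional is taken below the tangent of [p] at [x0] rather than below [p]: the
    tangent is at most [- p x0] at [- x0], and linearity of [q] then forces [q x0 = p x0]. *)
Lemma sublinear_dominated p x0 : sublinear p ->
  exists q, [/\ forall x y, q (x + y) = q x + q y,
    forall t x, q (t%:C%C *: x) = t * q x,
    forall x, q x <= p x & q x0 = p x0].
Proof.
move=> sp; have [r [sr rp rt]] := sublinear_tangent x0 sp.
have [q [sq qr qmin]] := sublinear_minimal sr.
have qD := minimal_sublinearD sq qmin.
have qN x : q (- x) = - q x.
  by apply/eqP; rewrite eq_sym eqr_oppLR -addr_eq0 -qD subrr (sublinear0 sq).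
exists q; split => //.
- move=> t x; have [t0|t0] := leP 0 t; first exact: sq.2.
  rewrite -[in LHS](opprK t) rmorphN scaleNr qN sq.2 ?mulNr ?opprK//.
  by rewrite oppr_ge0 ltW.
- by move=> x; exact: le_trans (qr x) (rp x).
- apply/eqP; rewrite eq_le (le_trans (qr x0) (rp x0))/=.
  have := le_trans (qr (- x0)) (rt 1 (- x0) ler01).
  by rewrite qN scale1r addNr (sublinear0 sp) mul1r sub0r lerN2.
Qed.

(** * Minkowski gauges and separation of a point from an absolutely convex set *)

Definition gauge (U : set E) x := inf [set t : R | 0 < t /\ U (t^-1%:C%C *: x)].

Variable U : set E.
Hypotheses (acU : absconvex U) (abU : absorbing U).

Let U0 : U 0. Proof. exact: absconvex0 acU abU. Qed.

Let gauge_neq0 x : [set t : R | 0 < t /\ U (t^-1%:C%C *: x)] !=set0.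
Proof.
have [r /posC[s s0 ->] Us] := abU x.
by exists s^-1 => /=; rewrite invr_gt0 invrK.
Qed.

Lemma gauge_sublinear : sublinear (gauge U).
Proof.
apply: (@sublinear_inf _ (fun=> 0)).
- exact: gauge_neq0.
- by move=> x a [/ltW].
- move=> x y a b [a0 Ua] [b0 Ub]; exists (a + b) => //.
  have ab0 : 0 < a + b by rewrite addr_gt0.
  split => //.
  have := @absconvexD _ _ U _ _ (a / (a + b))%:C%C (b / (a + b))%:C%C acU Ua Ub.
  rewrite !scaleRA.
  have -> : a / (a + b) * a^-1 = (a + b)^-1 by field; rewrite !gt_eqF.
  have -> : b / (a + b) * b^-1 = (a + b)^-1 by field; rewrite !gt_eqF.
  rewrite -scalerDr; apply.
  + by rewrite lecR divr_ge0 ?ltW.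
  + by rewrite lecR divr_ge0 ?ltW.
  + by rewrite -rmorphD -mulrDl mulfV ?gt_eqF.
- move=> x a t [a0 Ua] t0; exists (t * a) => //; split; first exact: mulr_gt0.
  rewrite scaleRA invfM.
  by have -> : t^-1 / a * t = a^-1 by field; rewrite !gt_eqF.
- by move=> a [/ltW].
- by move=> e e0; exists e => //; split => //; rewrite scaler0.
Qed.

Lemma gauge_le1 x : U x -> gauge U x <= 1.
Proof.
move=> Ux; apply: ge_inf; first by exists 0 => t [/ltW].
by split => //; rewrite invr1 scale1r.
Qed.

(** Invariance under unimodular scalars is what turns a bound on the real part of a functional into
    a bound on its modulus. *)
Lemma gauge_norm (a : R[i]) x : normc a = 1 -> gauge U (a *: x) = gauge U x.
Proof.
move=> a1; congr inf; apply/seteqP.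
have UZ b y : normc b = 1 -> U y -> U (b *: y).
  by move=> b1; apply: acU.2; rewrite -normcE b1.
split=> t /= [t0 Ut]; split => //; last first.
  by rewrite scalerA mulrC -scalerA; exact: UZ.
have a0 : a != 0.
  by apply/eqP => a0; move: a1; rewrite a0 normc_real// => /esym/eqP; rewrite oner_eq0.
have : normc a^-1 = 1.
  by have := normcM a a^-1; rewrite mulfV// normc_real// a1 mul1r.
move=> /UZ /(_ Ut).
have -> : a^-1 *: (t^-1%:C%C *: (a *: x)) = t^-1%:C%C *: x.
  by rewrite !scalerA mulrCA mulVf// mulr1.
by [].
Qed.

Lemma gauge_ge x r : 0 < r -> ~ U (r^-1%:C%C *: x) -> r <= gauge U x.
Proof.
move=> r0 nU; apply: (lb_le_inf (gauge_neq0 x)) => t [t0 Ut].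
rewrite leNgt; apply/negP => tr; apply: nU.
have -> : r^-1%:C%C *: x = (t / r)%:C%C *: (t^-1%:C%C *: x).
  by rewrite scaleRA; congr (_%:C%C *: _); field; rewrite !gt_eqF.
apply: acU.2 => //; rewrite (norm_le_normc _ 1) normc_real.
  by rewrite ler_pdivrMr// mul1r ltW.
by rewrite divr_ge0 ?ltW.
Qed.

(** A real functional [q] dominated by the gauge and equal to it at [x0] is complexified into
    [q x - i q (i x)]. Rotating [x] makes this value real and nonnegative, so that its modulus is a
    value of [q]. As [x0] is outside [r U], its gauge is at least [r > 1], which gives the strict
    inequality. *)
Lemma hahn_banach_separation r x0 : 1 < r -> ~ U (r^-1%:C%C *: x0) ->
  exists u : E -> R[i]^o, [/\ linear u, forall x, U x -> normc (u x) <= 1 &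
    1 < normc (u x0)].
Proof.
move=> r1 nU; have r0 : 0 < r by rewrite (lt_trans _ r1).
have [q [qD qZ qle qx0]] := sublinear_dominated x0 gauge_sublinear.
have qN x : q (- x) = - q x.
  by have := qZ (- 1) x; rewrite rmorphN scaleN1r mulN1r.
pose u x : R[i] := (q x +i* - q ('i%C *: x))%C.
have ii x : 'i%C *: ('i%C *: x) = - x.
  by rewrite scalerA -expr2 sqr_i scaleN1r.
have uD x y : u (x + y) = u x + u y.
  by rewrite /u scalerDr !qD opprD.
have uR t x : u (t%:C%C *: x) = t%:C%C * u x.
  rewrite /u scalerA mulrC -scalerA !qZ /GRing.mul/=.
  by rewrite !mul0r subr0 addr0 mulrN.
have ui x : u ('i%C *: x) = 'i%C * u x.
  rewrite /u ii qN opprK /GRing.mul/=.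
  by rewrite !mul0r !mul1r sub0r opprK add0r.
have uZ a x : u (a *: x) = a * u x.
  rewrite [a]complexE mulrDl -mulrA scalerDl uD uR -scalerA ui uR.
  by [].
exists u; split.
- by move=> a x y; rewrite uD uZ.
- move=> x Ux; have [ux0|ux0] := eqVneq (u x) 0; first by rewrite ux0 normc_real.
  have n0 : normc (u x) != 0.
    by apply: contra_neq ux0; exact: ComplexField.Normc.eq0_normc.
  pose a := (normc (u x))%:C%C / u x.
  have a1 : normc a = 1.
    have := normcM a (u x); rewrite /a mulfVK// normc_real ?normc_ge0//.
    by move=> /esym/(canRL (mulfK n0)); rewrite mulfV.
  have uax : u (a *: x) = (normc (u x))%:C%C by rewrite uZ /a mulfVK.
  have -> : normc (u x) = q (a *: x) by have := uax; rewrite /u => -[->].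
  by rewrite (le_trans (qle _))// gauge_norm// gauge_le1.
- apply: (lt_le_trans r1); apply: le_trans (gauge_ge r0 nU) _.
  rewrite -qx0 /u /= (le_trans (ler_norm _))// -sqrtr_sqr ler_wsqrtr//.
  by rewrite lerDl sqr_ge0.
Qed.

End hahn_banach.

(** * Spaces with countably many seminorms *)

Lemma ltr_invS (R : realType) (e : R) : 0 < e ->
  exists n, forall k, (n <= k)%N -> k.+1%:R^-1 < e.
Proof.
move=> e0; exists (Num.truncn e^-1) => k nk.
rewrite invf_plt ?posrE// (lt_le_trans (truncnS_gt _))// ler_nat ltnS.
exact: nk.
Qed.

Section seminorms.
Variables (R : realType) (E : lmodType R[i]) (q : nat -> E -> R).

Record seminorms := Seminorms {
  seminormD : forall n x y, q n (x + y) <= q n x + q n y ;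
  seminormZ : forall n a x, q n (a *: x) = normc a * q n x ;
  seminorm_mono : forall m n x, (m <= n)%N -> q m x <= q n x }.

Hypothesis sq : seminorms.

Lemma seminorm0 n : q n 0 = 0.
Proof. by rewrite -(scale0r 0) (seminormZ sq) normc_real// mul0r. Qed.

Lemma seminormN n x : q n (- x) = q n x.
Proof. by rewrite -scaleN1r (seminormZ sq) normcN normc_real// mul1r. Qed.

Lemma seminormB n x y : q n (x - y) = q n (y - x).
Proof. by rewrite -[RHS]seminormN opprB. Qed.

Lemma seminorm_ge0 n x : 0 <= q n x.
Proof.
have := seminormD sq n x (- x); rewrite subrr seminorm0 seminormN.
by rewrite -mulr2n pmulrn_lge0.
Qed.

Lemma seminorm_trans n x y z : q n (x - z) <= q n (x - y) + q n (y - z).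
Proof. by have := seminormD sq n (x - y) (y - z); rewrite addrA subrK. Qed.

Definition seminorm_base (U : set E) : Prop :=
  exists n (e : R), 0 < e /\ U = [set x | q n x < e].

Let sn_neq0 : exists U, seminorm_base U.
Proof. by eexists; exists 0%N, 1. Qed.

Let sn_absconvex U : seminorm_base U -> absconvex U.
Proof.
move=> [n [e [e0 ->]]]; split.
  move=> x y t /set_mem/= qx /set_mem/= qy; apply/mem_set => /=.
  have [s [u [s0 u0 su ts tu]]] := i01C t.
  change (q n (t%:num *: x + (1 - t%:num) *: y) < e); rewrite tu ts.
  rewrite (le_lt_trans (seminormD sq _ _ _))// !(seminormZ sq) !normc_real//.
  rewrite (@le_lt_trans _ _ (Num.max (q n x) (q n y)))//; last by rewrite gt_max qx.
  rewrite -[leRHS]mul1r -su mulrDl lerD// ler_wpM2l// le_max lexx//.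
  by rewrite orbT.
move=> a x /normc_le1 a1 /=; apply: le_lt_trans.
by rewrite (seminormZ sq) ler_piMl// seminorm_ge0.
Qed.

Let sn_absorbing U : seminorm_base U -> absorbing U.
Proof.
move=> [n [e [e0 ->]]] x.
have q1 : 0 < q n x + 1 by rewrite ltr_wpDl// seminorm_ge0.
exists (e / (q n x + 1))%:C%C; first by rewrite ltcR divr_gt0.
rewrite /= (seminormZ sq) normc_real; last by rewrite divr_ge0 ?ltW.
by rewrite mulrAC ltr_pdivrMr// ltr_pM2l// ltrDl.
Qed.

Let sn_setI U V : seminorm_base U -> seminorm_base V ->
  exists2 W, seminorm_base W & W `<=` U `&` V.
Proof.
move=> [n [e [e0 ->]]] [m [d [d0 ->]]].
exists [set x | q (maxn n m) x < Num.min e d].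
  by exists (maxn n m), (Num.min e d); rewrite lt_min e0.
move=> x /=; rewrite lt_min => /andP[qe qd]; split => /=.
  by rewrite (le_lt_trans _ qe)// (seminorm_mono sq)// leq_maxl.
by rewrite (le_lt_trans _ qd)// (seminorm_mono sq)// leq_maxr.
Qed.

Let sn_scale U (r : R[i]) : seminorm_base U -> 0 < r ->
  exists2 W, seminorm_base W & forall x, W x -> U (r *: x).
Proof.
move=> [n [e [e0 ->]]] /posC[s s0 ->].
exists [set x | q n x < e / s]; first by exists n, (e / s); rewrite divr_gt0.
move=> x /=; rewrite (seminormZ sq) normc_real ?(ltW s0)//.
by rewrite ltr_pdivlMr// mulrC.
Qed.

Definition seminorm_lcbase :=
  LCBase sn_neq0 sn_absconvex sn_absorbing sn_setI sn_scale.

Lemma seminorm_nbhs (x : lctype seminorm_lcbase) (A : set (lctype seminorm_lcbase)) :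
  nbhs x A <-> exists n (e : R), 0 < e /\ forall y, q n (y - x) < e -> A y.
Proof.
split=> [[U [n [e [e0 ->]]] UA]|[n [e [e0 qA]]]].
  by exists n, e; split => // y /UA; rewrite addrC subrK.
exists [set x | q n x < e]; first by exists n, e.
by move=> u /= que; apply: qA; rewrite addrAC subrr add0r.
Qed.

End seminorms.

Section frechet_schwartz.
Variables (R : realType) (E : tvsType R[i]) (q : nat -> E -> R).
Hypothesis sq : seminorms q.
Hypothesis q_nbhs : forall x (A : set E),
  nbhs x A <-> exists n (e : R), 0 < e /\ forall y, q n (y - x) < e -> A y.

Let q_ge0 := seminorm_ge0 sq.

(** The distance is the supremum over n of [q n (x - y)] capped at 1/(n+1). The caps make all terms
    beyond some n small, and monotonicity of the seminorms lets [q n] control the terms before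
    it. *)
Lemma seminorms_metrizable : (forall x, (forall n, q n x = 0) -> x = 0) ->
  metrizable E.
Proof.
move=> q_sep.
pose D x y := [set Num.min (n.+1%:R^-1) (q n (x - y)) | n in @setT nat].
have Dub x y c : D x y c -> c <= 1.
  by move=> [n _ <-]; rewrite ge_min invf_le1 ?ler1n.
have D0 x y : D x y !=set0 by eexists; exists 0%N.
pose d x y := sup (D x y).
have dle x y n : Num.min (n.+1%:R^-1) (q n (x - y)) <= d x y.
  by apply: ub_le_sup; [exists 1 => c /Dub|exists n].
have led x y (e : R) : (forall n, Num.min (n.+1%:R^-1) (q n (x - y)) <= e) -> d x y <= e.
  by move=> h; apply: ge_sup => // _ [n _ <-].
have n0 n : 0 < n.+1%:R^-1 :> R by rewrite invr_gt0.
exists d; split.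
- move=> x y; split=> [d0|->]; last first.
    apply/eqP; rewrite eq_le led => [|n]; last first.
      by rewrite subrr (seminorm0 sq) ge_min lexx orbT.
    by rewrite (le_trans _ (dle _ _ 0%N))// subrr (seminorm0 sq) le_min lexx (ltW (n0 0%N)).
  apply/eqP; rewrite -subr_eq0; apply/eqP/q_sep => n.
  apply/eqP; rewrite eq_le q_ge0 andbT.
  by have := dle x y n; rewrite d0 ge_min leNgt n0.
- move=> x y; congr sup; apply/seteqP.
  by split=> _ [n _ <-]; exists n => //; rewrite (seminormB sq).
- move=> x y z; apply: led => n.
  apply: le_trans (lerD (dle x y n) (dle y z n)).
  have := seminorm_trans sq n x y z.
  have := q_ge0 n (x - y); have := q_ge0 n (y - z); have := n0 n.
  move: (n.+1%:R^-1) (q n (x - z)) (q n (x - y)) (q n (y - z)) => a b c f a0 f0 c0 bcf.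
  by rewrite /Num.min; do 3! case: ltP => ?; lra.
- move=> x A; split=> [/q_nbhs[n [e [e0 qA]]]|[e e0 dA]].
    exists (Num.min (n.+1%:R^-1) e); first by rewrite lt_min n0.
    move=> y /= dxy; apply: qA; rewrite (seminormB sq).
    have := le_lt_trans (dle x y n) dxy.
    rewrite lt_min !gt_min ltxx/= => /andP[qn /orP[|//]].
    exact: lt_trans.
  have [n ne] := ltr_invS (divr_gt0 e0 (ltr0n R 2)).
  apply/q_nbhs; exists n, (e / 2); split; first by rewrite divr_gt0.
  move=> y qe; apply: dA => /=; apply: (@le_lt_trans _ _ (e / 2)).
    apply: led => k; rewrite ge_min; apply/orP.
    have [nk|kn] := leqP n k; [left|right]; first exact/ltW/ne.
    by rewrite (seminormB sq) (le_trans (seminorm_mono sq _ (ltnW kn)))// ltW.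
  by rewrite ltr_pdivrMr// ltr_pMr// ltr1n.
Qed.

(** Countability reduces Cauchy filters to Cauchy sequences: choose [A n] in the filter of
    [q n]-diameter below 1/(n+1), and a point [x n] common to [A 0], ..., [A n]. The filter
    converges to the limit of this sequence. *)
Lemma seminorms_complete :
  (forall x : nat -> E, (forall n (e : R), 0 < e ->
     exists K, forall j k, (K <= j)%N -> (K <= k)%N -> q n (x j - x k) < e) ->
   exists l, forall n (e : R), 0 < e ->
     exists K, forall k, (K <= k)%N -> q n (x k - l) < e) ->
  tvs_complete E.
Proof.
move=> qc F FF cF.
have /choice[A AP] n : exists A, F A /\ forall x y, A x -> A y -> q n (x - y) < n.+1%:R^-1.
  have [|A FA AA] := cF [set x | q n x < n.+1%:R^-1].
    apply/q_nbhs; exists n, n.+1%:R^-1; split; first by rewrite invr_gt0.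
    by move=> y; rewrite subr0.
  by exists A.
have /choice[x xP] n : exists x, forall i, (i <= n)%N -> A i x.
  have : F [set x | forall i, (i <= n)%N -> A i x].
    elim: n => [|n IH].
      by apply: filterS (AP 0%N).1 => x Ax i; rewrite leqn0 => /eqP ->.
    apply: filterS2 IH (AP n.+1).1 => x Ax An i.
    by rewrite leq_eqVlt => /predU1P[->//|]; rewrite ltnS; exact: Ax.
  by move=> /filter_ex.
have [n e e0|l lP] := qc x.
  have [K Ke] := ltr_invS e0; exists (maxn K n) => j k.
  rewrite !geq_max => /andP[Kj nj] /andP[Kk nk].
  have h : q (maxn K n) (x j - x k) < (maxn K n).+1%:R^-1.
    by apply: (AP _).2; apply: xP; rewrite geq_max ?Kj ?Kk.
  rewrite (le_lt_trans (seminorm_mono sq _ (leq_maxr K n)))//.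
  by rewrite (lt_trans h)// Ke// leq_maxl.
exists l => B /q_nbhs[n [e [e0 qB]]].
have e2 : 0 < e / 2 by rewrite divr_gt0.
have [K Ke] := ltr_invS e2; have [K' K'e] := lP n _ e2.
pose N := maxn K n; apply: filterS (AP N).1 => y Ay; apply: qB.
pose k := maxn N K'.
rewrite (le_lt_trans (seminorm_trans sq _ _ (x k) _))// [ltRHS]splitr ltrD//.
  rewrite (le_lt_trans (seminorm_mono sq _ (leq_maxr K n)))//.
  rewrite (lt_trans ((AP N).2 _ _ Ay _))//; first by apply: xP; exact: leq_maxl.
  by apply: Ke; exact: leq_maxl.
by apply: K'e; exact: leq_maxr.
Qed.

Lemma seminorms_schwartz :
  (forall n, exists m, forall e : R, 0 < e -> exists2 S : set E, finite_set S &
     forall x, q m x < 1 -> exists2 s, S s & q n (x - s) < e) ->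
  schwartz_space E.
Proof.
move=> qS U /q_nbhs[n [e [e0 qU]]]; have [m qm] := qS n.
exists [set x | q m x < 1].
  by apply/q_nbhs; exists m, 1; split => // y; rewrite subr0.
move=> r /posC[s s0 ->]; have [S Sfin Sm] := qm (s * e) (mulr_gt0 s0 e0).
exists S => // x /Sm[y Sy xy]; exists y => //.
exists (s^-1%:C%C *: (x - y)); last first.
  by rewrite scaleRA mulfV ?gt_eqF// scale1r addrC subrK.
apply: qU; rewrite subr0 (seminormZ sq) normc_real ?invr_ge0 ?(ltW s0)//.
by rewrite mulrC ltr_pdivrMr// mulrC.
Qed.

End frechet_schwartz.

(** * Complex numbers *)

Section complex_norm.
Variable R : realType.
Implicit Types (z w : R[i]) (e : R).

Lemma normc_Re z : `|complex.Re z| <= normc z.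
Proof. by case: z => x y /=; rewrite -sqrtr_sqr ler_wsqrtr// lerDl sqr_ge0. Qed.

Lemma normc_Im z : `|complex.Im z| <= normc z.
Proof. by case: z => x y /=; rewrite -sqrtr_sqr ler_wsqrtr// lerDr sqr_ge0. Qed.

Lemma normc0P z : normc z <= 0 -> z = 0.
Proof.
move=> z0; apply: ComplexField.Normc.eq0_normc.
by apply/eqP; rewrite eq_le z0 normc_ge0.
Qed.

Lemma normcB z w : normc (z - w) = normc (w - z).
Proof. by rewrite -normcN opprB. Qed.

Lemma normcX z n : normc (z ^+ n) = normc z ^+ n.
Proof.
elim: n => [|n IH]; first by rewrite !expr0 normc_real.
by rewrite !exprS normcM IH.
Qed.

Lemma normc_sum (I : Type) (r : seq I) (P : pred I) (F : I -> R[i]) :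
  normc (\sum_(i <- r | P i) F i) <= \sum_(i <- r | P i) normc (F i).
Proof.
elim/big_rec2: _ => [|i y x _ h]; first by rewrite normc_real.
by rewrite (le_trans (normcD _ _))// lerD2l.
Qed.

Lemma normc_small z : (forall e, 0 < e -> normc z <= e) -> z = 0.
Proof.
by move=> ze; apply: normc0P; apply/ler_addgt0Pr => e /ze; rewrite add0r.
Qed.

Lemma normc_complete (z : nat -> R[i]) :
  (forall e, 0 < e -> exists K, forall j k, (K <= j)%N -> (K <= k)%N ->
    normc (z j - z k) < e) ->
  exists l, forall e, 0 < e -> exists K, forall k, (K <= k)%N -> normc (z k - l) < e.
Proof.
move=> zc.
have cv (f : {additive R[i] -> R}) : (forall w, `|f w| <= normc w) ->
    exists l, forall e, 0 < e -> exists K, forall k, (K <= k)%N -> `|f (z k) - l| < e.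
  move=> fle.
  have : cauchy ((fun n => f (z n)) @ \oo).
    apply: cauchy_exP => e /= e0; have [K Kz] := zc e e0.
    exists (f (z K)); exists K => // k Kk /=.
    rewrite -ball_normE/= -raddfB (le_lt_trans (fle _))// Kz//.
  move=> /cauchy_cvg/cvg_ex[l /cvgrPdist_lt fl]; exists l => e e0.
  have [K _ Kl] := fl e e0; exists K => k /Kl/=; by rewrite distrC.
have [x xP] := cv (@complex.Re R : {additive _ -> _}) normc_Re.
have [y yP] := cv (@complex.Im R : {additive _ -> _}) normc_Im.
exists (x +i* y)%C => e e0; have e2 : 0 < e / 2 by rewrite divr_gt0.
have [K1 K1P] := xP _ e2; have [K2 K2P] := yP _ e2.
exists (maxn K1 K2) => k; rewrite geq_max => /andP[/K1P k1 /K2P k2].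
move: k1 k2; case: (z k) => a b /= k1 k2.
by rewrite (le_lt_trans (normc_le_ReIm _ _))// [ltRHS]splitr ltrD.
Qed.

Lemma nbhs_normc z (A : set R[i]^o) :
  nbhs (z : R[i]^o) A <-> exists2 e, 0 < e & forall w, normc (w - z) < e -> A w.
Proof.
split=> [/nbhs_ballP[r /= /posC[e e0 ->] eA]|[e e0 eA]].
  exists e => // w wz; apply: eA; rewrite -ball_normE/= distrC.
  by rewrite -normcE ltcR.
apply/nbhs_ballP; exists e%:C%C => /=; first by rewrite ltcR.
by move=> w; rewrite -ball_normE/= distrC -normcE ltcR; exact: eA.
Qed.

(** Pigeonhole: the real and imaginary parts of the k coordinates are cut into cells of length d/2,
    and one point of [B] is kept in each cell that meets [B]. *)
Lemma bounded_finite_net (X : Type) k (T : 'I_k -> X -> R[i]) (B : set X) (M d : R) :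
  (forall x i, B x -> normc (T i x) <= M) -> 0 < d ->
  exists S : set X, [/\ finite_set S, S `<=` B &
    forall x, B x -> exists2 s, S s & forall i, normc (T i x - T i s) < d].
Proof.
move=> TM d0; have d2 : 0 < d / 2 by rewrite divr_gt0.
have [[x0 Bx0]|B0] := pselect (exists x, B x); last first.
  by exists set0; split => // x Bx; exfalso; apply: B0; exists x.
pose g (t : R) := Num.truncn ((t + M) / (d / 2)).
have gE s t : 0 <= s + M -> 0 <= t + M -> g s = g t -> `|s - t| < d / 2.
  move=> s0 t0 st.
  have := truncn_itv (divr_ge0 s0 (ltW d2)); rewrite -/(g s) st => /andP[s1 s2].
  have := truncn_itv (divr_ge0 t0 (ltW d2)); rewrite -/(g t) => /andP[t1 t2].
  move: s1 s2 t1 t2; rewrite !ler_pdivlMr// !ltr_pdivrMr// -!natr1 !mulrDl !mul1r.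
  by move=> *; rewrite ltr_norml; apply/andP; split; lra.
pose m := (g M).+1.
have gm t : t <= M -> (g t < m)%N.
  by move=> tM; rewrite ltnS le_truncn// ler_pM2r ?invr_gt0// lerD2r.
pose code x : {ffun 'I_k -> 'I_m * 'I_m} :=
  [ffun i => (inord (g (complex.Re (T i x))), inord (g (complex.Im (T i x))))].
(* A cell that does not meet [B] gets the default [x0], so that all representatives lie in [B]. *)
have /choice[r rP] c : exists x, B x /\ ((exists2 y, B y & code y = c) -> code x = c).
  by have [[y By yc]|no] := pselect (exists2 y, B y & code y = c);
    [exists y|exists x0].
exists (range r); split.
- exact/finite_image/finite_finset.
- by move=> _ [c _ <-]; exact: (rP c).1.
move=> x Bx; exists (r (code x)); first by exists (code x).
have /= := (rP (code x)).2 ltac:(by exists x); have := (rP (code x)).1.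
move: (r _) => s Bs sx i.
have [] : (g (complex.Re (T i s)) = g (complex.Re (T i x))) /\
    (g (complex.Im (T i s)) = g (complex.Im (T i x))).
  have := congr1 (fun h : {ffun _ -> _} => h i) sx; rewrite /= !ffunE => -[].
  have ReM y : B y -> complex.Re (T i y) <= M.
    by move=> By; rewrite (le_trans (ler_norm _))// (le_trans (normc_Re _))// TM.
  have ImM y : B y -> complex.Im (T i y) <= M.
    by move=> By; rewrite (le_trans (ler_norm _))// (le_trans (normc_Im _))// TM.
  by move=> /(congr1 val) + /(congr1 val); rewrite /= !inordK ?gm ?ReM ?ImM.
have Re0 y : B y -> 0 <= complex.Re (T i y) + M.
  move=> By; rewrite -lerBlDr sub0r lerNl.
  by rewrite (le_trans (ler_norm _))// normrN (le_trans (normc_Re _))// TM.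
have Im0 y : B y -> 0 <= complex.Im (T i y) + M.
  move=> By; rewrite -lerBlDr sub0r lerNl.
  by rewrite (le_trans (ler_norm _))// normrN (le_trans (normc_Im _))// TM.
move=> /(gE _ _ (Re0 _ Bs) (Re0 _ Bx)) + /(gE _ _ (Im0 _ Bs) (Im0 _ Bx)).
rewrite normcB; case: (T i s) (T i x) => a b [a' b'] /= h1 h2.
by rewrite (le_lt_trans (normc_le_ReIm _ _))// [ltRHS]splitr ltrD.
Qed.

End complex_norm.

(** * Duality of compact inductive limits *)

Section compact_steps.
Variables (R : realType) (E : tvsType R[i]) (B : nat -> set E).
Local Notation C := R[i].

Hypotheses (B_absconvex : forall n, absconvex (B n)) (B_0 : forall n, B n 0)
  (B_mono : forall m n, (m <= n)%N -> B m `<=` B n)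
  (B_cover : forall x, exists n, exists2 r : R, 0 < r & B n (r%:C%C *: x))
  (B_bounded : forall n (U : set E), nbhs 0 U ->
     exists2 r : R, 0 < r & forall x, B n x -> U (r%:C%C *: x))
  (B_finest : forall U : set E, absconvex U ->
     (forall n, exists2 r : R, 0 < r & forall x, B n x -> U (r%:C%C *: x)) ->
     nbhs 0 U)
  (B_precompact : forall n, exists m, forall e : R, 0 < e ->
     exists S : set E, [/\ finite_set S, S `<=` B n &
       forall x, B n x -> exists s y, [/\ S s, B m y & x = s + e%:C%C *: y]])
  (B_compact : forall n (G : set_system E), UltraFilter G -> G (B n) ->
     exists x : E, G --> x)
  (E_hausdorff : forall x : E, x != 0 -> exists2 U : set E, nbhs 0 U & ~ U x).

(** * The dual with the topology of uniform convergence on the balls of the steps *)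

Lemma dualDE (u v : dual E) x : val (u + v) x = val u x + val v x :> C.
Proof. by []. Qed.

Lemma dualZE (a : C) (u : dual E) x : val (a *: u) x = a * val u x :> C.
Proof. by []. Qed.

Lemma dualBE (u v : dual E) x : val (u - v) x = val u x - val v x :> C.
Proof. by []. Qed.

Lemma dual_linear (u : dual E) : linear (val u).
Proof. by have := valP u; rewrite inE => -[]. Qed.

Lemma dual_continuous (u : dual E) : continuous (val u).
Proof. by have := valP u; rewrite inE => -[]. Qed.

Lemma dual0 (u : dual E) : val u 0 = 0 :> C.
Proof. by have := dual_linear u (- 1) 0 0; rewrite scaler0 addr0 scaleN1r addNr. Qed.

Lemma dualD (u : dual E) x y : val u (x + y) = val u x + val u y :> C.
Proof. by have := dual_linear u 1 x y; rewrite !scale1r. Qed.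

Lemma dualZ (u : dual E) a x : val u (a *: x) = a * val u x :> C.
Proof. by have := dual_linear u a x 0; rewrite !addr0 dual0 addr0. Qed.

Lemma absconvex_preim (T : lmodType C) (f : T -> C^o) (e : R) : linear f ->
  absconvex [set x | normc (f x) <= e].
Proof.
move=> lf.
have f0 : f 0 = 0 by have := lf (- 1) 0 0; rewrite scaler0 addr0 scaleN1r addNr.
have fZ a x : f (a *: x) = a * f x :> C by have := lf a x 0; rewrite !addr0 f0 addr0.
split.
  move=> x y t /set_mem/= fx /set_mem/= fy; apply/mem_set => /=.
  have [s [u [s0 u0 su ts tu]]] := i01C t.
  change (normc (f (t%:num *: x + (1 - t%:num) *: y)) <= e).
  rewrite tu ts lf fZ (le_trans (normcD _ _))// !normcM !normc_real//.
  by rewrite -[leRHS]mul1r -su mulrDl lerD// ler_wpM2l.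
move=> a x /normc_le1 a1 /= fx; rewrite fZ normcM.
by rewrite (le_trans _ fx)// ler_piMl// normc_ge0.
Qed.

(** Continuity is tested on the steps: the set where |f| <= e/2 is absolutely convex and absorbs
    every [B n], hence is a neighbourhood of 0 by [B_finest]. *)
Lemma linear_bounded_dual (f : E -> C^o) : linear f ->
  (forall n, exists M : R, forall x, B n x -> normc (f x) <= M) ->
  f \in @dual_pred R E.
Proof.
move=> lf fM; rewrite inE; split => //.
have f0 : f 0 = 0 by have := lf (- 1) 0 0; rewrite scaler0 addr0 scaleN1r addNr.
have fZ a x : f (a *: x) = a * f x :> C by have := lf a x 0; rewrite !addr0 f0 addr0.
have fD x y : f (x + y) = f x + f y :> C by have := lf 1 x y; rewrite !scale1r.
move=> x A /nbhs_normc[e e0 eA].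
have e2 : 0 < e / 2 by rewrite divr_gt0.
have : nbhs (0 : E) [set y | normc (f y) <= e / 2].
  apply: B_finest; first exact: absconvex_preim.
  move=> n; have [M MB] := fM n.
  have M1 : 0 < `|M| + 1 by rewrite ltr_wpDl.
  exists (e / 2 / (`|M| + 1)); first by rewrite divr_gt0.
  move=> y /MB fy /=; rewrite fZ normcM normc_real; last by rewrite divr_ge0 ?ltW.
  rewrite mulrAC ler_pdivrMr// ler_pM2l// (le_trans fy)//.
  by rewrite (le_trans (ler_norm _))// lerDl.
move=> /(nbhsB x); rewrite addr0; apply: filterS => _ [y /= fy <-].
apply: eA; rewrite fD addrAC subrr add0r (le_lt_trans fy)//.
by rewrite ltr_pdivrMr// ltr_pMr// ltr1n.
Qed.

Lemma dual_bounded (u : dual E) n : exists M : R, forall x, B n x -> normc (val u x) <= M.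
Proof.
have /B_bounded - /(_ n)[r r0 Br] : nbhs (0 : E) [set x | normc (val u x) <= 1].
  apply: (@dual_continuous u 0 [set z | normc z <= 1]).
  rewrite dual0; apply/nbhs_normc; exists 1 => // w.
  by rewrite subr0 => /ltW.
exists r^-1 => x /Br/=; rewrite dualZ normcM normc_real ?(ltW r0)// mulrC.
by rewrite -ler_pdivlMr// mul1r.
Qed.

Definition polar_norm n (u : dual E) : R := sup [set normc (val u x) | x in B n].

Lemma polar_norm_ge n u x : B n x -> normc (val u x) <= polar_norm n u.
Proof.
move=> Bx; have [M MB] := dual_bounded u n.
by apply: ub_le_sup; [exists M => _ [y By <-]; exact: MB|exists x].
Qed.

Lemma polar_norm_le n u (c : R) : (forall x, B n x -> normc (val u x) <= c) ->
  polar_norm n u <= c.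
Proof.
move=> uc; apply: ge_sup; last by move=> _ [x Bx <-]; exact: uc.
by exists (normc (val u 0)), 0.
Qed.

Lemma polar_seminorms : seminorms polar_norm.
Proof.
have half n a u : polar_norm n (a *: u) <= normc a * polar_norm n u.
  apply: polar_norm_le => x Bx; rewrite dualZE normcM.
  by rewrite ler_wpM2l ?normc_ge0// polar_norm_ge.
split.
- move=> n u v; apply: polar_norm_le => x Bx.
  by rewrite dualDE (le_trans (normcD _ _))// lerD// polar_norm_ge.
- move=> n a u; apply/eqP; rewrite eq_le half/=.
  have p0 v : 0 <= polar_norm n v.
    by apply: le_trans (polar_norm_ge v (B_0 n)); exact: normc_ge0.
  have [->|a0] := eqVneq a 0; first by rewrite normc_real// mul0r.
  have a1 : 0 < normc a.
    rewrite lt_neqAle normc_ge0 andbT eq_sym.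
    by apply: contra_neq a0; exact: ComplexField.Normc.eq0_normc.
  have := half n a^-1 (a *: u); rewrite scalerA mulVf// scale1r.
  rewrite -(ler_pM2l a1) mulrA -normcM mulfV// normc_real// mul1r.
  exact.
- move=> m n u mn; apply: polar_norm_le => x Bx.
  by apply: polar_norm_ge; exact: B_mono Bx.
Qed.

Definition predual : tvsType C := lctype (seminorm_lcbase polar_seminorms).

Let P_nbhs (u : predual) (A : set predual) : nbhs u A <->
  exists n (e : R), 0 < e /\ forall v : predual, polar_norm n (v - u) < e -> A v.
Proof. exact: seminorm_nbhs. Qed.

(** The convergence is uniform on each [B n], so the pointwise limit is linear and bounded on each
    [B n]; [linear_bounded_dual] makes it continuous. *)
Lemma predual_complete : tvs_complete predual.
Proof.
apply: (@seminorms_complete R predual polar_norm polar_seminorms P_nbhs) => u cu.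
have cx x : exists l : C, forall e : R, 0 < e -> exists K, forall k, (K <= k)%N ->
    normc (val (u k) x - l) < e.
  apply: normc_complete => e e0; have [n [r r0 Bx]] := B_cover x.
  have [K Ku] := cu n (e * r) (mulr_gt0 e0 r0); exists K => j k Kj Kk.
  have := le_lt_trans (polar_norm_ge (u j - u k) Bx) (Ku j k Kj Kk).
  by rewrite dualBE !dualZ -mulrBr normcM normc_real ?(ltW r0)// mulrC ltr_pM2r.
have {cx} [l lP] := choice cx.
have lu n (e : R) : 0 < e -> exists K, forall k, (K <= k)%N ->
    forall x, B n x -> normc (val (u k) x - l x) <= e.
  move=> e0; have [K Ku] := cu n e e0; exists K => k Kk x Bx.
  apply/ler_addgt0Pr => d d0; have [K' K'l] := lP x d d0.
  pose j := maxn K K'.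
  have -> : val (u k) x - l x = (val (u k) x - val (u j) x) + (val (u j) x - l x).
    by rewrite addrA subrK.
  rewrite (le_trans (normcD _ _))// lerD//; last by rewrite ltW// K'l// leq_maxr.
  rewrite -dualBE (le_trans (polar_norm_ge _ Bx))// ltW// Ku//.
  exact: leq_maxl.
have ll : linear (l : E -> C^o).
  move=> a x y; apply/eqP; rewrite -subr_eq0; apply/eqP.
  apply: normc_small => e e0; have a1 : 0 < normc a + 2.
    by rewrite ltr_wpDl ?normc_ge0.
  have e1 : 0 < e / (normc a + 2) by rewrite divr_gt0.
  have [K1 K1P] := lP x _ e1; have [K2 K2P] := lP y _ e1.
  have [K3 K3P] := lP (a *: x + y) _ e1.
  pose k := maxn K1 (maxn K2 K3).
  have k1 := K1P k ltac:(by rewrite leq_max leqnn).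
  have k2 := K2P k ltac:(by rewrite !leq_max leqnn orbT).
  have k3 := K3P k ltac:(by rewrite !leq_max leqnn !orbT).
  rewrite dualD dualZ in k3.
  change (normc (l (a *: x + y) - (a * l x + l y) : C) <= e).
  have -> : l (a *: x + y) - (a * l x + l y) = a * (val (u k) x - l x) +
      (val (u k) y - l y) - (a * val (u k) x + val (u k) y - l (a *: x + y)).
    by ring.
  rewrite (le_trans (normcD _ _))// normcN.
  rewrite (le_trans (lerD (normcD _ _) (lexx _)))// normcM.
  have -> : e = normc a * (e / (normc a + 2)) + e / (normc a + 2) + e / (normc a + 2).
    by field; rewrite gt_eqF.
  by rewrite !lerD// ?(ltW k2)// ?(ltW k3)// ler_wpM2l ?normc_ge0 ?ltW.
have lB n : exists M : R, forall x, B n x -> normc (l x) <= M.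
  have [K /(_ K (leqnn _)) uK] := lu n 1 ltr01.
  exists (polar_norm n (u K) + 1) => x Bx.
  have -> : l x = val (u K) x - (val (u K) x - l x) by rewrite subKr.
  by rewrite (le_trans (normcD _ _))// normcN lerD// ?uK// polar_norm_ge.
exists (Sub (l : E -> C^o) (linear_bounded_dual ll lB)) => n e e0.
have [K Kl] := lu n (e / 2) (divr_gt0 e0 (ltr0n _ 2)).
exists K => k Kk; apply: (@le_lt_trans _ _ (e / 2)).
  by apply: polar_norm_le => x Bx; rewrite dualBE SubK; exact: Kl.
by rewrite ltr_pdivrMr// ltr_pMr// ltr1n.
Qed.

(** Schauder's argument: since [B n] is covered by finitely many translates of (e/4) [B m0], a
    functional of [polar_norm m] below 1 is known on [B n], up to a small error, from its values at
    finitely many points. *)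
Lemma predual_schwartz : schwartz_space predual.
Proof.
apply: (@seminorms_schwartz R predual polar_norm polar_seminorms P_nbhs) => n.
(* The index [m] also dominates [n], so that these values, taken at points of [B n], are bounded by
   1. *)
have [m0 mP] := B_precompact n; pose m := maxn m0 n.
exists m => e e0; have e4 : 0 < e / 4 by rewrite divr_gt0.
have [S [Sfin SB Sx]] := mP _ e4.
have /finite_seqP[s sS] := Sfin.
have [|T [Tfin TB Tu]] := @bounded_finite_net R (dual E) (size s)
    (fun i u => val u (nth 0 s i)) [set u | polar_norm m u < 1] 1 (e / 4) _ e4.
  move=> u i /= u1; rewrite (le_trans _ (ltW u1))//.
  apply: polar_norm_ge; apply: (B_mono (leq_maxr m0 n)); apply: SB.
  by rewrite sS /=; exact: mem_nth.
exists T => // u u1; have [v Tv uv] := Tu u u1; exists v => //.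
have v1 : polar_norm m v < 1 := TB v Tv.
apply: (@le_lt_trans _ _ (3 * (e / 4))); last by lra.
apply: polar_norm_le => x /Sx[w [y [Sw By ->]]].
have Bmy : B m y := B_mono (leq_maxl m0 n) By.
rewrite dualBE !dualD !dualZ.
have -> : val u w + (e / 4)%:C%C * val u y - (val v w + (e / 4)%:C%C * val v y) =
  (val u w - val v w) + (e / 4)%:C%C * (val u y - val v y) by ring.
rewrite (le_trans (normcD _ _))//.
have -> : 3 * (e / 4) = e / 4 + (e / 4) * (1 + 1) by ring.
apply: lerD.
  move: Sw; rewrite sS /= => /(nthP 0)[i si <-].
  exact: ltW (uv (Ordinal si)).
rewrite normcM normc_real ?(ltW e4)// ler_pM2l//.
rewrite (le_trans (normcD _ _))// normcN.
by rewrite lerD// (le_trans (polar_norm_ge _ Bmy))// ltW.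
Qed.

Lemma predual_frechet_schwartz : frechet_schwartz_space predual.
Proof.
split; last exact: predual_schwartz.
split; last exact: predual_complete.
apply: (@seminorms_metrizable R predual polar_norm polar_seminorms P_nbhs) => u u0.
apply: val_inj; apply/funext => x; have [n [r r0 Bx]] := B_cover x.
have := polar_norm_ge u Bx; rewrite u0 dualZ normcM normc_real ?(ltW r0)//.
rewrite pmulr_rle0// => /normc0P ->.
by [].
Qed.


(** * The evaluation map into the strong dual *)

Lemma eval_dual_pred (x : E) : (fun u : predual => val u x : C^o) \in @dual_pred R predual.
Proof.
rewrite inE; split => // u A /nbhs_normc[e e0 eA].
have [n [r r0 Bx]] := B_cover x.
apply/P_nbhs; exists n, (e * r); split; first exact: mulr_gt0.
move=> v uv; apply: eA; rewrite -dualBE -(ltr_pM2r r0).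
apply: le_lt_trans uv.
rewrite mulrC -[X in X * _](normc_real (ltW r0)) -normcM -dualZ.
exact: polar_norm_ge.
Qed.

Definition eval_dual (x : E) : strong_dual predual :=
  Sub (fun u : predual => val u x : C^o) (eval_dual_pred x).

Lemma eval_dualE x (u : predual) : val (eval_dual x : dual predual) u = val u x :> C.
Proof. by []. Qed.

Lemma eval_dual_linear : linear eval_dual.
Proof.
move=> a x y; apply: val_inj; apply/funext => u.
exact: (dual_linear (u : dual E)).
Qed.

Lemma absconvexI (T : lmodType C) (I : Type) (D : set I) (U : I -> set T) :
  (forall i, D i -> absconvex (U i)) -> absconvex [set x | forall i, D i -> U i x].
Proof.
move=> acU; split.
  move=> x y t /set_mem xU /set_mem yU; apply/mem_set => i Di.
  by apply: set_mem; apply: (acU i Di).1; apply/mem_set; [exact: xU|exact: yU].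
by move=> a x a1 xU i Di; apply: (acU i Di).2 => //; exact: xU.
Qed.

(** A bounded set of functionals is uniformly bounded on each [B n], so its polar in E is absolutely
    convex and absorbs each [B n]. *)
Lemma eval_dual_continuous : continuous eval_dual.
Proof.
move=> x A [_ [A0 [_ [A0b /posC[e e0 ->] ->]]] WA].
have nU : nbhs (0 : E) [set y | forall u : predual, A0 u -> normc (val u y) <= e].
  apply: B_finest.
    by apply: absconvexI => u _; apply: absconvex_preim; exact: dual_linear.
  move=> n.
  have [|r /posC[s s0 ->] A0r] := A0b [set u : predual | polar_norm n u < 1].
    by apply/P_nbhs; exists n, 1; split => // v; rewrite subr0.
  exists (e / s); first exact: divr_gt0.
  move=> y By u /A0r[v /= v1 <-]; rewrite dualZE dualZ !normcM.
  rewrite !normc_real ?divr_ge0 ?(ltW e0) ?(ltW s0)// mulrA [s * _]mulrC.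
  rewrite mulfVK ?gt_eqF// ler_piMr ?(ltW e0)//.
  by rewrite (le_trans (polar_norm_ge v By))// ltW.
have := nbhsB x nU; rewrite addr0; apply: filterS => _ [y yU <-] /=.
have := eval_dual_linear 1 x y; rewrite !scale1r => ->.
by apply: WA => u /yU; rewrite norm_le_normc.
Qed.

Lemma linear_bounded_on_nbhs (f : E -> C^o) (U : set E) : linear f -> nbhs 0 U ->
  (forall x, U x -> normc (f x) <= 1) -> f \in @dual_pred R E.
Proof.
move=> lf nU fU; apply: linear_bounded_dual => // n.
have f0 : f 0 = 0 by have := lf (- 1) 0 0; rewrite scaler0 addr0 scaleN1r addNr.
have fZ a x : f (a *: x) = a * f x :> C by have := lf a x 0; rewrite !addr0 f0 addr0.
have [r r0 Br] := B_bounded n nU.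
exists r^-1 => x /Br/fU; rewrite fZ normcM normc_real ?(ltW r0)// mulrC.
by rewrite -ler_pdivlMr// mul1r.
Qed.

Lemma nbhs_absorbing (U : set E) : nbhs 0 U -> absorbing U.
Proof.
move=> nU x; have [n [r r0 Bx]] := B_cover x; have [s s0 Bs] := B_bounded n nU.
exists (s * r)%:C%C; first by rewrite ltcR mulr_gt0.
by rewrite -scaleRA; exact: Bs.
Qed.

(* The bipolar theorem: twice an absolutely convex neighbourhood of 0 contains
   the polar of its polar. *)
Lemma eval_dual_open (U : set E) : nbhs 0 U -> exists2 W : set (strong_dual predual),
  nbhs 0 W & forall x, W (eval_dual x) -> U x.
Proof.
move=> /nbhs0_absconvex[V [nV acV VU]].
pose A : set predual := [set u | forall x, V x -> normc (val u x) <= 1].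
(* The polar [A] is bounded in the predual because [V] absorbs each [B n]. The bound is 1/2 because
   separation with ratio 2 at the point 2x only yields |f x| > 1/2. *)
pose W : set (dual predual) := [set f | forall u, A u -> `|val f u| <= (2^-1)%:C%C].
exists W.
  exists W; last by move=> w; rewrite add0r.
  exists A, (2^-1)%:C%C; split => //; last by rewrite ltcR.
  move=> N /P_nbhs[n [e [e0 qN]]]; have [r r0 Br] := B_bounded n nV.
  pose c : R := 2 / (e * r); have c0 : 0 < c by rewrite divr_gt0 ?mulr_gt0.
  exists c%:C%C; first by rewrite ltcR.
  move=> u Au; exists (c^-1%:C%C *: u); last first.
    by rewrite scaleRA mulfV ?gt_eqF// scale1r.
  apply: qN; rewrite subr0 (seminormZ polar_seminorms) normc_real ?invr_ge0 ?(ltW c0)//.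
  rewrite mulrC ltr_pdivrMr// (@le_lt_trans _ _ r^-1)//.
    apply: polar_norm_le => x /Br/Au; rewrite dualZ normcM normc_real ?(ltW r0)//.
    by rewrite mulrC -ler_pdivlMr// mul1r.
  have -> : e * c = 2 * r^-1 by rewrite /c; field; rewrite !gt_eqF.
  by rewrite ltr_pMl ?invr_gt0// ltr1n.
move=> x Wx; apply: VU; apply: contrapT => nVx.
have [|f [lf fV f1]] := @hahn_banach_separation R E V acV (nbhs_absorbing nV) 2
    ((2 : R)%:C%C *: x) (ltr1n _ 2).
  by rewrite scaleRA mulVf// scale1r.
have df : f \in @dual_pred R E := linear_bounded_on_nbhs lf nV fV.
have := Wx (Sub f df : dual E) fV.
rewrite norm_le_normc eval_dualE SubK => fx; move: f1.
have f0 : f 0 = 0 by have := lf (- 1) 0 0; rewrite scaler0 addr0 scaleN1r addNr.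
have -> : f ((2 : R)%:C%C *: x) = (2 : R)%:C%C * f x :> C.
  by have := lf (2 : R)%:C%C x 0; rewrite !addr0 f0 addr0.
by rewrite normcM normc_real// ltNge; lra.
Qed.

Lemma eval_dual_inj x : eval_dual x = 0 -> x = 0.
Proof.
move=> x0; apply: contrapT => /eqP /E_hausdorff[U nU]; apply.
have [W nW WU] := eval_dual_open nU; apply: WU; rewrite x0.
exact: nbhs_singleton nW.
Qed.

(* The separation theorem is applied in C^k, to the image of a multiple of [B n]
   under the [k] functionals. *)
Lemma eval_dual_approx (f : dual predual) : exists n (c : R), 0 < c /\
  forall k (u : 'I_k -> dual E) (e : R), 0 < e ->
  exists2 x, B n x & forall i, normc (val (u i) x - c%:C%C * val f (u i)) <= e.
Proof.
have lf : linear (val f) by have := valP f; rewrite inE => -[].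
have f0 : val f 0 = 0 by have := lf (- 1) 0 0; rewrite scaler0 addr0 scaleN1r addNr.
have fZ a x : val f (a *: x) = a * val f x :> C by have := lf a x 0; rewrite !addr0 f0 addr0.
have fD x y : val f (x + y) = val f x + val f y :> C by have := lf 1 x y; rewrite !scale1r.
have : nbhs (0 : predual) [set u | normc (val f u) <= 1].
  have cf : continuous (val f) by have := valP f; rewrite inE => -[].
  apply: (cf 0 [set z | normc z <= 1]).
  by rewrite f0; apply/nbhs_normc; exists 1 => // w; rewrite subr0 => /ltW.
move=> /P_nbhs[n [r [r0 qf]]].
have {}qf (u : dual E) : (forall x, B n x -> normc (val u x) <= r / 2) ->
    normc (val f u) <= 1.
  move=> ur; apply: qf; rewrite subr0 (@le_lt_trans _ _ (r / 2))//.
    exact: polar_norm_le.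
  by rewrite ltr_pdivrMr// ltr_pMr// ltr1n.
have r4 : 0 < r / 4 by rewrite divr_gt0.
(* One factor 1/2 comes from replacing [polar_norm n u < r] by a large inequality, the other from
   separation with ratio 2. *)
exists n, (r / 4); split => // k u e e0.
(* The tolerance [e] makes [U] absorbing even when the functionals [u i] are linearly dependent:
   small vectors are approximated by [x = 0]. *)
pose U : set 'rV[C]_k := [set w | exists2 x, B n x &
  forall i, normc (val (u i) x - (r / 2)%:C%C * w 0 i) <= e].
have acU : absconvex U.
  split.
    move=> w z t /set_mem[x Bx wx] /set_mem[y By zy]; apply/mem_set.
    exists (t%:num *: x + (1 - t%:num) *: y).
      by apply/set_mem; apply: (B_absconvex n).1; exact/mem_set.
    have [s [v [s0 v0 sv ts tv]]] := i01C t.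
    move=> i.
    change (normc (val (u i) (t%:num *: x + (1 - t%:num) *: y)
      - (r / 2)%:C%C * (t%:num *: w + (1 - t%:num) *: z) 0 i) <= e).
    rewrite tv ts dualD !dualZ !mxE.
    have -> : s%:C%C * val (u i) x + v%:C%C * val (u i) y -
       (r / 2)%:C%C * (s%:C%C * w 0 i + v%:C%C * z 0 i) =
       s%:C%C * (val (u i) x - (r / 2)%:C%C * w 0 i) +
       v%:C%C * (val (u i) y - (r / 2)%:C%C * z 0 i) by ring.
    rewrite (le_trans (normcD _ _))// !normcM !(normc_real s0) !(normc_real v0).
    rewrite [leRHS](_ : e = s * e + v * e); last by rewrite -mulrDl sv mul1r.
    by rewrite lerD// ler_wpM2l ?wx ?zy.
  move=> a w a1 [x Bx wx]; exists (a *: x); first exact: (B_absconvex n).2.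
  move=> i; rewrite dualZ !mxE mulrCA -mulrBr normcM.
  by rewrite (le_trans _ (wx i))// ler_piMl ?normc_ge0// normc_le1.
have abU : absorbing U.
  move=> w; pose M := \sum_i normc (w 0 i).
  have M1 : 0 < (r / 2) * (M + 1).
    by rewrite mulr_gt0 ?divr_gt0// ltr_wpDl// sumr_ge0// => i _; exact: normc_ge0.
  exists (e / ((r / 2) * (M + 1)))%:C%C; first by rewrite ltcR divr_gt0.
  exists 0; first exact: B_0.
  move=> i; rewrite dual0 sub0r normcN !mxE !normcM.
  rewrite !normc_real ?divr_ge0 ?(ltW r0) ?(ltW M1) ?(ltW e0)//.
  have M0 : 0 < M + 1 by move: M1; rewrite pmulr_rgt0 ?divr_gt0.
  have -> : r / 2 * (e / (r / 2 * (M + 1)) * normc (w 0 i)) = e * (normc (w 0 i) / (M + 1)).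
    by field; rewrite !gt_eqF.
  rewrite -[leRHS]mulr1 ler_pM2l// ler_pdivrMr// mul1r /M (bigD1 i)//= -addrA lerDl.
  by rewrite addr_ge0// sumr_ge0// => j _; exact: normc_ge0.
pose y : 'rV[C]_k := \row_i val f (u i).
have : U ((2 : R)^-1%:C%C *: y).
  apply: contrapT => nUy.
  have [l [ll lU l1]] := hahn_banach_separation acU abU (ltr1n R 2) nUy.
  have l0 : l 0 = 0 by have := ll (- 1) 0 0; rewrite scaler0 addr0 scaleN1r addNr.
  have lZ a w : l (a *: w) = a * l w :> C by have := ll a w 0; rewrite !addr0 l0 addr0.
  have lD w z : l (w + z) = l w + l z :> C by have := ll 1 w z; rewrite !scale1r.
  have lE w : l w = \sum_i w 0 i * l 'e_i :> C.
    rewrite [in LHS](row_sum_delta w) (big_morph l lD l0).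
    by apply: eq_bigr => i _; exact: lZ.
  pose v : dual E := \sum_i (l 'e_i : C) *: u i.
  have vE x : val v x = \sum_i l 'e_i * val (u i) x :> C.
    rewrite /v (big_morph (fun w : dual E => val w x : C) (fun a b => dualDE a b x) erefl).
    by apply: eq_bigr => i _.
  have : normc (val f v) <= 1.
    apply: qf => x Bx; rewrite vE.
    have /lU : U (\row_i ((r / 2)^-1%:C%C * val (u i) x)).
      exists x => // i; rewrite mxE mulrA -rmorphM mulfV ?gt_eqF ?divr_gt0//.
      by rewrite mul1r subrr normc_real ?(ltW e0).
    have -> : l (\row_i ((r / 2)^-1%:C%C * val (u i) x)) =
        (r / 2)^-1%:C%C * \sum_i l 'e_i * val (u i) x :> C.
      rewrite lE mulr_sumr; apply: eq_bigr => i _.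
      by rewrite mxE mulrAC -!mulrA.
    rewrite normcM normc_real ?invr_ge0 ?divr_ge0 ?(ltW r0)//.
    by rewrite mulrC ler_pdivrMr ?divr_gt0// mul1r.
  apply/negP; rewrite -ltNge.
  suff -> : val f v = l y by [].
  rewrite /v (big_morph (val f : dual E -> C) fD f0) lE.
  by apply: eq_bigr => i _; rewrite fZ mxE mulrC.
move=> [x Bx xy]; exists x => // i; have := xy i.
rewrite !mxE mulrA -rmorphM; congr (normc (_ - _%:C%C * _) <= _).
by field.
Qed.

(** The sets of approximate solutions in [B n] of finitely many equations [u x = c f u] generate a
    proper filter. An ultrafilter finer than it contains [B n], hence converges, and its limit
    solves all these equations exactly. *)
Lemma eval_dual_surj (f : dual predual) : exists x, eval_dual x = f.
Proof.
have [n [c [c0 fx]]] := eval_dual_approx f.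
pose D k (u : 'I_k -> dual E) (e : R) : set E :=
  [set x | B n x /\ forall i, normc (val (u i) x - c%:C%C * val f (u i)) <= e].
pose F : set_system E := [set A | exists k (u : 'I_k -> dual E) (e : R), 0 < e /\ D k u e `<=` A].
have FF : ProperFilter F.
  apply: Build_ProperFilter_ex.
    move=> A [k [u [e [e0 DA]]]]; have [x Bx xu] := fx k u e e0.
    by exists x; apply: DA.
  split.
  - by exists 0%N, (fun=> 0), 1.
  - move=> P Q [k [u [e [e0 uP]]]] [l [v [d [d0 vQ]]]].
    exists (k + l)%N, (fun i => match fintype.split i with inl a => u a | inr b => v b end),
      (Num.min e d); split; first by rewrite lt_min e0.
    move=> x [Bx xe]; split.
      apply: uP; split => // i; have := xe (lshift l i).
      by rewrite (unsplitK (inl i)) le_min => /andP[].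
    apply: vQ; split => // i; have := xe (rshift k i).
    by rewrite (unsplitK (inr i)) le_min => /andP[].
  - move=> P Q PQ [k [u [e [e0 uP]]]]; exists k, u, e; split => //.
    exact: subset_trans uP PQ.
have [G [GU FG]] := ultraFilterLemma FF.
have GB : G (B n) by apply: FG; exists 0%N, (fun=> 0), 1; split => // x [].
have [x Gx] := B_compact GU GB.
exists (c^-1%:C%C *: x); apply: val_inj; apply/funext => u.
rewrite [LHS]dualZ; suff -> : val u x = c%:C%C * val f u :> C.
  by rewrite mulrA -rmorphM mulVf ?gt_eqF// mul1r.
apply/eqP; rewrite -subr_eq0; apply/eqP; apply: normc_small => e e0.
have e2 : 0 < e / 2 by rewrite divr_gt0.
have G1 : G [set y | normc (val u y - c%:C%C * val f u) <= e / 2].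
  apply: FG; exists 1%N, (fun=> u), (e / 2); split => // y [_ /(_ ord0)].
  exact.
have G2 : G [set y | normc (val u y - val u x) < e / 2].
  apply: Gx; apply: (@dual_continuous u x [set z | normc (z - val u x) < e / 2]).
  by apply/nbhs_normc; exists (e / 2).
have GF : ProperFilter G by exact: ultra_proper.
have [y [/= y1 y2]] := filter_ex (filterI G1 G2).
have -> : val u x - c%:C%C * val f u =
  (val u y - c%:C%C * val f u) - (val u y - val u x) by ring.
by rewrite (le_trans (normcD _ _))// normcN [leRHS]splitr lerD// ltW.
Qed.

Theorem dfs_of_compact_steps : dfs_space E.
Proof.
pose J : {linear E -> strong_dual predual} :=
  HB.pack eval_dual (GRing.isLinear.Build _ _ _ _ eval_dual eval_dual_linear).
have /choice[v vP] := eval_dual_surj.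
exists predual, J, v; split.
- exact: predual_frechet_schwartz.
- move=> x; have : eval_dual (v (eval_dual x) - x) = 0.
    by rewrite [LHS](linearB J) /= vP subrr.
  by move=> /eval_dual_inj/eqP; rewrite subr_eq0 => /eqP.
- exact: vP.
- exact: eval_dual_continuous.
move=> f A nA.
have nA0 : nbhs (0 : E) [set y | A (v f + y)].
  have := nbhsB (- v f) nA; rewrite addNr; apply: filterS => _ [y Ay <-] /=.
  by rewrite addrA subrr add0r.
have [W nW WA] := eval_dual_open nA0.
have := nbhsB f nW; rewrite addr0; apply: filterS => _ [w Ww <-] /=.
have -> : v (f + w) = v f + v w.
  apply/eqP; rewrite -subr_eq0; apply/eqP/eval_dual_inj.
  by rewrite [LHS](linearB J) linearD /= !vP subrr.
by apply: WA; rewrite vP.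
Qed.

End compact_steps.

(** * Power series *)

Section power_series.
Variable R : realType.
Local Notation C := R[i].
Implicit Types (a b : nat -> C) (z w l : C) (q M r s : R).

Lemma geometric_small q M e : 0 <= q < 1 -> 0 < e ->
  exists N, forall n, (N <= n)%N -> M * q ^+ n < e.
Proof.
move=> /andP[q0 q1] e0; have M1 : 0 < `|M| + 1 by rewrite ltr_wpDl.
have /cvgrPdist_lt/(_ (e / (`|M| + 1))) : (GRing.exp q : nat -> R) @ \oo --> 0.
  by apply: cvg_expr; rewrite ger0_norm.
rewrite divr_gt0// => /(_ isT)[N _ Nq]; exists N => n /Nq/=.
rewrite sub0r normrN ger0_norm ?exprn_ge0// ltr_pdivlMr// mulrC.
apply: le_lt_trans; rewrite ler_wpM2r ?exprn_ge0//.
by rewrite (le_trans (ler_norm _))// lerDl.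
Qed.

Lemma geometric_sum_le q n : 0 <= q < 1 -> \sum_(k < n) q ^+ k <= (1 - q)^-1.
Proof.
move=> /andP[q0 q1]; have q1' : 0 < 1 - q by rewrite subr_gt0.
rewrite -[leRHS]mul1r ler_pdivlMr// mulrC.
by rewrite -[leLHS]opprK -mulNr opprB -subrX1 opprB gerBl exprn_ge0.
Qed.

Lemma geometric_tail (t : nat -> C) q M m n : 0 <= q < 1 ->
  (forall k, normc (t k) <= M * q ^+ k) -> (m <= n)%N ->
  normc (\sum_(k < n) t k - \sum_(k < m) t k) <= M / (1 - q) * q ^+ m.
Proof.
move=> q01 tM mn; have M0 : 0 <= M.
  by have := tM 0%N; rewrite expr0 mulr1; apply: le_trans; exact: normc_ge0.
rewrite -(subnKC mn) big_split_ord/= addrAC subrr add0r.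
rewrite (le_trans (normc_sum _ _ _))//.
apply: (@le_trans _ _ (\sum_(k < n - m) M * q ^+ m * q ^+ k)).
  by apply: ler_sum => k _; rewrite (le_trans (tM _))// exprD mulrA.
rewrite -mulr_sumr [leRHS]mulrAC ler_wpM2l//; last exact: geometric_sum_le.
by rewrite mulr_ge0// exprn_ge0//; case/andP: q01.
Qed.

Lemma geometric_series (t : nat -> C) q M : 0 <= q < 1 ->
  (forall k, normc (t k) <= M * q ^+ k) ->
  exists l, forall n, normc (\sum_(k < n) t k - l) <= M / (1 - q) * q ^+ n.
Proof.
move=> q01 tM.
have [|l lP] := @normc_complete R (fun n => \sum_(k < n) t k).
  move=> e e0; have [N NP] := geometric_small (M / (1 - q)) q01 e0.
  exists N => j k Nj Nk; have [jk|/ltnW jk] := leqP j k.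
    by rewrite normcB (le_lt_trans (geometric_tail q01 tM jk))// NP.
  by rewrite (le_lt_trans (geometric_tail q01 tM jk))// NP.
exists l => n; apply/ler_addgt0Pr => e e0; have [K Kl] := lP e e0.
have := Kl (maxn K n) (leq_maxl _ _).
have := geometric_tail q01 tM (leq_maxr K n).
move: (\sum_(k < maxn K n) t k) => x nx xl.
have -> : \sum_(k < n) t k - l = (\sum_(k < n) t k - x) + (x - l).
  by rewrite addrA subrK.
rewrite (le_trans (normcD _ _))// lerD//; first by rewrite normcB.
exact: ltW.
Qed.

Definition pseries_cvg a z l := forall e : R, 0 < e -> exists N, forall n, (N <= n)%N ->
  normc (\sum_(k < n) a k * z ^+ k - l) < e.

Lemma pseries_cvg_unique a z l l' : pseries_cvg a z l -> pseries_cvg a z l' -> l = l'.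
Proof.
move=> al al'; apply/eqP; rewrite -subr_eq0; apply/eqP; apply: normc_small => e e0.
have e2 : 0 < e / 2 by rewrite divr_gt0.
have [N NP] := al _ e2; have [N' NP'] := al' _ e2.
have := NP (maxn N N') (leq_maxl _ _); have := NP' (maxn N N') (leq_maxr _ _).
move: (\sum_(k < _) _) => x h1 h2.
have -> : l - l' = (x - l') - (x - l) by ring.
by rewrite (le_trans (normcD _ _))// normcN [leRHS]splitr lerD// ltW.
Qed.

Lemma pseries_cvg_series a z l :
  (series (fun n => a n * z ^+ n) : nat -> C^o) @ \oo --> (l : C^o) <-> pseries_cvg a z l.
Proof.
split=> [/cvgrPdist_lt al e e0|al].
  have := al e%:C%C; rewrite ltcR => /(_ e0)[N _ NP]; exists N => n /NP/=.
  by rewrite distrC -normcE ltcR /series/= big_mkord.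
apply/cvgrPdist_lt => _ /posC[e e0 ->]; have [N NP] := al e e0.
by exists N => // n /NP; rewrite distrC -normcE ltcR /series/= big_mkord.
Qed.

Lemma pseries_cvg_bounded a z l : pseries_cvg a z l ->
  exists M, forall n, normc (a n) * normc z ^+ n <= M.
Proof.
move=> al; have [N NP] := al 1 ltr01.
exists (2 + \sum_(k < N) normc (a k) * normc z ^+ k) => n.
have s0 k : 0 <= normc (a k) * normc z ^+ k.
  by rewrite mulr_ge0 ?exprn_ge0 ?normc_ge0.
have [nN|Nn] := ltnP n N.
  rewrite (bigD1 (Ordinal nN))//= addrCA lerDl addr_ge0//.
  by rewrite sumr_ge0.
have := NP n.+1 (leqW Nn); rewrite big_ord_recr/= => h1; have h0 := NP n Nn.
rewrite -normcX -normcM.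
move: h0 h1; move: (\sum_(k < n) _) (a n * z ^+ n) => x y h0 h1.
rewrite (@le_trans _ _ 2)//; last by rewrite lerDl sumr_ge0.
have -> : y = (x + y - l) - (x - l) by ring.
by rewrite (le_trans (normcD _ _))// normcN; lra.
Qed.

Lemma normc_term a n z r q M : (forall k, normc (a k) * r ^+ k <= M) ->
  0 <= q -> normc z <= q * r -> normc (a n * z ^+ n) <= M * q ^+ n.
Proof.
move=> aM q0 zq; rewrite normcM normcX.
apply: (@le_trans _ _ (normc (a n) * (q * r) ^+ n)).
  by rewrite ler_wpM2l ?normc_ge0// lerXn2r// nnegrE ?normc_ge0// (le_trans _ zq)// normc_ge0.
by rewrite exprMn mulrCA mulrC ler_wpM2r// exprn_ge0.
Qed.

Lemma pseries_cvg_geometric a r q M z : (forall k, normc (a k) * r ^+ k <= M) ->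
  0 <= q < 1 -> normc z <= q * r ->
  exists l, forall n, normc (\sum_(k < n) a k * z ^+ k - l) <= M / (1 - q) * q ^+ n.
Proof.
move=> aM q01 zq; apply: (@geometric_series (fun k => a k * z ^+ k) q M q01) => k.
by apply: (@normc_term a k z r q M) => //; case/andP: q01.
Qed.

Lemma geometric_psums a q M z l : 0 <= q < 1 ->
  (forall n, normc (\sum_(k < n) a k * z ^+ k - l) <= M * q ^+ n) -> pseries_cvg a z l.
Proof.
move=> q01 al e e0; have [N NP] := geometric_small M q01 e0.
by exists N => n Nn; rewrite (le_lt_trans (al n))// NP.
Qed.

Lemma pseries_cvg_geometric_error a r q M z l : (forall k, normc (a k) * r ^+ k <= M) ->
  0 <= q < 1 -> normc z <= q * r -> pseries_cvg a z l ->
  forall n, normc (\sum_(k < n) a k * z ^+ k - l) <= M / (1 - q) * q ^+ n.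
Proof.
move=> aM q01 zq al; have [l' l'P] := pseries_cvg_geometric aM q01 zq.
by rewrite (pseries_cvg_unique al (geometric_psums q01 l'P)).
Qed.

Lemma pseries_cvg_ex a r M z : (forall k, normc (a k) * r ^+ k <= M) ->
  normc z < r -> exists l, pseries_cvg a z l.
Proof.
move=> aM zr; have r0 : 0 < r by rewrite (le_lt_trans (normc_ge0 z)).
have q01 : 0 <= normc z / r < 1.
  by rewrite divr_ge0 ?normc_ge0 ?(ltW r0)//= ltr_pdivrMr// mul1r.
have [|l lP] := pseries_cvg_geometric aM q01 (z := z); first by rewrite mulfVK ?gt_eqF.
by exists l; exact: geometric_psums lP.
Qed.

(** Up to the factor |a k|, the left-hand side is a single term of the binomial expansion of (|w| +
    s)^k. *)
Lemma binomial_coef_bound a r q M w s n k : (forall k, normc (a k) * r ^+ k <= M) ->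
  0 <= s -> 0 <= q -> normc w + s <= q * r ->
  normc (a k * 'C(k, n)%:R * w ^+ (k - n)) * s ^+ n <= M * q ^+ k.
Proof.
move=> aM s0 q0 wsq; rewrite !normcM normcX.
have -> : normc ('C(k, n)%:R : C) = 'C(k, n)%:R.
  by rewrite -(rmorph_nat (@real_complex R)) normc_real.
apply: (@le_trans _ _ (normc (a k) * (normc w + s) ^+ k)).
  rewrite -!mulrA ler_wpM2l ?normc_ge0//.
  have [kn|nk] := ltnP k n.
    by rewrite bin_small// mul0r exprn_ge0// addr_ge0// normc_ge0.
  rewrite exprDn (bigD1 (Ordinal (nk : (n < k.+1)%N)))//= -[X in X <= _]addr0.
  rewrite -[X in _ <= X + _]mulr_natl; apply: lerD => //; apply: sumr_ge0 => i _.
  by rewrite mulrn_wge0// mulr_ge0 ?exprn_ge0 ?normc_ge0.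
apply: (@le_trans _ _ (normc (a k) * (q * r) ^+ k)).
  rewrite ler_wpM2l ?normc_ge0// lerXn2r// nnegrE.
    by rewrite addr_ge0 ?normc_ge0.
  by rewrite (le_trans _ wsq)// addr_ge0 ?normc_ge0.
by rewrite exprMn mulrCA mulrC ler_wpM2r// exprn_ge0.
Qed.

(** The new coefficients are b_n = sum_k a_k C(k,n) w^(k-n). No double series is rearranged: for the
    partial sums k < N the binomial identity is finite and exact, and truncating b_n at N costs at
    most a constant times q^N / s^n, which is summable against |z - w|^n. *)
Lemma pseries_cvg_recenter a r q M w s : (forall k, normc (a k) * r ^+ k <= M) ->
  0 < s -> 0 <= q < 1 -> normc w + s <= q * r ->
  exists b, [/\ forall n, normc (b n) * s ^+ n <= M / (1 - q),
    forall n, pseries_cvg (fun j => a (j + n)%N * 'C(j + n, n)%:R) w (b n) &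
    forall z l, normc (z - w) < s -> pseries_cvg a z l -> pseries_cvg b (z - w) l].
Proof.
move=> aM s0 q01 wsq; have q0 : 0 <= q by case/andP: q01.
have sX n : 0 < s ^+ n by rewrite exprn_gt0.
have /choice[b bP] n : exists b : C, forall K,
    normc (\sum_(k < K) a k * 'C(k, n)%:R * w ^+ (k - n) - b) * s ^+ n <=
    M / (1 - q) * q ^+ K.
  have [k|l lP] := @geometric_series
      (fun k => a k * 'C(k, n)%:R * w ^+ (k - n)) q (M / s ^+ n) q01.
    rewrite [leRHS]mulrAC ler_pdivlMr//; exact: binomial_coef_bound aM (ltW s0) q0 wsq.
  exists l => K; rewrite -ler_pdivlMr// (le_trans (lP K))//.
  by rewrite le_eqVlt; apply/orP; left; apply/eqP; rewrite -!mulrA; congr (_ * _); ring.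
exists b; split.
- by move=> n; have := bP n 0%N; rewrite big_ord0 sub0r normcN expr0 mulr1.
- move=> n; apply: (@geometric_psums _ q (M / (1 - q) * q ^+ n / s ^+ n)) => // J.
  rewrite [leRHS]mulrAC ler_pdivlMr// -[leRHS]mulrA -exprD addnC.
  have := bP n (J + n)%N; rewrite addnC big_split_ord/= big1 ?add0r => [|i _]; last first.
    by rewrite bin_small// mulr0 mul0r.
  rewrite addnC.
  by under eq_bigr do rewrite addKn addnC.
move=> z l zs al; set t := normc (z - w) / s.
have t01 : 0 <= t < 1.
  by rewrite divr_ge0 ?normc_ge0 ?(ltW s0)//= ltr_pdivrMr// mul1r.
(* The first term pays for truncating the coefficients [b n], the second for truncating the original
   series at [z]. *)
apply: (@geometric_psums _ q (M / (1 - q) * (1 - t)^-1 + M / (1 - q))) => // N.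
have zr : normc z <= q * r.
  rewrite -[z](subrK w) addrC (le_trans (normcD _ _))//.
  by rewrite (le_trans _ wsq)// lerD2l ltW.
have M0 : 0 <= M / (1 - q).
  rewrite divr_ge0 ?subr_ge0 ?(ltW (andP q01).2)//.
  by apply: le_trans (aM 0%N); rewrite expr0 mulr1 normc_ge0.
have -> : \sum_(n < N) b n * (z - w) ^+ n - l =
    - (\sum_(n < N) (\sum_(k < N) a k * 'C(k, n)%:R * w ^+ (k - n) - b n) * (z - w) ^+ n)
    + (\sum_(k < N) a k * z ^+ k - l).
  have -> : \sum_(k < N) a k * z ^+ k =
      \sum_(n < N) (\sum_(k < N) a k * 'C(k, n)%:R * w ^+ (k - n)) * (z - w) ^+ n.
    under [RHS]eq_bigr do rewrite mulr_suml.
    rewrite exchange_big/=; apply: eq_bigr => k _.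
    rewrite -[in LHS](subrK w z) addrC exprDn mulr_sumr.
    rewrite [RHS](bigID (fun i : 'I_N => (i < k.+1)%N))/= [X in _ = _ + X]big1 ?addr0; last first.
      by move=> i; rewrite -leqNgt => /bin_small ->; rewrite mulr0 !mul0r.
    rewrite (big_ord_narrow (ltn_ord k)); apply: eq_bigr => i _ /=.
    by rewrite -mulr_natl; ring.
  rewrite addrA -sumrN -big_split/=; congr (_ - _).
  by apply: eq_bigr => n _; ring.
rewrite (le_trans (normcD _ _))// normcN mulrDl lerD//; last first.
  exact: pseries_cvg_geometric_error aM q01 zr al N.
rewrite (le_trans (normc_sum _ _ _))//.
apply: (@le_trans _ _ (\sum_(n < N) M / (1 - q) * q ^+ N * t ^+ n)).
  apply: ler_sum => n _; rewrite normcM normcX.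
  have -> : normc (z - w) = s * t by rewrite /t mulrC mulfVK ?gt_eqF.
  by rewrite exprMn mulrA ler_wpM2r ?bP// exprn_ge0//; case/andP: t01.
rewrite -mulr_sumr mulrAC ler_wpM2r ?exprn_ge0//.
by rewrite ler_wpM2l// geometric_sum_le.
Qed.

End power_series.

(** * Roots of unity and Cauchy estimates *)

(** X^n - 1 splits and is separable, so it has n distinct roots; a group of n distinct n-th roots of
    unity contains a primitive one. *)
Lemma closed_prim_root (F : numClosedFieldType) (n : nat) :
  (0 < n)%N -> exists w : F, n.-primitive_root w.
Proof.
move=> n0; pose p : {poly F} := 'X^n - 1; have [rs prs] := closed_field_poly_normal p.
rewrite (monicP _) ?monicXnsubC// scale1r in prs.
have rs1 : all n.-unity_root rs.
  by apply/allP => z; rewrite -root_prod_XsubC -prs.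
have urs : uniq rs.
  rewrite -separable.separable_prod_XsubC -prs cyclotomic.separable_Xn_sub_1//.
  by rewrite pnatr_eq0 -lt0n.
have nrs : (n <= size rs)%N.
  by rewrite -ltnS -(size_prod_XsubC rs id) -prs size_XnsubC.
by have /hasP[w _ wn] := cyclic.has_prim_root n0 rs1 urs nrs; exists w.
Qed.

Section coefficient_mean.
Variable R : realType.
Local Notation C := R[i].
Implicit Types (a b : nat -> C) (z w l : C) (q M r s : R).

Lemma complex_prim_root n : (0 < n)%N -> exists w : C, n.-primitive_root w.
Proof. exact: closed_prim_root. Qed.

Lemma normc_prim_root n w : n.-primitive_root w -> normc w = 1.
Proof.
move=> wn; have n0 := prim_order_gt0 wn.
apply: (@pexpIrn _ n n0); rewrite ?nnegrE ?normc_ge0//.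
by rewrite -normcX (prim_expr_order wn) expr1n normc_real.
Qed.

Lemma sum_prim_root n w m : n.-primitive_root w -> ~~ (n %| m)%N ->
  \sum_(k < n) w ^+ (k * m) = 0.
Proof.
move=> wn nm; have wm : w ^+ m - 1 != 0.
  by rewrite subr_eq0 -(prim_order_dvd wn).
apply: (mulfI wm); rewrite mulr0.
under eq_bigr do rewrite mulnC exprM.
by rewrite -subrX1 -exprM mulnC exprM (prim_expr_order wn) expr1n subrr.
Qed.

(* Cauchy's formula with the circle replaced by the [N]-th roots of unity; it is
   exact because the polynomial has degree less than [N]. *)
Lemma coef_mean a N w z n : N.-primitive_root w -> (n < N)%N ->
  \sum_(k < N) w ^+ (k * (N - n)) * \sum_(j < N) a j * (w ^+ k * z) ^+ j =
  N%:R * (a n * z ^+ n).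
Proof.
move=> wN nN; under eq_bigr do rewrite mulr_sumr.
rewrite exchange_big/= (bigD1 (Ordinal nN))//= [X in _ + X]big1 ?addr0 => [|j jn].
  rewrite mulr_natl -[in RHS](card_ord N) -sumr_const; apply: eq_bigr => k _.
  have -> : w ^+ (k * (N - n)) * (a n * (w ^+ k * z) ^+ n) =
    w ^+ (k * (N - n) + k * n) * (a n * z ^+ n) by rewrite exprMn exprD -exprM; ring.
  rewrite -mulnDr subnK; last exact: ltnW.
  by rewrite mulnC exprM (prim_expr_order wN) expr1n mul1r.
rewrite (eq_bigr (fun k : 'I_N => a j * z ^+ j * w ^+ (k * (N - n + j)))) => [|k _].
  rewrite -mulr_sumr (sum_prim_root wN) ?mulr0//.
  apply/negP => Nd; move: jn; rewrite -val_eqE/= => /eqP; apply.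
  (* [N - n + j] lies strictly between 0 and 2N, so it can only be the multiple N itself, which
     means j = n. *)
  have [q qN] := dvdnP Nd.
  have jN := ltn_ord j.
  have q1 : q = 1%N.
    case: q qN => [|[|q]] // qN; first by move: nN jN qN; lia.
    by move: nN jN qN; rewrite !mulSn; lia.
  by move: nN jN qN; rewrite q1 mul1n; lia.
by rewrite exprMn mulnDr exprD -exprM; ring.
Qed.

Lemma coef_mean_le a N w z n : N.-primitive_root w -> (n < N)%N ->
  normc (a n * z ^+ n) <=
  N%:R^-1 * \sum_(k < N) normc (\sum_(j < N) a j * (w ^+ k * z) ^+ j).
Proof.
move=> wN nN; have N0 : 0 < N%:R :> R by rewrite ltr0n (leq_ltn_trans _ nN).
rewrite [leRHS]mulrC ler_pdivlMr// [leLHS]mulrC.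
have <- : normc (N%:R * (a n * z ^+ n)) = N%:R * normc (a n * z ^+ n).
  by rewrite normcM -(rmorph_nat (@real_complex R)) normc_real ?ltW.
rewrite -(coef_mean a z wN nN) (le_trans (normc_sum _ _ _))//.
apply: ler_sum => k _.
by rewrite normcM normcX (normc_prim_root wN) expr1n mul1r.
Qed.

(** Replacing the partial sums of length [N] in the exact mean by the full sums [g] costs the
    geometric tail, which vanishes as [N] grows with [n] fixed. *)
Lemma coef_mean_error a r q M N w z n (g : C -> C) :
  (forall k, normc (a k) * r ^+ k <= M) -> 0 <= q < 1 -> normc z <= q * r ->
  (forall k : 'I_N, pseries_cvg a (w ^+ k * z) (g (w ^+ k * z))) ->
  N.-primitive_root w -> (n < N)%N ->
  normc (a n) * normc z ^+ n <=
  N%:R^-1 * \sum_(k < N) normc (g (w ^+ k * z)) + M / (1 - q) * q ^+ N.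
Proof.
move=> aM q01 zq ag wN nN; rewrite -normcX -normcM.
have N0 : 0 < N%:R :> R by rewrite ltr0n (leq_ltn_trans _ nN).
apply: le_trans (coef_mean_le a z wN nN) _.
rewrite -lerBlDl -mulrBr [leLHS]mulrC ler_pdivrMr// -sumrB.
rewrite (_ : _ * N%:R = \sum_(k < N) (M / (1 - q) * q ^+ N)); last first.
  by rewrite sumr_const card_ord mulr_natr.
apply: ler_sum => k _.
rewrite lerBlDr -[X in normc X](subrK (g (w ^+ k * z))) (le_trans (normcD _ _))// lerD2r.
apply: (pseries_cvg_geometric_error aM q01 _ (ag k)).
by rewrite normcM normcX (normc_prim_root wN) expr1n mul1r.
Qed.

Lemma cauchy_estimate a r s M A : (forall k, normc (a k) * r ^+ k <= M) ->
  0 <= s < r -> (forall z l, normc z = s -> pseries_cvg a z l -> normc l <= A) ->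
  forall n, normc (a n) * s ^+ n <= A.
Proof.
move=> aM /andP[s0 sr] aA n; have r0 : 0 < r by rewrite (le_lt_trans s0).
have q01 : 0 <= s / r < 1.
  by rewrite divr_ge0 ?(ltW r0)//= ltr_pdivrMr// mul1r.
have sq : s <= s / r * r by rewrite mulfVK ?gt_eqF.
apply/ler_addgt0Pr => e e0.
have [N0 N0P] := geometric_small (M / (1 - s / r)) q01 e0.
pose N := maxn N0 n.+1; have nN : (n < N)%N by exact: leq_maxr.
have [w wN] := complex_prim_root (leq_ltn_trans (leq0n n) nN).
have ns : normc s%:C%C = s by rewrite normc_real.
have wk k : normc (w ^+ k * s%:C%C) = s.
  by rewrite normcM normcX (normc_prim_root wN) expr1n mul1r.
have /choice[g gP] z : exists l, normc z = s -> pseries_cvg a z l.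
  have [zs|zs] := eqVneq (normc z) s; last by exists 0 => /eqP; rewrite (negbTE zs).
  have [|l lP] := pseries_cvg_ex (z := z) aM; first by rewrite zs.
  by exists l.
have := @coef_mean_error a r (s / r) M N w s%:C%C n g aM q01.
rewrite ns => /(_ sq (fun k => gP _ (wk k)) wN nN) h.
apply: le_trans h _; apply: lerD; last first.
  by apply/ltW/N0P; exact: leq_maxl.
rewrite [leLHS]mulrC ler_pdivrMr ?ltr0n ?(leq_ltn_trans _ nN)//.
rewrite mulr_natr -[in leRHS](card_ord N) -sumr_const; apply: ler_sum => k _.
by apply: (aA (w ^+ k * s%:C%C)) => //; exact: gP.
Qed.

Lemma pseries_cvgB a b z l l' : pseries_cvg a z l -> pseries_cvg b z l' ->
  pseries_cvg (fun n => a n - b n) z (l - l').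
Proof.
move=> al bl e e0; have e2 : 0 < e / 2 by rewrite divr_gt0.
have [N NP] := al _ e2; have [N' NP'] := bl _ e2.
exists (maxn N N') => n; rewrite geq_max => /andP[/NP h1 /NP' h2].
have -> : \sum_(k < n) (a k - b k) * z ^+ k - (l - l') =
    (\sum_(k < n) a k * z ^+ k - l) - (\sum_(k < n) b k * z ^+ k - l').
  under eq_bigr do rewrite mulrBl.
  by rewrite sumrB; ring.
by rewrite (le_lt_trans (normcD _ _))// normcN [ltRHS]splitr ltrD.
Qed.

(** Cauchy's estimate with bound 0, applied to the difference of the two series. *)
Lemma pseries_cvg_coef_unique a b r (f : C -> C) : 0 < r ->
  (forall z, normc z < r -> pseries_cvg a z (f z)) ->
  (forall z, normc z < r -> pseries_cvg b z (f z)) -> a = b.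
Proof.
move=> r0 af bf; apply/funext => n; apply/eqP; rewrite -subr_eq0; apply/eqP.
pose d n := a n - b n.
have d0 z : normc z < r -> pseries_cvg d z 0.
  by move=> zr; rewrite -(subrr (f z)); apply: pseries_cvgB; [exact: af|exact: bf].
have r2 : normc (r / 2)%:C%C = r / 2 by rewrite normc_real// divr_ge0// ltW.
have [|M] := @pseries_cvg_bounded R d (r / 2)%:C%C 0.
  by apply: d0; rewrite r2 ltr_pdivrMr// ltr_pMr// ltr1n.
rewrite r2 => dM.
have := @cauchy_estimate d (r / 2) (r / 4) M 0 dM.
have r4 : 0 < r / 4 by rewrite divr_gt0.
move=> /(_ ltac:(by apply/andP; split; lra)) dn.
apply: normc0P; rewrite -(pmulr_lle0 _ (exprn_gt0 n r4)); apply: dn => z l zr zl.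
rewrite (pseries_cvg_unique zl (d0 z _)) ?normc_real// zr; lra.
Qed.

End coefficient_mean.

(** * Taylor expansion on the whole disc *)

Section taylor.
Variable R : realType.
Local Notation C := R[i].
Implicit Types (a b : nat -> C) (z w l : C) (f : C -> C^o) (q M r s d rho : R).

(* The number [d] controls both the radius and the coefficients, so that the
   property is monotone in [d]. *)
Definition expands f w d := exists b,
  (forall n, normc (b n) * d ^+ n <= d^-1) /\
  forall z, normc (z - w) < d -> pseries_cvg b (z - w) (f z).

Lemma expands_le f w d d' : 0 < d' -> d' <= d -> expands f w d -> expands f w d'.
Proof.
move=> d0 dd [b [bd bf]]; exists b; split=> [n|z zw]; last first.
  by apply: bf; exact: lt_le_trans zw dd.
apply: (@le_trans _ _ d^-1); last by rewrite lef_pV2 ?posrE// (lt_le_trans d0).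
apply: le_trans (bd n); rewrite ler_wpM2l ?normc_ge0// lerXn2r ?nnegrE ?(ltW d0)//.
by rewrite (le_trans (ltW d0)).
Qed.

Lemma analytic_psums f c : analytic_at f c -> exists a r, 0 < r /\
  forall z, normc (z - c) < r -> pseries_cvg a (z - c) (f z).
Proof.
move=> [a [r [r0 fa]]]; exists a, r; split => // z /fa h.
exact/pseries_cvg_series.
Qed.

Lemma analytic_expands f c : analytic_at f c -> exists2 d, 0 < d &
  forall w, normc (w - c) < d -> expands f w d.
Proof.
move=> /analytic_psums[a [r [r0 fa]]].
have r2 : 0 < r / 2 by rewrite divr_gt0.
have nr : normc (r / 2)%:C%C = r / 2 by rewrite normc_real// ltW.
have [M aM] : exists M, forall n, normc (a n) * (r / 2) ^+ n <= M.
  have := fa (c + (r / 2)%:C%C); rewrite addrAC subrr add0r nr.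
  move=> /(_ ltac:(lra)) /pseries_cvg_bounded[M]; rewrite nr => aM.
  by exists M.
have M0 : 0 <= M.
  by apply: le_trans (aM 0%N); rewrite expr0 mulr1 normc_ge0.
(* This gives |w - c| + s <= r/4, that is, ratio 1/2 with respect to the radius r/2. The recentred
   coefficients are then bounded by 2M, which the second term of [d] turns into [d^-1]; the added 1
   covers M = 0. *)
pose s := r / 8; have s0 : 0 < s by rewrite divr_gt0.
pose d := Num.min s (2 * M + 1)^-1.
have d0 : 0 < d by rewrite lt_min s0 invr_gt0 ltr_wpDl// mulr_ge0.
exists d => // w wd.
have ws : normc (w - c) < s by rewrite (lt_le_trans wd)// ge_min lexx.
have [||b [bs _ bf]] := @pseries_cvg_recenter R a (r / 2) (1 / 2) M (w - c) s aM s0.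
- by apply/andP; split; lra.
- by move: ws; rewrite /s; lra.
exists b; split=> [n|z zw]; last first.
  have := bf (z - c) (f z); rewrite opprB addrA subrK; apply.
    by rewrite (lt_le_trans zw)// ge_min lexx.
  apply: fa; rewrite -[z](subrK w) -addrA (le_lt_trans (normcD _ _))//.
  have : normc (z - w) < s by rewrite (lt_le_trans zw)// ge_min lexx.
  by move: ws; rewrite /s; lra.
have ds : d <= s by rewrite ge_min lexx.
apply: (@le_trans _ _ (normc (b n) * s ^+ n)).
  by rewrite ler_wpM2l ?normc_ge0// lerXn2r// nnegrE ltW.
rewrite (le_trans (bs n))//.
have M1 : 0 < 2 * M + 1 by rewrite ltr_wpDl// mulr_ge0.
apply: (@le_trans _ _ (2 * M + 1)).
  have -> : M / (1 - 1 / 2) = 2 * M by field.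
  by rewrite lerDl.
by rewrite -[leLHS]invrK lef_pV2 ?posrE ?invr_gt0// ge_min lexx orbT.
Qed.

(** Compactness, with [d] sought among the numbers 1/(n+1) by monotonicity of [expands]. The cover
    is taken on the square that contains the closed disc, and points near one outside the disc
    satisfy the implication [P] vacuously. *)
Lemma uniform_expands f rho : (forall c, normc c <= rho -> analytic_at f c) ->
  exists2 d, 0 < d & forall w, normc w <= rho -> expands f w d.
Proof.
move=> fa; pose K : set (R * R) := `[- rho, rho]%classic `*` `[- rho, rho]%classic.
have cK : compact K by apply: compact_setX; exact: segment_compact.
pose P (n : nat) (xy : R * R) := normc (xy.1 +i* xy.2)%C <= rho ->
  expands f (xy.1 +i* xy.2)%C n.+1%:R^-1.
have near_ball (xy : R * R) (e : R) : 0 < e ->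
    nbhs xy [set xy' : R * R | normc ((xy'.1 +i* xy'.2)%C - (xy.1 +i* xy.2)%C) < e].
  move=> e0; have e2 : 0 < e / 2 by rewrite divr_gt0.
  exists (ball xy.1 (e / 2), ball xy.2 (e / 2)).
    by split; exact: nbhsx_ballx.
  move=> [x' y'] [/=]; rewrite -!ball_normE/= => h1 h2.
  rewrite (le_lt_trans (normc_le_ReIm _ _))// [ltRHS]splitr.
  by rewrite ltrD// distrC.
have := (compact_near_coveringP K).1 cK nat \oo P _.
case=> [[x y] _|N _ NP].
  set c := (x +i* y)%C; have [cr|rc] := leP (normc c) rho.
    have [d d0 dP] := analytic_expands (fa c cr); have [N NP] := ltr_invS d0.
    exists ([set xy' : R * R | normc ((xy'.1 +i* xy'.2)%C - c) < d], [set n | (N <= n)%N]).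
      by split; [exact: near_ball|exists N].
    move=> [[x' y'] n] [/= xd Nn] _; apply: (@expands_le _ _ d).
    - by rewrite invr_gt0.
    - exact/ltW/NP.
    - exact: dP.
  have e0 : 0 < normc c - rho by rewrite subr_gt0.
  exists ([set xy' : R * R | normc ((xy'.1 +i* xy'.2)%C - c) < normc c - rho], setT).
    by split; [exact: near_ball|exact: filterT].
  move=> [[x' y'] n] [/= xd _]; rewrite /P/=; set w := (x' +i* y')%C => wr.
  have h : normc c <= normc (c - w) + normc w by have := normcD (c - w) w; rewrite subrK.
  have {}xd : normc (c - w) < normc c - rho by rewrite normcB; exact: xd.
  by have := le_lt_trans h (ltr_leD xd wr); rewrite subrK ltxx.
exists N.+1%:R^-1; first by rewrite invr_gt0.
move=> w wr; have Kw : K (complex.Re w, complex.Im w).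
  split; rewrite /= in_itv/= -ler_norml.
    exact: le_trans (normc_Re _) wr.
  exact: le_trans (normc_Im _) wr.
have := NP N (leqnn N) _ Kw; rewrite /P [(_.1 +i* _.2)%C](_ : _ = w); last by case: (w).
exact.
Qed.

Lemma pseries_cvg_shift_unique a b w r f : 0 < r ->
  (forall z, normc (z - w) < r -> pseries_cvg a (z - w) (f z)) ->
  (forall z, normc (z - w) < r -> pseries_cvg b (z - w) (f z)) -> a = b.
Proof.
move=> r0 af bf; apply: (@pseries_cvg_coef_unique R a b r (fun h => f (h + w))) => // z zr.
  by have := af (z + w); rewrite addrK; exact.
by have := bf (z + w); rewrite addrK; exact.
Qed.

(* The [n]-th coefficient of the expansion at [w] is a power series in [w], which
   the local expansions bound on the circle |w| = [t]: Cauchy's estimate applies. *)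
Lemma taylor_coef_bound a f rho d t n j : 0 < d -> 0 < t < rho ->
  (forall z, normc z < rho -> pseries_cvg a z (f z)) ->
  (forall w, normc w < rho -> expands f w d) ->
  normc (a (j + n)%N) * 'C(j + n, n)%:R * t ^+ j * d ^+ n <= d^-1.
Proof.
move=> d0 /andP[t0 trho] af fe.
(* Equally spaced radii between [t] and [rho]: [a] is bounded at t + 3e, the series of n-th
   coefficients at t + e, and recentring uses t + 2e. *)
pose e := (rho - t) / 4; have e0 : 0 < e by rewrite divr_gt0// subr_gt0.
have et : rho = t + 4 * e by rewrite /e; field.
pose r := t + 3 * e; have r0 : 0 < r by rewrite /r; lra.
have nr : normc r%:C%C = r by rewrite normc_real// ltW.
have [M aM] : exists M, forall k, normc (a k) * r ^+ k <= M.
  have [|M] := pseries_cvg_bounded (af r%:C%C _); first by rewrite nr et /r; lra.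
  by rewrite nr => aM; exists M.
pose q := (t + 2 * e) / r.
have q01 : 0 <= q < 1.
  by apply/andP; split; [rewrite divr_ge0//; [lra|exact: ltW]|rewrite ltr_pdivrMr// /r; lra].
have qr : q * r = t + 2 * e by rewrite /q mulfVK ?gt_eqF.
pose a' j := a (j + n)%N * 'C(j + n, n)%:R.
have nC k : normc ('C(k, n)%:R : C) = 'C(k, n)%:R.
  by rewrite -(rmorph_nat (@real_complex R)) normc_real.
have a'M k : normc (a' k) * (t + e) ^+ k <= M / e ^+ n.
  rewrite ler_pdivlMr ?exprn_gt0//.
  have te : normc (t + e)%:C%C = t + e by rewrite normc_real// addr_ge0 ?ltW.
  have := @binomial_coef_bound R a r 1 M (t + e)%:C%C e n (k + n) aM (ltW e0) ler01.
  rewrite te mul1r => /(_ ltac:(rewrite /r; lra)).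
  by rewrite expr1n mulr1 addnK normcM normcX te.
rewrite -ler_pdivlMr ?exprn_gt0// -nC -normcM.
apply: (@cauchy_estimate R a' (t + e) t (M / e ^+ n) (d^-1 / d ^+ n) a'M) => [|w l wt a'l].
- by rewrite (ltW t0) ltrDl.
- have [|b [_ bn bf]] := @pseries_cvg_recenter R a r q M w e aM e0 q01.
    by rewrite wt qr lerD2l; lra.
  rewrite (pseries_cvg_unique a'l (bn n)).
  have [|b0 [b0d b0f]] := fe w; first by rewrite wt.
  suff -> : b = b0 by rewrite ler_pdivlMr ?exprn_gt0.
  have ed0 : 0 < Num.min e d by rewrite lt_min e0.
  apply: (@pseries_cvg_shift_unique b b0 w _ f ed0) => z; rewrite lt_min => /andP[ze zd].
    apply: bf => //; apply: af; rewrite -[z](subrK w).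
    by rewrite (le_lt_trans (normcD _ _))// wt et; lra.
  exact: b0f.
Qed.

(** Adding the bounds of [taylor_coef_bound] over all splittings k = j + n rebuilds the binomial
    expansion of (t + d)^k, so |a_k| (t + d)^k <= (k + 1) / d and the series converges beyond [rho].
    At [z] its sum is compared with f through the recentring at the point [w] of modulus [t] on the
    same ray, where both expansions have the same coefficients. *)
Lemma taylor_extend a f rho d : 0 < rho -> 0 < d ->
  (forall z, normc z < rho -> pseries_cvg a z (f z)) ->
  (forall w, normc w < rho -> expands f w d) ->
  forall z, normc z < rho + d / 4 -> pseries_cvg a z (f z).
Proof.
move=> rho0 d0 af fe.
pose t := Num.max (rho / 2) (rho - d / 4).
have t0 : 0 < t by rewrite lt_max divr_gt0.
have trho : t < rho by rewrite gt_max; apply/andP; split; lra.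
have td : rho - d / 4 <= t by rewrite le_max lexx orbT.
have a0 k : normc (a k) * (t + d) ^+ k <= k.+1%:R * d^-1.
  rewrite exprDn mulr_sumr.
  rewrite (_ : k.+1%:R * d^-1 = \sum_(i < k.+1) d^-1); last first.
    by rewrite sumr_const card_ord mulr_natl.
  apply: ler_sum => n _; have nk : (n <= k)%N by rewrite -ltnS.
  have := @taylor_coef_bound a f rho d t n (k - n) d0 _ af fe.
  rewrite t0 trho => /(_ isT); rewrite subnK//; apply: le_trans.
  by rewrite -mulr_natr le_eqVlt; apply/orP; left; apply/eqP; ring.
pose r := t + 3 / 4 * d; pose r1 := t + d.
have r1_0 : 0 < r1 by rewrite addr_gt0.
have r0 : 0 < r by rewrite /r; lra.
pose q := r / r1.
have q01 : 0 <= q < 1.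
  by rewrite divr_ge0 ?(ltW r0) ?(ltW r1_0)//= ltr_pdivrMr// mul1r /r /r1; lra.
(* The factor k + 1 is absorbed by the smaller radius: (k + 1) q^k <= 1 + q + ... + q^k. *)
have aM k : normc (a k) * r ^+ k <= d^-1 / (1 - q).
  have -> : r = q * r1 by rewrite /q mulfVK ?gt_eqF.
  rewrite exprMn mulrCA mulrC.
  have q0 : 0 <= q ^+ k by rewrite exprn_ge0//; case/andP: q01.
  apply: (le_trans (ler_wpM2r q0 (a0 k))).
  rewrite mulrAC [X in X <= _]mulrC ler_wpM2l ?invr_ge0 ?(ltW d0)//.
  apply: le_trans (geometric_sum_le k.+1 q01).
  rewrite mulr_natl -[X in _ *+ X](card_ord k.+1) -sumr_const.
  apply: ler_sum => i _; case/andP: q01 => q0' q1.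
  by apply: ler_wiXn2l => //; [exact: ltW|rewrite -ltnS].
move=> z zr; have [zrho|rhoz] := ltP (normc z) rho; first exact: af.
have z0 : 0 < normc z by rewrite (lt_le_trans rho0).
have [|l al] := pseries_cvg_ex (z := z) aM; first by rewrite /r; lra.
pose w := (t / normc z)%:C%C * z.
have wt : normc w = t.
  rewrite normcM normc_real ?mulfVK ?gt_eqF//.
  by rewrite divr_ge0 ?ltW.
have zw : normc (z - w) = normc z - t.
  have -> : z - w = (1 - t / normc z)%:C%C * z by rewrite /w rmorphB; ring.
  rewrite normcM normc_real; last first.
    by rewrite subr_ge0 ler_pdivrMr// mul1r (le_trans (ltW trho)).
  by rewrite mulrBl mul1r mulfVK ?gt_eqF.
(* The recentred series must reach [z], at distance |z| - t from [w], while |w| + s = |z| + d/8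
   stays below t + 5d/8, hence below [r]. *)
pose s := normc z - t + d / 8.
have s0 : 0 < s by rewrite /s; lra.
pose q' := (t + 5 / 8 * d) / r.
have q'01 : 0 <= q' < 1.
  rewrite divr_ge0 ?(ltW r0)//=; last by rewrite addr_ge0 ?mulr_ge0 ?ltW.
  by rewrite ltr_pdivrMr// mul1r /r; lra.
have [|b [_ _ bf]] := @pseries_cvg_recenter R a r q' _ w s aM s0 q'01.
  by rewrite wt mulfVK ?gt_eqF// /s; lra.
have [|b0 [b0d b0f]] := fe w; first by rewrite wt.
have bb : b = b0.
  pose e := Num.min (Num.min s d) (rho - t).
  have e0 : 0 < e by rewrite !lt_min s0 d0 subr_gt0.
  apply: (@pseries_cvg_shift_unique b b0 w e f e0) => y; rewrite !lt_min => /andP[/andP[ys yd] yr].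
    apply: bf => //; apply: af; rewrite -[y](subrK w).
    by rewrite (le_lt_trans (normcD _ _))// wt; lra.
  exact: b0f.
have bl : pseries_cvg b (z - w) l by apply: bf => //; rewrite zw /s; lra.
have bfz : pseries_cvg b (z - w) (f z) by rewrite bb; apply: b0f; rewrite zw; lra.
by rewrite -(pseries_cvg_unique bl bfz).
Qed.

(** The supremum of the radii where the expansion at 0 represents f is itself such a radius. If it
    were below 1, a uniform [d] on the closed disc would enlarge it by d/4. *)
Lemma taylor_holo f : holo_disc f ->
  exists a, forall z, normc z < 1 -> pseries_cvg a z (f z).
Proof.
move=> [fa _].
have [|a [r [r0 af]]] := @analytic_psums f 0; first by apply: fa; rewrite /disc/mkset normc_real.
have {}af z : normc z < r -> pseries_cvg a z (f z) by have := af z; rewrite subr0.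
exists a.
pose S : set R := [set rho | 0 < rho <= 1 /\ forall z, normc z < rho -> pseries_cvg a z (f z)].
have Sr : S (Num.min r 1).
  rewrite /S/= lt_min r0 ltr01 ge_min lexx orbT; split => // z.
  by rewrite lt_min => /andP[/af].
have Sub : has_ubound S by exists 1 => rho [/andP[]].
have Ssup : has_sup S by split => //; exists (Num.min r 1).
have sup0 : 0 < sup S.
  by apply: lt_le_trans (ub_le_sup Sub Sr); rewrite lt_min r0 ltr01.
have supf z : normc z < sup S -> pseries_cvg a z (f z).
  move=> /(sup_gt (proj1 Ssup))[rho Srho zrho].
  exact: Srho.2.
suff : 1 <= sup S by move=> s1 z z1; apply: supf; exact: lt_le_trans s1.
rewrite leNgt; apply/negP => sup1.
have [|d d0 de] := @uniform_expands f (sup S).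
  by move=> c cs; apply: fa; rewrite /disc/= (le_lt_trans cs).
have := taylor_extend sup0 d0 supf (fun w ws => de w (ltW ws)).
move=> ext; have : S (Num.min 1 (sup S + d / 4)).
  rewrite /S/= lt_min ltr01 ge_min lexx addr_gt0 ?divr_gt0//=; split => // z.
  by rewrite lt_min => /andP[_ /ext].
move=> /(ub_le_sup Sub); rewrite ge_min => /orP[|]; first by rewrite leNgt sup1.
by rewrite gerDl leNgt divr_gt0.
Qed.

Lemma power_series_holo a (f : C -> C^o) :
  (forall z, normc z < 1 -> pseries_cvg a z (f z)) -> (forall z, ~ disc z -> f z = 0) ->
  holo_disc f.
Proof.
move=> af f0; split => // c; rewrite /disc/= => c1.
pose e := (1 - normc c) / 4; have e0 : 0 < e by rewrite divr_gt0 ?subr_gt0.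
have ce : 1 = normc c + 4 * e by rewrite /e; field.
pose r := normc c + 3 * e.
have r0 : 0 < r by rewrite /r; have := normc_ge0 c; lra.
have nr : normc r%:C%C = r by rewrite normc_real// ltW.
have [M aM] : exists M, forall k, normc (a k) * r ^+ k <= M.
  have [|M] := pseries_cvg_bounded (af r%:C%C _); first by rewrite nr ce /r; lra.
  by rewrite nr => aM; exists M.
pose q := (normc c + 2 * e) / r.
have q01 : 0 <= q < 1.
  rewrite divr_ge0 ?(ltW r0)//=; last by have := normc_ge0 c; lra.
  by rewrite ltr_pdivrMr// mul1r /r; lra.
have [|b [_ _ bf]] := @pseries_cvg_recenter R a r q M c e aM e0 q01.
  by rewrite mulfVK ?gt_eqF// lerD2l; lra.
exists b, e; split => // z zc; apply/pseries_cvg_series; apply: bf => //.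
apply: af; rewrite -[z](subrK c) (le_lt_trans (normcD _ _))//.
by rewrite ce; lra.
Qed.

End taylor.

(** * Rotation invariance of the area *)

Section area_rotation.
Variable R : realType.
Local Notation leb := (@lebesgue_measure R).
Local Notation plane := (measurableTypeR R * measurableTypeR R)%type.
Implicit Types (f : plane -> \bar R) (a c : R).
Local Open Scope ereal_scope.

Lemma lebesgue_measure_shift c (A : set (measurableTypeR R)) : measurable A ->
  pushforward leb (fun x : measurableTypeR R => (x + c)%R : measurableTypeR R) A = leb A.
Proof.
move=> mA; apply/esym/lebesgue_measure_unique => //=; first exact: measurable_funD.
move=> _ _ [[a b]] _ <-.
rewrite /pushforward.
have -> : ((fun x : R => (x + c)%R) @^-1` `]a, b]%classic) = `](a - c)%R, (b - c)%R]%classic.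
  by apply/seteqP; split=> x /=; rewrite !in_itv/= ltrBlDr lerBrDr.
rewrite !lebesgue_measure_itv/= !lte_fin ltrD2r.
by case: ifP => // _; rewrite -!EFinB; congr _%:E; ring.
Qed.

Lemma ge0_integral_shift c (g : measurableTypeR R -> \bar R) :
  measurable_fun setT g -> (forall x, 0 <= g x) ->
  \int[leb]_x g (x + c)%R = \int[leb]_x g x.
Proof.
move=> mg g0.
have ms : measurable_fun setT (fun x : measurableTypeR R => (x + c)%R : measurableTypeR R).
  exact: measurable_funD.
have := @ge0_integral_pushforward _ _ _ _ R _ ms leb setT g measurableT mg (fun y _ => g0 y).
rewrite preimage_setT /= => <-.
by apply: eq_measure_integral => //= A mA _; exact: lebesgue_measure_shift.
Qed.

Lemma measurable_shear a : measurable_fun setT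
  (fun z : plane => ((z.1 + a * z.2)%R, z.2) : plane).
Proof.
apply: measurable_fun_pair; last exact: measurable_snd.
apply: measurable_funD; first exact: measurable_fst.
by apply: measurable_funM => //; exact: measurable_snd.
Qed.

Lemma measurable_shear2 a : measurable_fun setT
  (fun z : plane => (z.1, (z.2 + a * z.1)%R) : plane).
Proof.
apply: measurable_fun_pair; first exact: measurable_fst.
apply: measurable_funD; first exact: measurable_snd.
by apply: measurable_funM => //; exact: measurable_fst.
Qed.

Lemma ge0_integral_shear a f : measurable_fun setT f -> (forall z, 0 <= f z) ->
  \int[@area R]_z f ((z.1 + a * z.2)%R, z.2) = \int[@area R]_z f z.
Proof.
move=> mf f0; rewrite /area.
have ms := measurableT_comp mf (measurable_shear a).
transitivity (\int[leb]_y \int[leb]_x f ((x + a * y)%R, y)).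
  by have h := fubini_tonelli2 _ ms (fun z => f0 _); exact: h.
transitivity (\int[leb]_y \int[leb]_x f (x, y)); last first.
  by have h := fubini_tonelli2 _ mf f0; apply: esym; exact: h.
apply: eq_integral => y _.
apply: (@ge0_integral_shift (a * y)%R (fun x => f (x, y))) => //.
exact: measurableT_comp mf _.
Qed.

Lemma ge0_integral_shear2 a f : measurable_fun setT f -> (forall z, 0 <= f z) ->
  \int[@area R]_z f (z.1, (z.2 + a * z.1)%R) = \int[@area R]_z f z.
Proof.
move=> mf f0; rewrite /area.
have ms := measurableT_comp mf (measurable_shear2 a).
transitivity (\int[leb]_x \int[leb]_y f (x, (y + a * x)%R)).
  by have h := fubini_tonelli1 _ ms (fun z => f0 _); exact: h.
transitivity (\int[leb]_x \int[leb]_y f (x, y)); last first.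
  by have h := fubini_tonelli1 _ mf f0; apply: esym; exact: h.
apply: eq_integral => x _ /=.
apply: (@ge0_integral_shift (a * x)%R (fun y => f (x, y))) => //.
exact: measurableT_comp mf _.
Qed.

Definition rot (c s : R) (z : plane) : plane :=
  ((c * z.1 - s * z.2)%R, (s * z.1 + c * z.2)%R).

(* A rotation of angle [theta] is a product of three shears, with parameters
   [- tan (theta / 2)], [sin theta] and [- tan (theta / 2)]. *)
Lemma ge0_integral_rot_neN1 c s f : (c ^+ 2 + s ^+ 2 = 1)%R -> (c != -1)%R ->
  measurable_fun setT f -> (forall z, 0 <= f z) ->
  \int[@area R]_z f (rot c s z) = \int[@area R]_z f z.
Proof.
move=> cs cN1 mf f0; have c1 : (1 + c != 0)%R by rewrite addrC addr_eq0.
pose t := (- (s / (1 + c)))%R.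
rewrite -(ge0_integral_shear t mf f0).
have m1 := measurableT_comp mf (measurable_shear t).
rewrite -(ge0_integral_shear2 s m1 (fun z => f0 _)).
have m2 := measurableT_comp m1 (measurable_shear2 s).
rewrite -(ge0_integral_shear t m2 (fun z => f0 _)).
apply: eq_integral => z _ /=; congr f.
have ts : (t * s = c - 1)%R.
  have s2 : (s ^+ 2 = (1 - c) * (1 + c))%R by rewrite -subr_sqr expr1n -cs addrAC subrr add0r.
  by rewrite /t mulNr mulrAC -expr2 s2 mulfK// opprB.
have tc : (t * (1 + c) = - s)%R by rewrite /t mulNr mulfVK.
rewrite /rot; congr pair.
  have -> : (z.1 + t * z.2 + t * (z.2 + s * (z.1 + t * z.2)) =
    z.1 * (1 + t * s) + z.2 * (t * (1 + (1 + t * s))))%R by ring.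
  rewrite ts (_ : (1 + (c - 1) = c)%R); last by ring.
  by rewrite tc; ring.
have -> : (z.2 + s * (z.1 + t * z.2) = s * z.1 + z.2 * (1 + t * s))%R by ring.
by rewrite ts; ring.
Qed.

(** The half turn, for which tan (theta / 2) is undefined, is the square of a quarter turn. *)
Lemma ge0_integral_rot c s f : (c ^+ 2 + s ^+ 2 = 1)%R ->
  measurable_fun setT f -> (forall z, 0 <= f z) ->
  \int[@area R]_z f (rot c s z) = \int[@area R]_z f z.
Proof.
move=> cs mf f0; have [cN1|] := eqVneq c (-1)%R; last by move=> /(ge0_integral_rot_neN1 cs); exact.
have s0 : s = 0%R.
  by apply/eqP; rewrite -sqrf_eq0; move: cs => /eqP; rewrite cN1 sqrrN expr1n addrC eq_sym -subr_eq subrr eq_sym.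
have i1 : (0 ^+ 2 + 1 ^+ 2 = 1 :> R)%R by ring.
have iN1 : (0 != -1 :> R)%R by rewrite eq_sym oppr_eq0 oner_eq0.
have mrot : measurable_fun setT (rot 0 1).
  apply: measurable_fun_pair.
    by apply: measurable_funB; apply: measurable_funM => //; (exact: measurable_fst || exact: measurable_snd).
  by apply: measurable_funD; apply: measurable_funM => //; (exact: measurable_fst || exact: measurable_snd).
rewrite -(ge0_integral_rot_neN1 i1 iN1 mf f0).
have m1 := measurableT_comp mf mrot.
rewrite -(ge0_integral_rot_neN1 i1 iN1 m1 (fun z => f0 _)).
apply: eq_integral => z _ /=; congr f; rewrite /rot cN1 s0/=; congr pair.
  by ring.
by ring.
Qed.

End area_rotation.

(** * Estimates in Bergman spaces *)

Section bergman_estimates.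
Variable R : realType.
Local Notation C := R[i].
Local Notation area := (@area R).
Implicit Types (f g : C -> C^o) (p mu nu e rho : R).

(** An elementary substitute for Jensen's inequality, to pass from a mean of |f| to a mean of |f|^p:
    above the threshold, x = x^p / x^(p-1) <= x^p / t^(p-1). *)
Lemma powR_gt_le (p x t : R) : 1 < p -> 0 <= x -> 0 < t ->
  x <= t + x `^ p / t `^ (p - 1).
Proof.
move=> p1 x0 t0; have tp : 0 < t `^ (p - 1) by rewrite powR_gt0.
have [xt|tx] := leP x t; first by rewrite ler_wpDr// divr_ge0 ?powR_ge0.
rewrite ler_wpDl ?(ltW t0)// ler_pdivlMr// -(mulr_powRB1 x0) ?(lt_trans ltr01)//.
rewrite ler_wpM2l// ge0_ler_powR ?nnegrE ?(ltW t0) ?(ltW tx)//.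
by rewrite subr_ge0 ltW.
Qed.

Lemma powR_norm (p x : R) : 0 < p -> 0 <= x -> (x `^ p^-1) `^ p = x.
Proof. by move=> p0 x0; rewrite -powRrM mulVf ?gt_eqF// powRr1. Qed.

Lemma bergman_norm_lt p mu f e : 0 < p -> 0 < e ->
  (bergman_norm p mu f < e%:E)%E <-> (bergman_modular p mu f < (e `^ p)%:E)%E.
Proof. by move=> p0 e0; apply: poweR_ltE => //; exact: bergman_modular_ge0. Qed.

Lemma bergman_norm_le p mu f e : 0 < p -> 0 < e ->
  (bergman_modular p mu f <= (e `^ p)%:E)%E -> (bergman_norm p mu f <= e%:E)%E.
Proof.
move=> p0 e0 fe; apply/lee_addgt0Pr => d d0; rewrite -EFinD ltW//.
apply/bergman_norm_lt => //; first exact: addr_gt0.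
apply: le_lt_trans fe _; rewrite lte_fin.
by rewrite gt0_ltr_powR ?nnegrE ?ltrDl ?(ltW e0)// addr_ge0 ?ltW.
Qed.

(** The triangle inequality follows from convexity of balls: f + g is the convex combination, with
    weights a/(a+b) and b/(a+b), of two functions of norm less than a + b. *)
Lemma bergman_normD p mu f g (a b : R) : 1 < p -> holo_disc f -> holo_disc g ->
  0 < a -> 0 < b -> (bergman_norm p mu f < a%:E)%E -> (bergman_norm p mu g < b%:E)%E ->
  (bergman_norm p mu (f + g)%R < (a + b)%:E)%E.
Proof.
move=> p1 Hf Hg a0 b0 fa gb; have ab0 : 0 < a + b by rewrite addr_gt0.
have p0 : 0 < p by rewrite (lt_trans _ p1).
have scale c h : 0 < c -> holo_disc h -> (bergman_norm p mu h < c%:E)%E ->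
    (bergman_norm p mu (((a + b) / c)%:C%C *: h)%R < (a + b)%:E)%E.
  move=> c0 Hh hc; rewrite bergman_norm_scale// normc_real ?divr_ge0 ?ltW//.
  have -> : ((a + b)%:E = ((a + b) / c)%:E * c%:E :> \bar R)%E.
    by rewrite -EFinM mulfVK// gt_eqF.
  by rewrite lte_pmul2l// ?lte_fin ?divr_gt0.
have := @bergman_normD_lt R p mu _ _ (a / (a + b)) (b / (a + b)) (a + b) p1 ab0
  (holoZ ((a + b) / a)%:C%C Hf) (holoZ ((a + b) / b)%:C%C Hg).
rewrite -mulrDl mulfV ?gt_eqF//.
move=> /(_ (divr_ge0 (ltW a0) (ltW ab0)) (divr_ge0 (ltW b0) (ltW ab0)) erefl
  (scale _ _ a0 Hf fa) (scale _ _ b0 Hg gb)).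
rewrite !scaleRA.
have -> : a / (a + b) * ((a + b) / a) = 1 by field; rewrite !gt_eqF.
have -> : b / (a + b) * ((a + b) / b) = 1 by field; rewrite !gt_eqF.
by rewrite !scale1r.
Qed.

Lemma holoB f g : holo_disc f -> holo_disc g -> holo_disc (f - g).
Proof.
by move=> Hf Hg; rewrite addrC -scaleN1r; apply: holo_lin.
Qed.

Lemma bergman_normB p mu f g (a b : R) : 1 < p -> holo_disc f -> holo_disc g ->
  0 < a -> 0 < b -> (bergman_norm p mu f < a%:E)%E -> (bergman_norm p mu g < b%:E)%E ->
  (bergman_norm p mu (f - g)%R < (a + b)%:E)%E.
Proof.
move=> p1 Hf Hg a0 b0 fa gb; have p0 : 0 < p by rewrite (lt_trans _ p1).
have -> : f - g = f + (-1 : C) *: g by rewrite scaleN1r.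
apply: (bergman_normD p1 Hf (holoZ (-1) Hg) a0 b0 fa).
by rewrite (bergman_norm_scale _ _ p0 Hg) normcN normc_real// mul1e.
Qed.

(** * Taylor coefficients controlled by the norm *)

Definition taylor f : nat -> C :=
  xget (fun=> 0) [set a | forall z, normc z < 1 -> pseries_cvg a z (f z)].

Lemma taylorP f : holo_disc f -> forall z, normc z < 1 -> pseries_cvg (taylor f) z (f z).
Proof.
move=> /taylor_holo fa.
exact: (@xgetPex _ (fun=> 0) [set a | forall z, normc z < 1 -> pseries_cvg a z (f z)] fa).
Qed.

Lemma taylorB f g n : holo_disc f -> holo_disc g ->
  taylor (f - g) n = taylor f n - taylor g n.
Proof.
move=> Hf Hg; have Hfg := holoB Hf Hg.
suff -> : taylor (f - g) = (fun n => taylor f n - taylor g n) by [].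
apply: (@pseries_cvg_coef_unique R _ _ 1 (f - g)) => // z z1; first exact: taylorP.
by apply: pseries_cvgB; exact: taylorP.
Qed.

Lemma taylor_bounded f r : holo_disc f -> 0 <= r < 1 ->
  exists M, forall n, normc (taylor f n) * r ^+ n <= M.
Proof.
move=> Hf /andP[r0 r1]; have nr : normc r%:C%C = r by rewrite normc_real.
have [|M] := pseries_cvg_bounded (taylorP Hf (z := r%:C%C) _); first by rewrite nr.
by rewrite nr => fM; exists M.
Qed.

Definition annulus (s t : R) : set C := [set z | s < normc z /\ normc z < t].

Lemma measurable_annulus s t :
  measurable [set xy : R * R | annulus s t (xy.1 +i* xy.2)%C].
Proof.
apply: measurable_openC => c [sc ct].
exists (Num.min (normc c - s) (t - normc c)); first by rewrite lt_min !subr_gt0 sc.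
move=> z; rewrite lt_min => /andP[h1 h2]; split.
  by have := normcD (c - z) z; rewrite subrK normcB => h; lra.
by have := normcD (z - c) c; rewrite subrK => h; lra.
Qed.

Lemma rot_complex (c s : R) (xy : R * R) :
  ((rot c s xy).1 +i* (rot c s xy).2)%C = (c +i* s)%C * (xy.1 +i* xy.2)%C.
Proof. by apply/eqP; rewrite /rot /GRing.mul/= eq_complex/= addrC [_ * _ + _]addrC !eqxx. Qed.

(** A small square of explicit area suffices: the lower bound of [coef_bound] holds at every point
    of the annulus but needs to be integrated only over a set of positive measure. *)
Lemma area_rectangle (s t : R) : 0 <= s -> s < t ->
  exists2 Q : set (R * R), measurable Q /\ (0 < area Q < +oo)%E &
    forall xy, Q xy -> annulus s t (xy.1 +i* xy.2)%C.
Proof.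
move=> s0 st; pose h := (t - s) / 2; have h0 : 0 < h by rewrite divr_gt0// subr_gt0.
exists (`]s, s + h[%classic `*` `]0, h[%classic).
  split; first by apply: measurableX; exact: measurable_itv.
  have -> : area (`]s, s + h[%classic `*` `]0, h[%classic) = (h * h)%:E.
    rewrite /Defs.area product_measure1E; [|exact: measurable_itv|exact: measurable_itv].
    have leb (a : R) : lebesgue_measure (`]a, a + h[%classic : set R) = h%:E.
      by rewrite lebesgue_measure_itv/= lte_fin ltrDl h0 -EFinB addrAC subrr add0r.
    by rewrite EFinM; congr (_ * _)%E; [exact: leb|rewrite -[X in `]_, X[]add0r; exact: leb].
  by rewrite lte_fin mulr_gt0//= ltry.
move=> [x y] [/=]; rewrite !in_itv/= => /andP[sx xs] /andP[y0 yh]; split.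
  apply: lt_le_trans (normc_Re _) => /=.
  by rewrite ger0_norm// (le_trans s0)// ltW.
apply: (le_lt_trans (normc_le_ReIm _ _)).
rewrite !ger0_norm ?(ltW y0)//; last by rewrite (le_trans s0)// ltW.
have -> : t = s + h + h by rewrite /h; field.
exact: ltrD.
Qed.

Lemma bergman_integrandE p mu f (xy : R * R) : bergman_integrand p mu f xy =
  normc (f (xy.1 +i* xy.2)%C) `^ p * (1 - normc (xy.1 +i* xy.2)%C) `^ mu.
Proof. by []. Qed.

(** By contradiction: a large coefficient makes the mean of |f|^p over the [N] rotations of any
    point of the annulus large. Integrated over [Q], this bounds from below a sum of [N] rotated
    integrals, each of which equals one integral bounded by pi e^p; the factors [N] cancel. *)
Lemma coef_bound p mu rho : 1 < p -> 0 < mu -> 0 < rho < 1 ->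
  exists2 c : R, 0 < c & forall f e, holo_disc f -> 0 < e ->
    (bergman_norm p mu f < e%:E)%E -> forall n, normc (taylor f n) * rho ^+ n <= c * e.
Proof.
move=> p1 mu0 /andP[rho0 rho1]; have p0 : 0 < p by rewrite (lt_trans _ p1).
pose t := (1 + rho) / 2; have t1 : t < 1 by rewrite /t; lra.
have trho : rho < t by rewrite /t; lra.
have t0 : 0 < t by rewrite (lt_trans rho0).
have [Q [mQ /andP[Q0 Qoo]] QA] := area_rectangle (ltW rho0) trho.
pose m := fine (area Q); have m0 : 0 < m by rewrite fine_gt0// Q0.
have Qm : area Q = m%:E by rewrite /m fineK// ge0_fin_numE ?(ltW Q0).
pose c0 := (1 - t) `^ mu * m.
have c00 : 0 < c0 by rewrite mulr_gt0// powR_gt0// subr_gt0.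
pose c := 8 * (pi / c0) `^ p^-1.
have pc0 : 0 < pi / c0 by rewrite divr_gt0// pi_gt0.
exists c; first by rewrite mulr_gt0// powR_gt0.
move=> f e Hf e0 /(bergman_norm_lt _ _ p0 e0) fe n.
rewrite leNgt; apply/negP => cfe.
(* The assumption reads |a_n| rho^n > 4k: one k pays for truncation, another is the threshold in
   [powR_gt_le]. The integrated estimate ends with k <= l, while the 8 in [c] makes k = 2l. *)
pose k := c * e / 4.
have k0 : 0 < k by rewrite divr_gt0// mulr_gt0// mulr_gt0// powR_gt0.
pose l := (pi / c0) `^ p^-1 * e.
have l0 : 0 < l by rewrite mulr_gt0// powR_gt0.
have kE : k = 2 * l by rewrite /k /c /l; field.
have [r [r0 r1 tr]] : exists r, [/\ 0 < r, r < 1 & t < r].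
  by exists ((1 + t) / 2); split; lra.
have r01 : 0 <= r < 1 by rewrite (ltW r0).
have [M aM] := taylor_bounded Hf r01.
pose q := t / r; have q01 : 0 <= q < 1.
  by rewrite divr_ge0 ?ltW//= ltr_pdivrMr// mul1r.
have [N0 N0P] := geometric_small (M / (1 - q)) q01 k0.
pose N := maxn N0 n.+1; have nN : (n < N)%N by exact: leq_maxr.
have NE : M / (1 - q) * q ^+ N < k by apply: N0P; exact: leq_maxl.
have N0' : 0 < N%:R :> R by rewrite ltr0n (leq_ltn_trans _ nN).
have [w wN] := complex_prim_root R (leq_ltn_trans (leq0n n) nN).
have w1 i : normc (w ^+ i) = 1 by rewrite normcX (normc_prim_root wN) expr1n.
pose A : set (R * R) := [set xy | annulus rho t (xy.1 +i* xy.2)%C].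
have mA : measurable A := measurable_annulus rho t.
have AD : A `<=` @disc2 R.
  by move=> xy [_ /lt_trans]; apply.
(* Extension by 0 from the annulus, which rotations preserve, gives a function on the whole plane,
   as rotation invariance requires. *)
pose G : R * R -> \bar R := (EFin \o bergman_integrand p mu f) \_ A.
have mG : measurable_fun setT G.
  apply/(measurable_restrictT _ mA); apply: measurable_funS (measurable_bergman p mu Hf) => //.
  exact: measurable_disc2.
have G0 xy : (0 <= G xy)%E.
  by rewrite /G /patch; case: ifP => // _; exact: bergman_integrand_ge0.
pose rk (i : nat) (xy : R * R) := rot (complex.Re (w ^+ i)) (complex.Im (w ^+ i)) xy.
have rkE i xy : ((rk i xy).1 +i* (rk i xy).2)%C = w ^+ i * (xy.1 +i* xy.2)%C.
  by rewrite rot_complex; congr (_ * _); case: (w ^+ i).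
have csq i : complex.Re (w ^+ i) ^+ 2 + complex.Im (w ^+ i) ^+ 2 = 1.
  have := w1 i; case: (w ^+ i) => a b /= ab.
  have := congr1 (fun x => x ^+ 2) ab; rewrite sqr_sqrtr ?expr1n//.
  by rewrite addr_ge0// sqr_ge0.
have mrk i : measurable_fun setT (rk i).
  apply: measurable_fun_pair.
    by apply: measurable_funB; apply: measurable_funM => //;
      (exact: measurable_fst || exact: measurable_snd).
  by apply: measurable_funD; apply: measurable_funM => //;
    (exact: measurable_fst || exact: measurable_snd).
have intG i : (\int[area]_xy G (rk i xy) = \int[area]_xy G xy)%E.
  exact: ge0_integral_rot (csq i) mG G0.
have GD : (\int[area]_xy G xy <= (pi * e `^ p)%:E)%E.
  rewrite /G -integral_mkcond.
  apply: (@le_trans _ _ (\int[area]_(xy in disc2 (R:=R)) (bergman_integrand p mu f xy)%:E)%E).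
    apply: ge0_subset_integral => //; first exact: measurable_disc2.
      exact: measurable_bergman.
    by move=> xy _; exact: bergman_integrand_ge0.
  move: fe; rewrite /bergman_modular EFinM muleC lte_pdivrMr ?pi_gt0//.
  by rewrite muleC => /ltW.
have key xy : ((k `^ p * (1 - t) `^ mu * N%:R)%:E * (\1_Q xy)%:E <=
    \sum_(i < N) G (rk i xy))%E.
  rewrite indicE; case: (boolP (xy \in Q)) => [|_]; last first.
    by rewrite mule0; apply: sume_ge0.
  rewrite inE mule1 => /QA; set z := (_ +i* _)%C => -[zrho zt].
  have GE i : G (rk i xy) = (normc (f (w ^+ i * z)) `^ p * (1 - normc z) `^ mu)%:E.
    have Ark : A (rk i xy) by rewrite /A /mkset rkE /annulus /mkset normcM w1 mul1r.
    rewrite /G /patch (mem_set Ark) /comp bergman_integrandE rkE.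
    by rewrite normcM w1 mul1r.
  rewrite (eq_bigr (fun i : 'I_N => (normc (f (w ^+ i * z)) `^ p * (1 - normc z) `^ mu)%:E))
    => [|i _]; last exact: GE.
  rewrite sumEFin lee_fin -mulr_suml mulrAC.
  apply: ler_pM; rewrite ?powR_ge0// ?mulr_ge0 ?powR_ge0//; last first.
    by rewrite ge0_ler_powR ?nnegrE ?subr_ge0 ?(ltW t1) ?(ltW mu0) ?lerD2l ?lerN2 ?(ltW zt)// (ltW (lt_trans zt t1)).
  have zq : normc z <= q * r by rewrite /q mulfVK ?gt_eqF// ltW.
  have := @coef_mean_error R (taylor f) r q M N w z n f aM q01 zq _ wN nN.
  have ps (i : 'I_N) : pseries_cvg (taylor f) (w ^+ i * z) (f (w ^+ i * z)).
    by apply: (taylorP Hf); rewrite normcM w1 mul1r (lt_trans zt).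
  move=> /(_ ps) hm.
  pose S := \sum_(i < N) normc (f (w ^+ i * z)) `^ p.
  have S1 : \sum_(i < N) normc (f (w ^+ i * z)) <= N%:R * k + S / k `^ (p - 1).
    rewrite (_ : N%:R * k = \sum_(i < N) k); last by rewrite sumr_const card_ord mulr_natl.
    rewrite /S mulr_suml -big_split/=; apply: ler_sum => i _.
    by apply: powR_gt_le => //; exact: normc_ge0.
  have h4 : 4 * k < normc (taylor f n) * normc z ^+ n.
    apply: lt_le_trans (_ : normc (taylor f n) * rho ^+ n <= _).
      by move: cfe; rewrite /k; lra.
    by rewrite ler_wpM2l ?normc_ge0// lerXn2r ?nnegrE ?normc_ge0 ?(ltW rho0)// ltW.
  have : 3 * k < N%:R^-1 * (N%:R * k + S / k `^ (p - 1)).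
    apply: lt_le_trans (_ : N%:R^-1 * \sum_(i < N) normc (f (w ^+ i * z)) <= _).
      by move: NE hm h4; lra.
    by rewrite ler_wpM2l// invr_ge0 ltW.
  rewrite mulrDr mulKf ?gt_eqF// => h3.
  have : k <= N%:R^-1 * (S / k `^ (p - 1)) by lra.
  rewrite mulrC ler_pdivlMr// ler_pdivlMr ?powR_gt0// mulrAC mulr_powRB1 ?(ltW k0)//.
have : ((k `^ p * (1 - t) `^ mu * N%:R)%:E * area Q <= N%:R%:E * (pi * e `^ p)%:E)%E.
  have c1 : 0 <= k `^ p * (1 - t) `^ mu * N%:R.
    by rewrite mulr_ge0 ?(ltW N0')// mulr_ge0 ?powR_ge0.
  have -> : area Q = (\int[area]_xy (\1_Q xy)%:E)%E by rewrite integral_indic// setIT.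
  rewrite -ge0_integralZl//; last exact/measurable_EFinP.
  apply: (@le_trans _ _ (\int[area]_xy \sum_(i < N) G (rk i xy))%E).
    apply: ge0_le_integral => //.
    - by move=> xy _; rewrite mule_ge0 ?lee_fin.
    - by apply: measurable_funeM; exact/measurable_EFinP.
    - by apply: emeasurable_sum => i; exact: measurableT_comp mG (mrk i).
  apply: (@le_trans _ _ (\sum_(i < N) \int[area]_xy G (rk i xy))%E).
    rewrite le_eqVlt; apply/orP; left; apply/eqP.
    apply: (ge0_integral_sum area measurableT) => [i|//].
    exact: measurableT_comp mG (mrk i).
  rewrite -EFinM mulr_natl -[X in _ *+ X](card_ord N) -sumr_const -sumEFin.
  by apply: lee_sum => i _; rewrite intG; exact: GD.
rewrite Qm -!EFinM lee_fin => h.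
have : k `^ p <= l `^ p.
  rewrite /l [leRHS]powRM ?powR_ge0 ?(ltW e0)// powR_norm ?(ltW pc0)//.
  rewrite mulrAC ler_pdivlMr// -(ler_pM2r N0'); move: h; rewrite /c0; lra.
apply/negP; rewrite -ltNge gt0_ltr_powR// ?nnegrE ?(ltW k0) ?(ltW l0)//.
by rewrite kE ltr_pMl// ltr1n.
Qed.

(** The geometric error estimate at the empty partial sum bounds |f z| itself. *)
Lemma point_bound p mu z : 1 < p -> 0 < mu -> normc z < 1 ->
  exists2 c : R, 0 < c & forall f e, holo_disc f -> 0 < e ->
    (bergman_norm p mu f < e%:E)%E -> normc (f z) <= c * e.
Proof.
move=> p1 mu0 z1; pose rho := (1 + normc z) / 2.
have z0 := normc_ge0 z.
have rho01 : 0 < rho < 1 by apply/andP; split; rewrite /rho; lra.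
have [rho0 rho1] := andP rho01.
have [c c0 cP] := coef_bound p1 mu0 rho01.
pose q := normc z / rho.
have q01 : 0 <= q < 1.
  by rewrite divr_ge0 ?(ltW rho0)//= ltr_pdivrMr// mul1r /rho; lra.
have q1 : 0 < 1 - q by rewrite subr_gt0; case/andP: q01.
exists (c / (1 - q)); first by rewrite divr_gt0.
move=> f e Hf e0 fe.
have := pseries_cvg_geometric_error (cP f e Hf e0 fe) q01 _ (taylorP Hf z1).
rewrite mulfVK ?gt_eqF// => /(_ (lexx _) 0%N).
by rewrite big_ord0 sub0r normcN expr0 mulr1 mulrAC.
Qed.

Lemma cvg_powR (p x : R) (u : nat -> R) : 1 < p -> 0 <= x -> (forall n, 0 <= u n) ->
  u @ \oo --> x -> (fun n => u n `^ p) @ \oo --> x `^ p.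
Proof.
move=> p1 x0 u0 ux; have p0 : 0 < p by rewrite (lt_trans _ p1).
have [x00|xn0] := eqVneq x 0; last first.
  have {}x0 : 0 < x by rewrite lt_neqAle eq_sym xn0.
  have cx : {for x, continuous (fun y : R => y `^ p)}.
    apply/differentiable_continuous/derivable1_diffP.
    by apply: derivable_powR; rewrite in_itv/= x0.
  exact: cvg_comp ux cx.
(* At 0 the derivability argument is replaced by the inequality u^p <= u for 0 <= u < 1. *)
rewrite x00 powR0 ?gt_eqF// in ux *; apply/cvgrPdist_lt => e e0.
have /cvgrPdist_lt/(_ (Num.min 1 e)) := ux.
rewrite lt_min ltr01 e0 => /(_ isT)[N _ NP]; exists N => // n /NP/=.
rewrite !sub0r !normrN !ger0_norm ?powR_ge0// lt_min => /andP[un1 une].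
apply: le_lt_trans une; have [->|un] := eqVneq (u n) 0.
  by rewrite powR0// gt_eqF.
rewrite -[leRHS]powRr1// ger_powR ?(ltW p1)//.
by rewrite lt_neqAle eq_sym un u0 ltW.
Qed.

Lemma limn_einf_le (u : nat -> \bar R) (c : \bar R) :
  (forall n, (u n <= c)%E) -> (limn_einf u <= c)%E.
Proof.
move=> uc; rewrite limn_einf_lim; apply: lime_le; first exact: is_cvg_einfs.
apply: nearW => n; apply: le_trans (uc n).
by apply: ereal_inf_lbound; exists n => /=.
Qed.

Lemma bergman_norm_lim p mu (fs : nat -> C -> C^o) f e : 1 < p -> 0 < e ->
  (forall k, holo_disc (fs k)) -> holo_disc f ->
  (forall z, normc z < 1 -> forall d : R, 0 < d -> exists K, forall k, (K <= k)%N ->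
    normc (fs k z - f z) < d) ->
  (forall k, (bergman_norm p mu (fs k) < e%:E)%E) ->
  (bergman_norm p mu f <= e%:E)%E.
Proof.
move=> p1 e0 Hfs Hf fsf fse; have p0 : 0 < p by rewrite (lt_trans _ p1).
apply: bergman_norm_le => //.
rewrite /bergman_modular muleC -lee_pdivlMr ?invr_gt0 ?pi_gt0//.
have mD := @measurable_disc2 R.
have ge0 k xy : disc2 xy -> (0 <= (bergman_integrand p mu (fs k) xy)%:E)%E.
  by move=> _; exact: bergman_integrand_ge0.
have := fatou area mD (fun k => measurable_bergman p mu (Hfs k)) ge0.
move=> F; apply: le_trans (le_trans _ F) _; last first.
  apply: limn_einf_le => k; rewrite lee_pdivlMr ?invr_gt0 ?pi_gt0// muleC.
  by have /bergman_norm_lt - /(_ p0 e0) := fse k; exact: ltW.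
rewrite le_eqVlt; apply/orP; left; apply/eqP.
apply: eq_integral => xy; rewrite inE => Dxy /=.
have fc : (fun k => bergman_integrand p mu (fs k) xy) @ \oo --> bergman_integrand p mu f xy; last first.
  have fcE : (fun k => (bergman_integrand p mu (fs k) xy)%:E) @ \oo -->
      (bergman_integrand p mu f xy)%:E by apply: cvg_EFin => //; exact: nearW.
  by have [-> _] := cvg_limn_einf_sup fcE.
rewrite bergman_integrandE; apply: cvgMr_tmp.
apply: cvg_powR => //; [exact: normc_ge0|by move=> n; exact: normc_ge0|].
apply/cvgrPdist_lt => d d0; have [K KP] := fsf _ Dxy d d0.
exists K => // k Kk; apply: le_lt_trans (KP k Kk).
move: (fs k _) (f _) => x y; rewrite ler_norml; apply/andP; split.
  by have := normcD (x - y) y; rewrite subrK; lra.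
by have := normcD (y - x) x; rewrite subrK normcB; lra.
Qed.

(** * Comparison of two weights, finite nets and completeness *)

Lemma area_disc_le : (area (@disc2 R) <= 4%:E)%E.
Proof.
have mQ : measurable (`[-1, 1]%classic : set R) := measurable_itv _.
have -> : 4%:E = area (`[-1, 1]%classic `*` `[-1, 1]%classic).
  rewrite /Defs.area product_measure1E//.
  have leb : lebesgue_measure (`[-1, 1]%classic : set R) = 2%:E.
    by rewrite lebesgue_measure_itv/= lte_fin ifT ?gtrN// -EFinB opprK.
  rewrite (_ : 4 = 2 * 2 :> R); last by ring.
  by rewrite EFinM; congr (_ * _)%E.
apply: le_measure; rewrite ?inE; [exact: measurable_disc2|exact: measurableX|].
move=> [x y] xy1; have {}xy1 : normc (x +i* y)%C < 1 by [].
by split; rewrite /= in_itv/= -ler_norml; apply: ltW; apply: le_lt_trans xy1;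
  [exact: (normc_Re (x +i* y)%C)|exact: (normc_Im (x +i* y)%C)].
Qed.

(** Where |z| > 1 - t, the weight of exponent nu is at most t^(nu - mu) times that of exponent mu.
    Elsewhere it is at most 1 and |f| <= s, on a set of area at most 4. *)
Lemma bergman_modular_split p mu nu (t s : R) f : 1 < p -> 0 < mu -> mu < nu ->
  0 < t < 1 -> 0 <= s -> holo_disc f -> (forall z, normc z <= 1 - t -> normc (f z) <= s) ->
  (bergman_modular p nu f <=
   (t `^ (nu - mu))%:E * bergman_modular p mu f + (pi^-1 * (s `^ p * 4))%:E)%E.
Proof.
move=> p1 mu0 mn /andP[t0 t1] s0 Hf fs; have p0 : 0 < p by rewrite (lt_trans _ p1).
have pi0 : (0 <= (pi^-1)%:E :> \bar R)%E by rewrite lee_fin invr_ge0 pi_ge0.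
have mD := @measurable_disc2 R.
have mm := measurable_bergman p mu Hf; have mn' := measurable_bergman p nu Hf.
have g0 xy : (0 <= (bergman_integrand p mu f xy)%:E)%E := bergman_integrand_ge0 p mu f xy.
have tt : 0 <= t `^ (nu - mu) by exact: powR_ge0.
rewrite /bergman_modular muleCA EFinM -ge0_muleDr; last 2 first.
- by rewrite mule_ge0// integral_ge0.
- by rewrite lee_fin mulr_ge0// powR_ge0.
apply: lee_wpmul2l => //.
apply: (@le_trans _ _ (\int[area]_(xy in disc2 (R:=R))
  ((t `^ (nu - mu))%:E * (bergman_integrand p mu f xy)%:E + (s `^ p)%:E))%E).
  apply: ge0_le_integral => //.
  - by move=> xy _; exact: bergman_integrand_ge0.
  - by apply: emeasurable_funD => //; exact: measurable_funeM.
  move=> xy Dxy; rewrite !bergman_integrandE -EFinM -EFinD lee_fin.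
  have {}Dxy : normc (xy.1 +i* xy.2)%C < 1 by [].
  move: (xy.1 +i* xy.2)%C Dxy => z z1.
  have z1' : 0 < 1 - normc z by rewrite subr_gt0.
  have w1 : (1 - normc z) `^ nu <= 1.
    rewrite -[leRHS](powRr0 (1 - normc z)) ger_powR// ?(ltW (lt_trans mu0 mn))//.
    by rewrite z1'/= gerBl normc_ge0.
  have [zt|tz] := leP (normc z) (1 - t).
    apply: ler_wpDl; first by rewrite !mulr_ge0 ?powR_ge0.
    rewrite -[leRHS]mulr1 ler_pM ?powR_ge0// ge0_ler_powR ?nnegrE ?normc_ge0 ?(ltW p0)//.
    exact: fs.
  apply: ler_wpDr; first exact: powR_ge0.
  rewrite mulrCA ler_wpM2l ?powR_ge0//.
  have -> : nu = (nu - mu) + mu by rewrite subrK.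
  rewrite powRD ?(gt_eqF z1') ?implybT// [in leRHS]addrK ler_wpM2r ?powR_ge0//.
  rewrite ge0_ler_powR ?nnegrE ?(ltW t0) ?(ltW z1') ?subr_ge0 ?(ltW mn)//.
  by move: tz; lra.
rewrite ge0_integralD//; last 3 first.
- by move=> xy _; apply: mule_ge0.
- exact: measurable_funeM.
- by move=> xy _; rewrite lee_fin powR_ge0.
rewrite ge0_integralZl// integral_cst// leeD2l// EFinM lee_wpmul2l//.
  by rewrite lee_fin powR_ge0.
exact: area_disc_le.
Qed.

Lemma bergman_small p mu nu (e c : R) : 1 < p -> 0 < mu -> mu < nu -> 0 < e -> 0 < c ->
  exists K (d : R), 0 < d /\ forall f, holo_disc f -> (bergman_norm p mu f < c%:E)%E ->
    (forall n, (n < K)%N -> normc (taylor f n) <= d) -> (bergman_norm p nu f < e%:E)%E.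
Proof.
move=> p1 mu0 mn e0 c0; have p0 : 0 < p by rewrite (lt_trans _ p1).
have nm0 : 0 < nu - mu by rewrite subr_gt0.
have ep : 0 < e `^ p by rewrite powR_gt0.
have cp : 0 < c `^ p by rewrite powR_gt0.
(* [a] and [b] are chosen so that each of the two terms of [bergman_modular_split] is at most e^p /
   4. *)
pose a := e `^ p / (4 * c `^ p); have a0 : 0 < a by rewrite divr_gt0// mulr_gt0.
pose t := Num.min (1 / 2) (a `^ (nu - mu)^-1).
have t0 : 0 < t by rewrite lt_min powR_gt0// divr_gt0.
have t2 : t <= 1 / 2 by rewrite ge_min lexx.
have ta : t `^ (nu - mu) <= a.
  rewrite -[leRHS](powR_norm nm0 (ltW a0)) ge0_ler_powR ?nnegrE ?powR_ge0 ?(ltW nm0) ?(ltW t0)//.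
  by rewrite ge_min lexx orbT.
pose b := pi * e `^ p / 16; have b0 : 0 < b by rewrite divr_gt0// mulr_gt0// pi_gt0.
pose s := b `^ p^-1; have s0 : 0 < s by rewrite powR_gt0.
have sb : s `^ p = b by rewrite powR_norm// ltW.
pose rho := 1 - t; pose r := (1 + rho) / 2.
have rho0 : 0 < rho by rewrite /rho; lra.
have r01 : 0 < r < 1 by apply/andP; split; rewrite /r /rho; lra.
have [r0 r1] := andP r01.
have [k k0 kP] := coef_bound p1 mu0 r01.
pose q := rho / r; have q01 : 0 <= q < 1.
  by rewrite divr_ge0 ?(ltW r0) ?(ltW rho0)//= ltr_pdivrMr// mul1r /r /rho; lra.
have s2 : 0 < s / 2 by rewrite divr_gt0.
have [K KP] := geometric_small (k * c / (1 - q)) q01 s2.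
(* On |z| <= 1 - t the first [K] terms add up to at most K d <= s/2, and the tail to less than s/2.
   The successor avoids a zero denominator. *)
pose d := s / (2 * K.+1%:R).
have d0 : 0 < d by rewrite divr_gt0// mulr_gt0.
exists K, d; split => // f Hf fc fd.
have fs z : normc z <= 1 - t -> normc (f z) <= s.
  move=> zt; have z1 : normc z < 1 by rewrite (le_lt_trans zt)// gtrBl.
  have zq : normc z <= q * r by rewrite /q mulfVK ?gt_eqF.
  have h := pseries_cvg_geometric_error (kP f c Hf c0 fc) q01 zq (taylorP Hf z1) K.
  have h1 : normc (\sum_(n < K) taylor f n * z ^+ n) <= s / 2.
    apply: le_trans (normc_sum _ _ _) _.
    apply: (@le_trans _ _ (\sum_(n < K) d)).
      apply: ler_sum => n _; rewrite normcM normcX -[leRHS]mulr1.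
      by rewrite ler_pM ?normc_ge0 ?exprn_ge0 ?normc_ge0 ?fd// exprn_ile1 ?normc_ge0// ltW.
    rewrite sumr_const card_ord -[leLHS]mulr_natl /d.
    have K1 : 0 < K.+1%:R :> R by [].
    have KK : K%:R <= K.+1%:R :> R by rewrite ler_nat.
    move: (K%:R) (K.+1%:R) K1 KK => x y y0 xy.
    rewrite mulrA ler_pdivrMr ?mulr_gt0//.
    by have := ler_wpM2r (ltW s0) xy; lra.
  rewrite -[f z]opprK -[- f z](addKr (\sum_(n < K) taylor f n * z ^+ n)) normcN addrC.
  rewrite (le_trans (normcD _ _))// normcN [leRHS]splitr lerD//.
  by rewrite (le_trans h)// ltW// KP.
apply/(bergman_norm_lt _ _ p0 e0).
have t01 : 0 < t < 1 by rewrite t0; lra.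
apply: (le_lt_trans (bergman_modular_split p1 mu0 mn t01 (ltW s0) Hf fs)).
move: fc => /(bergman_norm_lt _ _ p0 c0) fc.
apply: (@le_lt_trans _ _ (a%:E * (c `^ p)%:E + (pi^-1 * (s `^ p * 4))%:E)%E).
  rewrite leeD2r// lee_pmul ?lee_fin ?powR_ge0 ?bergman_modular_ge0//.
  exact: ltW.
rewrite -EFinM -EFinD lte_fin sb.
have -> : a * c `^ p + pi^-1 * (b * 4) = e `^ p / 2.
  rewrite /a /b; move: (@pi R) (pi_gt0 R) => y y0.
  by field; rewrite !gt_eqF.
by rewrite ltr_pdivrMr// ltr_pMr// ltr1n.
Qed.

(** The net is built on the first [K] Taylor coefficients. Differences of elements of the unit ball
    have norm below 2, which is the constant given to [bergman_small]. *)
Lemma bergman_net p mu nu (X : Type) (F : X -> C -> C^o) (D : set X) :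
  1 < p -> 0 < mu -> mu < nu ->
  (forall x, D x -> holo_disc (F x) /\ (bergman_norm p mu (F x) < 1%:E)%E) ->
  forall e : R, 0 < e -> exists S : set X, [/\ finite_set S, S `<=` D &
    forall x, D x -> exists2 s, S s & (bergman_norm p nu (F x - F s)%R < e%:E)%E].
Proof.
move=> p1 mu0 mn DF e e0.
have [K [d [d0 Kd]]] := @bergman_small p mu nu e 2 p1 mu0 mn e0 (ltr0n _ 2).
have half01 : 0 < (1 / 2 : R) < 1 by apply/andP; split; lra.
have [c c0 cP] := coef_bound p1 mu0 half01.
have [|S [Sfin SD Sd]] := @bounded_finite_net R X K (fun i x => taylor (F x) i) D
    (c * 2 ^+ K) d _ d0.
  move=> x i Dx; have [Hx Nx] := DF x Dx.
  have := cP _ _ Hx ltr01 Nx i; rewrite mulr1 div1r exprVn ler_pdivrMr ?exprn_gt0//.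
  move=> h; apply: le_trans h _; rewrite ler_wpM2l ?(ltW c0)//.
  by rewrite ler_eXn2l ?ltr1n// ltnW.
exists S; split => // x Dx; have [s Ss xs] := Sd x Dx; exists s => //.
have [Hx Nx] := DF x Dx; have [Hs Ns] := DF s (SD s Ss).
apply: Kd; first exact: holoB.
  have := bergman_normB p1 Hx Hs ltr01 ltr01 Nx Ns.
  by rewrite -[1 + 1]/(2 : R).
by move=> n nK; rewrite taylorB//; exact: ltW (xs (Ordinal nK)).
Qed.

(** By [coef_bound] the Taylor coefficients converge, with errors uniform in n after multiplication
    by rho^n. The limit coefficients define a holomorphic f, to which the functions converge
    pointwise on the disc. *)
Lemma bergman_complete p mu (fs : nat -> C -> C^o) : 1 < p -> 0 < mu ->
  (forall k, holo_disc (fs k)) ->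
  (forall e : R, 0 < e -> exists K, forall j k, (K <= j)%N -> (K <= k)%N ->
    (bergman_norm p mu (fs j - fs k)%R < e%:E)%E) ->
  exists f, [/\ holo_disc f,
    forall z, normc z < 1 -> forall d : R, 0 < d -> exists K, forall k, (K <= k)%N ->
      normc (fs k z - f z) < d &
    forall e : R, 0 < e -> exists K, forall k, (K <= k)%N ->
      (bergman_norm p mu (fs k - f)%R < e%:E)%E].
Proof.
move=> p1 mu0 Hfs cfs.
have cB j k n : taylor (fs j - fs k) n = taylor (fs j) n - taylor (fs k) n.
  exact: taylorB.
have unif rho : 0 < rho < 1 -> forall e : R, 0 < e -> exists K, forall j k,
    (K <= j)%N -> (K <= k)%N -> forall n,
    normc (taylor (fs j) n - taylor (fs k) n) * rho ^+ n <= e.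
  move=> rho01 e e0; have [c c0 cP] := coef_bound p1 mu0 rho01.
  have [K KP] := cfs (e / c) (divr_gt0 e0 c0); exists K => j k Kj Kk n.
  have := cP _ _ (holoB (Hfs j) (Hfs k)) (divr_gt0 e0 c0) (KP j k Kj Kk) n.
  by rewrite cB mulrC [c * _]mulrC mulfVK ?gt_eqF// mulrC.
have half01 : 0 < (1 / 2 : R) < 1 by apply/andP; split; lra.
have /choice[a aP] n : exists l, forall e : R, 0 < e -> exists K, forall k, (K <= k)%N ->
    normc (taylor (fs k) n - l) < e.
  apply: normc_complete => e e0; have h0 : 0 < (1 / 2 : R) ^+ n by rewrite exprn_gt0// divr_gt0.
  have [K KP] := unif _ half01 (e / 2 * (1 / 2) ^+ n) (mulr_gt0 (divr_gt0 e0 (ltr0n _ 2)) h0).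
  exists K => j k Kj Kk; have := KP j k Kj Kk n; rewrite ler_pM2r// => h.
  by apply: le_lt_trans h _; rewrite ltr_pdivrMr// ltr_pMr// ltr1n.
have lim rho : 0 < rho < 1 -> forall e : R, 0 < e -> exists K, forall k,
    (K <= k)%N -> forall n, normc (taylor (fs k) n - a n) * rho ^+ n <= e.
  move=> rho01 e e0; have [K KP] := unif rho rho01 e e0; exists K => k Kk n.
  apply/ler_addgt0Pr => d d0; have [K' K'P] := aP n d d0.
  pose j := maxn K K'; have jK := KP k j Kk (leq_maxl _ _) n.
  have ja := K'P j (leq_maxr _ _).
  have [/ltW rho0 /ltW rho1] := andP rho01.
  have -> : taylor (fs k) n - a n = (taylor (fs k) n - taylor (fs j) n) +
    (taylor (fs j) n - a n) by ring.
  apply: (le_trans (ler_wpM2r (exprn_ge0 _ rho0) (normcD _ _))).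
  rewrite mulrDl lerD// -[leRHS]mulr1 ler_pM ?normc_ge0 ?exprn_ge0 ?(ltW ja)//.
  exact: exprn_ile1.
have abound rho : 0 < rho < 1 -> exists M, forall n, normc (a n) * rho ^+ n <= M.
  move=> rho01; have [K KP] := lim rho rho01 1 ltr01.
  have [/ltW rho0 rho1] := andP rho01.
  have rho01' : 0 <= rho < 1 by rewrite rho0.
  have [M MP] := taylor_bounded (Hfs K) rho01'; exists (M + 1) => n.
  have -> : a n = taylor (fs K) n - (taylor (fs K) n - a n) by rewrite subKr.
  apply: (le_trans (ler_wpM2r (exprn_ge0 _ rho0) (normcD _ _))).
  by rewrite mulrDl normcN lerD// KP.
have psa z : exists l, (normc z < 1 -> pseries_cvg a z l) /\ (~ disc z -> l = 0).
  have [z1|z1] := ltP (normc z) 1; last by exists 0; split => //; rewrite ltNge z1.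
  have rho01 : 0 < (1 + normc z) / 2 < 1.
    by have := normc_ge0 z => ?; apply/andP; split; lra.
  have [M MP] := abound _ rho01.
  have [|l lP] := pseries_cvg_ex (z := z) MP; first lra.
  by exists l; split.
have [f fP] := choice psa.
have Hf : holo_disc f.
  apply: (@power_series_holo R a) => z; first exact: (fP z).1.
  exact: (fP z).2.
have fsf z : normc z < 1 -> forall d : R, 0 < d -> exists K, forall k, (K <= k)%N ->
    normc (fs k z - f z) < d.
  move=> z1 d d0; pose rho := (1 + normc z) / 2; have z0 := normc_ge0 z.
  have rho01 : 0 < rho < 1 by apply/andP; split; rewrite /rho; lra.
  have [rho0 _] := andP rho01.
  pose q := normc z / rho; have q01 : 0 <= q < 1.
    by rewrite divr_ge0 ?(ltW rho0)//= ltr_pdivrMr// mul1r /rho; lra.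
  have q1 : 0 < 1 - q by rewrite subr_gt0; case/andP: q01.
  have d2 : 0 < d / 2 by rewrite divr_gt0.
  have [K KP] := lim rho rho01 (d / 2 * (1 - q)) (mulr_gt0 d2 q1); exists K => k Kk.
  have := pseries_cvg_geometric_error (KP k Kk) q01 _ (pseries_cvgB (taylorP (Hfs k) z1) ((fP z).1 z1)).
  rewrite mulfVK ?gt_eqF// => /(_ (lexx _) 0%N).
  rewrite big_ord0 sub0r normcN expr0 mulr1 mulfK ?gt_eqF// => h.
  by apply: le_lt_trans h _; rewrite ltr_pdivrMr// ltr_pMr// ltr1n.
exists f; split => // e e0; have e2 : 0 < e / 2 by rewrite divr_gt0.
have [K KP] := cfs _ e2; exists K => k Kk.
apply: (@le_lt_trans _ _ (e / 2)%:E); last first.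
  by rewrite lte_fin ltr_pdivrMr// ltr_pMr// ltr1n.
(* Pointwise convergence is upgraded to norm convergence: with k fixed, the Cauchy bound survives
   the limit in j. *)
apply: (@bergman_norm_lim p mu (fun j => fs k - fs (K + j)%N) (fs k - f)) => //.
- by move=> j; exact: holoB.
- exact: holoB.
- move=> z z1 d d0; have [K' K'P] := fsf z z1 d d0; exists K' => j Kj.
  have -> : (fs k - fs (K + j)%N) z - (fs k - f) z = - (fs (K + j)%N z - f z).
    by rewrite !fctE; ring.
  by rewrite normcN K'P// (leq_trans Kj)// leq_addl.
- by move=> j; apply: KP => //; exact: leq_addr.
Qed.

End bergman_estimates.

(** * The two limit spaces *)

Section bergman_plus_frechet.
Variables (R : realType) (p alpha : R) (p1 : 1 < p) (alpha0 : 0 < alpha).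
Local Notation C := R[i].
Local Notation E := (bergman_plus p1 alpha0).

Let p0 : 0 < p. Proof. by rewrite (lt_trans _ p1). Qed.

Let weight (n : nat) : R := alpha + n.+1%:R^-1.

Let weight_gt n : alpha < weight n.
Proof. by rewrite ltrDl invr_gt0. Qed.

Let weight_gt0 n : 0 < weight n.
Proof. exact: lt_trans (weight_gt n). Qed.

Let weight_lt m n : (m < n)%N -> weight n < weight m.
Proof. by move=> mn; rewrite ltrD2l ltf_pV2 ?posrE// ltr_nat ltnS. Qed.

Lemma plus_holo (f : E) : holo_disc (val f).
Proof. exact: bergman_plus_holo. Qed.

Definition plus_norm (n : nat) (f : E) : R :=
  fine (bergman_norm p (alpha + n.+1%:R^-1) (val f)).

Lemma plus_normE n (f : E) : (bergman_norm p (weight n) (val f) = (plus_norm n f)%:E)%E.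
Proof.
rewrite /plus_norm fineK// ge0_fin_numE ?bergman_norm_ge0//.
exact: (bergman_plusP f (weight_gt n)).2.
Qed.

Lemma plus_norm_lt n (f : E) (e : R) :
  (bergman_norm p (weight n) (val f) < e%:E)%E <-> plus_norm n f < e.
Proof. by rewrite plus_normE lte_fin. Qed.

Lemma plus_norm_ge0 n (f : E) : 0 <= plus_norm n f.
Proof. by rewrite -lee_fin -plus_normE bergman_norm_ge0. Qed.

Lemma plus_seminorms : seminorms plus_norm.
Proof.
split.
- move=> n f g; apply/ler_addgt0Pr => e e0; have e2 : 0 < e / 2 by rewrite divr_gt0.
  have pos h : 0 < plus_norm n h + e / 2 by rewrite ltr_wpDl ?plus_norm_ge0.
  have lt h : (bergman_norm p (weight n) (val h) < (plus_norm n h + e / 2)%:E)%E.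
    by apply/plus_norm_lt; rewrite ltrDl.
  have := bergman_normD p1 (plus_holo f) (plus_holo g) (pos f) (pos g) (lt f) (lt g).
  by move=> /(plus_norm_lt n (f + g)) /ltW; rewrite addrACA -splitr.
- move=> n a f; apply/eqP; rewrite -eqe EFinM -!plus_normE.
  by apply/eqP; exact: bergman_norm_scale (plus_holo f).
- move=> m n f mn; rewrite -lee_fin -!plus_normE.
  apply: bergman_norm_mono => //; first exact: plus_holo.
  by rewrite lerD2l lef_pV2 ?posrE// ler_nat ltnS.
Qed.

Lemma plus_nbhs (x : E) (A : set E) :
  nbhs x A <-> exists n (e : R), 0 < e /\ forall y, plus_norm n (y - x) < e -> A y.
Proof.
split=> [[U [n [e [e0 ->]]] UA]|[n [e [e0 qA]]]].
  exists n, e; split => // y /plus_norm_lt yx.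
  by have := UA _ yx; rewrite addrC subrK.
exists [set f | (bergman_norm p (weight n) (val f) < e%:E)%E]; first by exists n, e.
move=> u /= /plus_norm_lt ue; apply: qA.
by rewrite addrAC subrr add0r.
Qed.

Lemma plus_eq0 (f : E) : (forall z, normc z < 1 -> val f z = 0) -> f = 0.
Proof.
move=> f0; apply: val_inj; apply/funext => z.
have [z1|z1] := ltP (normc z) 1; first exact: f0.
by apply: (plus_holo f).2; rewrite /disc /mkset ltNge z1.
Qed.

Lemma plus_separated (f : E) : (forall n, plus_norm n f = 0) -> f = 0.
Proof.
move=> f0; apply: plus_eq0 => z z1; apply: normc_small => e e0.
have [c c0 cP] := point_bound p1 (weight_gt0 0) z1.
have := cP _ (e / c) (plus_holo f) (divr_gt0 e0 c0).
rewrite [c * _]mulrC mulfVK ?gt_eqF//; apply.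
by apply/plus_norm_lt; rewrite f0 divr_gt0.
Qed.

(** Each weight yields its own limit; all of them are pointwise limits of the same sequence, hence
    equal to the one for the first weight. *)
Lemma plus_sequentially_complete (x : nat -> E) :
  (forall n (e : R), 0 < e -> exists K, forall j k, (K <= j)%N -> (K <= k)%N ->
    plus_norm n (x j - x k) < e) ->
  exists l, forall n (e : R), 0 < e -> exists K, forall k, (K <= k)%N ->
    plus_norm n (x k - l) < e.
Proof.
move=> cx; pose fs k : C -> C^o := val (x k).
have Hfs k : holo_disc (fs k) := plus_holo (x k).
have lim n : exists f, [/\ holo_disc f,
    forall z, normc z < 1 -> forall d : R, 0 < d -> exists K, forall k, (K <= k)%N ->
      normc (fs k z - f z) < d &
    forall e : R, 0 < e -> exists K, forall k, (K <= k)%N ->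
      (bergman_norm p (weight n) (fs k - f)%R < e%:E)%E].
  apply: bergman_complete => // e e0; have [K KP] := cx n e e0.
  by exists K => j k Kj Kk; apply/(plus_norm_lt n (x j - x k)); exact: KP.
have [f [Hf ff fN]] := lim 0%N.
have fall n e : 0 < e -> exists K, forall k, (K <= k)%N ->
    (bergman_norm p (weight n) (fs k - f)%R < e%:E)%E.
  have [g [Hg fg gN]] := lim n; suff -> : f = g by exact: gN.
  apply/funext => z; have [z1|z1] := ltP (normc z) 1; last first.
    by rewrite Hf.2 ?Hg.2// /disc /mkset ltNge z1.
  apply/eqP; rewrite -subr_eq0; apply/eqP; apply: normc_small => d d0.
  have d2 : 0 < d / 2 by rewrite divr_gt0.
  have [K KP] := ff z z1 _ d2; have [K' K'P] := fg z z1 _ d2.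
  have -> : f z - g z = (fs (maxn K K') z - g z) - (fs (maxn K K') z - f z) by ring.
  rewrite (le_trans (normcD _ _))// normcN [leRHS]splitr lerD// ltW//.
    exact: K'P (leq_maxr _ _).
  exact: KP (leq_maxl _ _).
have fE : f \in bergman_plus_pred p1 alpha0.
  rewrite inE => mu amu.
  have [n /(_ n (leqnn n)) nmu] : exists n, forall k, (n <= k)%N -> k.+1%:R^-1 < mu - alpha.
    by apply: ltr_invS; rewrite subr_gt0.
  have wmu : weight n <= mu by rewrite /weight -lerBrDl ltW.
  split => //; apply: le_lt_trans (bergman_norm_mono p0 Hf wmu) _.
  have [K /(_ K (leqnn K)) KP] := fall n 1 ltr01.
  have := bergman_normB p1 (Hfs K) (holoB (Hfs K) Hf) _ ltr01 _ KP.
  rewrite subKr.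
  have fs0 : 0 < plus_norm n (x K) + 1 by rewrite ltr_wpDl ?plus_norm_ge0.
  have fsK : (bergman_norm p (weight n) (fs K) < (plus_norm n (x K) + 1)%:E)%E.
    by apply/(plus_norm_lt n (x K)); rewrite ltrDl.
  by move=> /(_ _ fs0 fsK) /lt_trans; apply; exact: ltry.
exists (Sub f fE : bergman_plus_lmod p1 alpha0) => n e e0.
have [K KP] := fall n e e0; exists K => k Kk.
by apply/plus_norm_lt; exact: KP.
Qed.

Theorem bergman_plus_frechet_schwartz : frechet_schwartz_space E.
Proof.
split; last first.
  (* The weights decrease with n, so the unit ball of [plus_norm n.+1] is precompact for
     [plus_norm n]. *)
  apply: (seminorms_schwartz plus_seminorms plus_nbhs) => n; exists n.+1 => e e0.
  have [|S [Sfin SD SP]] := @bergman_net R p (weight n.+1) (weight n) E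
    (fun f => val f) [set f | plus_norm n.+1 f < 1] p1 (weight_gt0 _)
    (weight_lt (ltnSn n)) _ e e0.
    by move=> f /= f1; split; [exact: plus_holo|exact/plus_norm_lt].
  exists S => // f f1; have [s Ss fs] := SP f f1; exists s => //.
  exact/plus_norm_lt.
split; first exact: (seminorms_metrizable plus_seminorms plus_nbhs plus_separated).
exact: (seminorms_complete plus_seminorms plus_nbhs plus_sequentially_complete).
Qed.

End bergman_plus_frechet.

Lemma ultra_seq (T : Type) (G : set_system T) (I : eqType) (s : seq I) (A : I -> set T) :
  UltraFilter G -> G [set x | exists2 i, i \in s & A i x] ->
  exists2 i, i \in s & G (A i).
Proof.
move=> GU; have GF : ProperFilter G by exact: ultra_proper.
elim: s => [|i s IH] GA.
  by have [x []] := filter_ex GA.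
have [GAi|GAi] := in_ultra_setVsetC (A i) GU; first by exists i => //; exact: mem_head.
have [|j js GAj] := IH.
  apply: filterS2 GA GAi => x [j]; rewrite in_cons => /predU1P[->|js] Aj nAi //.
  by exists j.
by exists j => //; rewrite in_cons js orbT.
Qed.

Section bergman_minus_dfs.
Variables (R : realType) (p alpha : R) (p1 : 1 < p) (alpha0 : 0 < alpha).
Local Notation C := R[i].
Local Notation E := (bergman_minus p1 alpha0).

Let p0 : 0 < p. Proof. by rewrite (lt_trans _ p1). Qed.

(** A sequence cofinal in ]0, alpha[ that is positive from n = 0 on whatever [alpha] is, unlike
    alpha - 1/(n+1). *)
Let weight (n : nat) : R := alpha * (1 - n.+2%:R^-1).

Let weight_gt0 n : 0 < weight n.
Proof. by rewrite mulr_gt0// subr_gt0 invf_lt1// ltr1n. Qed.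

Let weight_lt n : weight n < alpha.
Proof. by rewrite gtr_pMr// gtrBl invr_gt0. Qed.

Let weight_mono m n : (m < n)%N -> weight m < weight n.
Proof. by move=> mn; rewrite ltr_pM2l// ltrD2l ltrN2 ltf_pV2 ?posrE// ltr_nat !ltnS. Qed.

Let weight_cofinal mu : mu < alpha -> exists n, mu <= weight n.
Proof.
move=> mua; have e0 : 0 < (alpha - mu) / alpha by rewrite divr_gt0// subr_gt0.
have [n /(_ n.+1 (leqnSn n)) nmu] := ltr_invS e0; exists n.
rewrite /weight mulrBr mulr1 lerBrDr -lerBrDl ltW//.
by rewrite -ltr_pdivlMl// mulrC.
Qed.

Lemma minus_holo (f : E) : holo_disc (val f).
Proof. exact: bergman_minus_holo. Qed.

Lemma minus_valD (f g : E) : val (f + g) = val f + val g :> (C -> C^o).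
Proof. by []. Qed.

Lemma minus_valZ (a : C) (f : E) : val (a *: f) = a *: val f :> (C -> C^o).
Proof. by []. Qed.

Definition minus_ball (n : nat) : set E :=
  [set f | (bergman_norm p (alpha * (1 - n.+2%:R^-1)) (val f) < 1%:E)%E].

Lemma minus_scale mu (s : R) (f : E) : 0 <= s ->
  (bergman_norm p mu (val (s%:C%C *: f)) = s%:E * bergman_norm p mu (val f))%E.
Proof.
move=> s0; rewrite minus_valZ (bergman_norm_scale _ _ p0 (minus_holo f)).
by rewrite normc_real.
Qed.

Lemma minus_scale_lt1 mu (s : R) (f : E) : 0 < s ->
  (bergman_norm p mu (val (s^-1%:C%C *: f)) < 1%:E)%E <->
  (bergman_norm p mu (val f) < s%:E)%E.
Proof.
move=> s0; rewrite minus_scale ?invr_ge0 ?(ltW s0)//.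
have -> : (1%:E = s^-1%:E * s%:E :> \bar R)%E by rewrite -EFinM mulVf ?gt_eqF.
by rewrite lte_pmul2l// ?lte_fin ?invr_gt0.
Qed.

Lemma minus_ball_absconvex n : absconvex (minus_ball n).
Proof.
split.
  move=> f g t /set_mem ft /set_mem gt; apply/mem_set.
  change (minus_ball n (t%:num *: (f : E) + (1 - t%:num) *: (g : E))).
  rewrite /minus_ball /mkset minus_valD !minus_valZ.
  apply: (bergman_ball_conv t p1 ltr01 (minus_holo f) (minus_holo g) ft gt).
move=> a f a1 fe; rewrite /minus_ball /mkset minus_valZ.
apply: (bergman_ball_balanced p0 (minus_holo f) a1 fe).
Qed.

Lemma minus_ball0 n : minus_ball n 0.
Proof.
have := @minus_scale (weight n) 0 0 (lexx _); rewrite scale0r mul0e => h.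
by rewrite /minus_ball /mkset -/(weight n) h lte_fin ltr01.
Qed.

Lemma minus_ball_mono m n : (m <= n)%N -> minus_ball m `<=` minus_ball n.
Proof.
rewrite leq_eqVlt => /predU1P[->//|mn] f; apply: le_lt_trans.
by apply: bergman_norm_mono; [|exact: minus_holo|exact/ltW/weight_mono].
Qed.

Lemma minus_ball_cover (f : E) : exists n, exists2 r : R, 0 < r & minus_ball n (r%:C%C *: f).
Proof.
have [mu [mu0 mua [Hf nf]]] := bergman_minusP f; have [n mun] := weight_cofinal mua.
have {}nf : (bergman_norm p (weight n) (val f) < +oo)%E.
  by apply: le_lt_trans nf; exact: bergman_norm_mono.
have [e e0 fe] := bergman_norm_fin nf.
exists n, e^-1; first by rewrite invr_gt0.
exact/minus_scale_lt1.
Qed.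

Lemma minus_ball_bounded n (U : set E) : nbhs 0 U ->
  exists2 r : R, 0 < r & forall f, minus_ball n f -> U (r%:C%C *: f).
Proof.
move=> nU; have [e e0 eU] := bergman_minus_incl (weight_gt0 n) (weight_lt n) nU.
exists e => // f f1; apply: eU; rewrite minus_scale ?(ltW e0)//.
by rewrite -[ltRHS]mule1 lte_pmul2l ?lte_fin.
Qed.

Lemma minus_ball_finest (U : set E) : absconvex U ->
  (forall n, exists2 r : R, 0 < r & forall f, minus_ball n f -> U (r%:C%C *: f)) ->
  nbhs 0 U.
Proof.
move=> acU BU; exists U; last by move=> u; rewrite add0r.
split => // mu mu0 mua; have [n mun] := weight_cofinal mua.
have [r r0 rU] := BU n; exists r => // f fr.
have -> : f = r%:C%C *: (r^-1%:C%C *: f) by rewrite scaleRA mulfV ?gt_eqF// scale1r.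
apply: rU; apply/minus_scale_lt1 => //; apply: le_lt_trans fr.
by apply: bergman_norm_mono => //; exact: minus_holo.
Qed.

Lemma minus_net n (e : R) : 0 < e -> exists S : set E, [/\ finite_set S,
  S `<=` minus_ball n &
  forall f, minus_ball n f -> exists2 s, S s &
    (bergman_norm p (weight n.+1) (val (f - s)%R) < e%:E)%E].
Proof.
apply: (@bergman_net R p (weight n) (weight n.+1) E (fun f => val f)) => //.
  exact: weight_mono.
by move=> f f1; split => //; exact: minus_holo.
Qed.

Lemma minus_ball_precompact n : exists m, forall e : R, 0 < e ->
  exists S : set E, [/\ finite_set S, S `<=` minus_ball n &
    forall f, minus_ball n f -> exists s y, [/\ S s, minus_ball m y & f = s + e%:C%C *: y]].
Proof.
exists n.+1 => e e0; have [S [Sfin SB SP]] := minus_net n e0.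
exists S; split => // f /SP[s Ss fs]; exists s, (e^-1%:C%C *: (f - s)); split => //.
  exact/minus_scale_lt1.
by rewrite scaleRA mulfV ?gt_eqF// scale1r addrC subrK.
Qed.

Lemma minus_normB_trans mu (f g h : E) (a b : R) : 0 < a -> 0 < b ->
  (bergman_norm p mu (val (f - g)%R) < a%:E)%E -> (bergman_norm p mu (val (g - h)%R) < b%:E)%E ->
  (bergman_norm p mu (val (f - h)%R) < (a + b)%:E)%E.
Proof.
move=> a0 b0 fg gh.
have := bergman_normD p1 (minus_holo (f - g)) (minus_holo (g - h)) a0 b0 fg gh.
by rewrite -minus_valD addrA subrK.
Qed.

Lemma minus_norm_sym mu (f g : E) :
  (bergman_norm p mu (val (f - g)%R) = bergman_norm p mu (val (g - f)%R))%E.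
Proof.
have -> : g - f = (- 1) *: (f - g) by rewrite scaleN1r opprB.
rewrite minus_valZ (bergman_norm_scale _ _ p0 (minus_holo (f - g))).
by rewrite normcN normc_real// mul1e.
Qed.

(** An ultrafilter on a precompact set is Cauchy, here for the norm of weight index n + 1. That step
    is complete and its inclusion is continuous, so the limit found there is a limit in E. *)
Lemma minus_ball_compact n (G : set_system E) : UltraFilter G -> G (minus_ball n) ->
  exists f : E, G --> f.
Proof.
move=> GU GB; have GF : ProperFilter G by exact: ultra_proper.
pose mu := weight n.+1.
have /choice[A AP] k : exists A, [/\ G A, A `<=` minus_ball n &
    forall f g, A f -> A g -> (bergman_norm p mu (val (f - g)%R) < k.+1%:R^-1%:E)%E].
  have k0 : 0 < (k.+1%:R^-1 / 2 : R) by rewrite divr_gt0// invr_gt0.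
  have [S [/finite_seqP[s ->] SB SP]] := minus_net n k0.
  (* The ball is covered by finitely many balls of radius half of 1/(k+1); the ultrafilter contains
     one of them, and two of its points are at distance below 1/(k+1). *)
  have [|c cs Gc] := @ultra_seq E G E s
      (fun c => [set f | (bergman_norm p mu (val (f - c)%R) < (k.+1%:R^-1 / 2)%:E)%E]) GU.
    apply: filterS GB => f /SP[c cs fc]; exists c => //.
  exists ([set f | (bergman_norm p mu (val (f - c)%R) < (k.+1%:R^-1 / 2)%:E)%E] `&`
    minus_ball n); split => [|f []//|f g [fc _] [gc _]]; first exact: filterI.
  rewrite [X in (_ < X%:E)%E](splitr k.+1%:R^-1).
  by apply: (minus_normB_trans k0 k0 fc); rewrite minus_norm_sym.
have /choice[x xP] k : exists x, forall i, (i <= k)%N -> A i x.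
  have : G [set x | forall i, (i <= k)%N -> A i x].
    elim: k => [|k IH].
      by have [GA0 _ _] := AP 0%N; apply: filterS GA0 => x Ax i; rewrite leqn0 => /eqP ->.
    have [GAk _ _] := AP k.+1; apply: filterS2 IH GAk => x Ax Ak i.
    by rewrite leq_eqVlt => /predU1P[->//|]; rewrite ltnS; exact: Ax.
  by move=> /filter_ex.
have [|f [Hf _ fN]] := @bergman_complete R p mu (fun k => val (x k)) p1 (weight_gt0 _)
    (fun k => minus_holo (x k)).
  move=> e e0; have [K KP] := ltr_invS e0; exists K => j k Kj Kk.
  apply: (@lt_trans _ _ (K.+1%:R^-1)%:E); last by rewrite lte_fin KP.
  by have [_ _ AK] := AP K; apply: AK; apply: xP.
have fE : f \in bergman_minus_pred p1 alpha0.
  rewrite inE; exists mu; split; [exact: weight_gt0|exact: weight_lt|split => //].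
  have [K /(_ K (leqnn K)) KP] := fN 1 ltr01.
  have [_ AB _] := AP K; have xB := AB _ (xP K K (leqnn K)).
  have xmu := minus_ball_mono (leqnSn n) xB.
  have := bergman_normB p1 (minus_holo (x K)) (holoB (minus_holo (x K)) Hf) ltr01 ltr01 xmu KP.
  by rewrite subKr => /lt_trans; apply; exact: ltry.
exists (Sub f fE : bergman_minus_lmod p1 alpha0) => B nB.
have nB0 : nbhs (0 : E) [set y | B ((Sub f fE : bergman_minus_lmod p1 alpha0) + y)].
  move: nB => [U BU UB]; exists U => // u Uu; rewrite add0r; exact: UB.
have [e e0 eB] := bergman_minus_incl (weight_gt0 n.+1) (weight_lt n.+1) nB0.
have e2 : 0 < e / 2 by rewrite divr_gt0.
have [K KP] := fN _ e2; have [K' K'P] := ltr_invS e2.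
have [GA _ AK] := AP K'; apply: filterS GA => y Ay.
set F : E := Sub f fE; pose k := maxn K K'.
have -> : y = F + (y - F) by rewrite addrC subrK.
apply: eB; rewrite [X in (_ < X%:E)%E](splitr e).
apply: (@minus_normB_trans _ y (x k) F) => //; last exact: KP (leq_maxl _ _).
apply: (@lt_trans _ _ (K'.+1%:R^-1)%:E); last by rewrite lte_fin K'P.
by apply: AK => //; apply: xP; exact: leq_maxr.
Qed.

(** Evaluation at a point where f does not vanish is bounded on each ball by [point_bound], so a
    small sublevel set of its modulus is a neighbourhood of 0. *)
Lemma minus_hausdorff (f : E) : f != 0 -> exists2 U : set E, nbhs 0 U & ~ U f.
Proof.
move=> fn0; have [z z1 fz] : exists2 z, normc z < 1 & normc (val f z) != 0.
  apply: contrapT => nz; move/eqP: fn0; apply.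
  apply: val_inj; apply/funext => z; have [z1|z1] := ltP (normc z) 1; last first.
    by apply: (minus_holo f).2; rewrite /disc /mkset ltNge z1.
  apply: contrapT => fz; apply: nz; exists z => //.
  by apply/eqP => /ComplexField.Normc.eq0_normc.
have {}fz : 0 < normc (val f z) by rewrite lt_neqAle eq_sym fz normc_ge0.
have lin : linear (fun g : E => val g z : C^o) by [].
have ac := absconvex_preim (normc (val f z) / 2) lin.
exists [set g | normc (val g z) <= normc (val f z) / 2].
  apply: (minus_ball_finest ac) => n.
  have [c c0 cP] := point_bound p1 (weight_gt0 n) z1.
  pose r := normc (val f z) / 2 / c; have r0 : 0 < r by rewrite !divr_gt0.
  exists r => // g g1.
  have := cP _ _ (minus_holo g) ltr01 g1; rewrite mulr1 => gc.
  change (normc (r%:C%C * (val g z : C)) <= normc (val f z) / 2).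
  rewrite normcM normc_real ?(ltW r0)//.
  by rewrite mulrAC ler_pdivrMr// ler_pM2l// divr_gt0.
by rewrite /= leNgt ltr_pdivrMr// ltr_pMr// ltr1n.
Qed.

Theorem bergman_minus_dfs : dfs_space E.
Proof.
apply: (@dfs_of_compact_steps R E minus_ball).
- exact: minus_ball_absconvex.
- exact: minus_ball0.
- exact: minus_ball_mono.
- exact: minus_ball_cover.
- exact: minus_ball_bounded.
- exact: minus_ball_finest.
- exact: minus_ball_precompact.
- exact: minus_ball_compact.
- exact: minus_hausdorff.
Qed.

End bergman_minus_dfs.

Theorem corollary3p2 (R : realType) (p alpha : R)
    (p1 : 1 < p) (alpha0 : 0 < alpha) :
  frechet_schwartz_space (bergman_plus p1 alpha0) /\
  dfs_space (bergman_minus p1 alpha0).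
Proof.
split; first exact: bergman_plus_frechet_schwartz.
exact: bergman_minus_dfs.
Qed.
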